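(* Suppose the following hold. (A1) $\mathbb M$ is bounded on $L^2$; there exist positive functions $\phi,\phi^*\in L^2$ and a scalar $\rho>0$ with $\mathbb M\phi=\rho\phi$ and $\mathbb M^*\phi^*=\rho\phi^*$; $\phi$ and $\phi^*$ are the unique (up to scale) positive solutions in $L^2$ of these two problems; $\rho$ is a simple and isolated eigenvalue of $\mathbb M$ and is the largest eigenvalue of $\mathbb M$; and, when $\phi,\phi^*$ are scaled so that $\mathbb E[\phi(X_t)\phi^*(X_t)]=1$, $\lim_{\tau\to\infty}\rho^{-\tau}\mathbb M_\tau\psi(x)=\mathbb E[\psi(X_t)\phi^*(X_t)]\,\phi(x)$ for all $\psi\in L^2$. (A2) $\|\Pi_k\mathbb M-\mathbb M\|=o(1)$. (A3) $\|\widehat{\mathbf G}^o-\mathbf I\|=o_p(1)$ and $\|\widehat{\mathbf M}^o-\mathbf M^o\|=o_p(1)$. (A4) (a) $\|\Pi_k\phi-\phi\|=o(n^{-1/2})$ and $\|\Pi_k\phi^*-\phi^*\|=o(n^{-1/2})$; (b) $\|\widehat{\mathbf G}^o-\mathbf I\|=o_p(n^{-1/4})$ and $\|\widehat{\mathbf M}^o-\mathbf M^o\|=o_p(n^{-1/4})$; (c) $\mathbb E[(\phi^*(X_t)m(X_t,X_{t+1})\phi(X_{t+1}))^2]<\infty$. Normalize $\|\phi\|=1$, $\langle\phi,\phi^*\rangle=1$, and let $\psi_{\rho,t}=\phi^*(X_t)m(X_t,X_{t+1})\phi(X_{t+1})-\rho\,\phi^*(X_t)\phi(X_t)$ and $\psi_{lm,t}=\log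 m(X_t,X_{t+1})-\mathbb E[\log m(X_t,X_{t+1})]$. (A5) $\frac1{\sqrt n}\sum_{t=0}^{n-1}(\psi_{\rho,t},\psi_{lm,t})'\to_dN(0,W)$ for some finite matrix $W$. Let $L=\log\rho-\mathbb E[\log m(X_t,X_{t+1})]$ and $\hat L=\log\hat\rho-\frac1n\sum_{t=0}^{n-1}\log m(X_t,X_{t+1})$. Then $\sqrt n(\hat L-L)\to_dN(0,V_L)$, where $V_L=\hbar'W\hbar$ and $\hbar=(\rho^{-1},-1)'$.
   Context: $X=\{X_t:t=0,1,2,\dots\}$ is a time-homogeneous, strictly stationary and ergodic first-order Markov process with values in $\mathcal X\subseteq\mathbb R^d$ and stationary distribution $Q$. $m:\mathcal X^2\to(0,\infty)$ is a known measurable function with $\mathbb E[\log m(X_t,X_{t+1})]$ finite. $L^2$ is the space of $\psi:\mathcal X\to\mathbb R$ with $\int\psi^2\,dQ<\infty$, with norm $\|\cdot\|$ and inner product $\langle\cdot,\cdot\rangle$; functions are identified $Q$-a.e., and ''positive'' means positive $Q$-a.e. The operator $\mathbb M\psi(x)=\mathbb E[m(X_t,X_{t+1})\psi(X_{t+1})\mid X_t=x]$ acts on $L^2$; $\mathbb M_\tau=\mathbb M^\tau$; $\mathbb M^*$ is its adjoint. $\|\cdot\|$ also denotes the operator norm on $L^2$ and the operator norm (largest singular value) of matrices. An eigenvalue is simple if it has a unique eigenfunction up to scale, and isolated if some neighborhood of it contains no other point of the spectrum. Sieve: for each $k$, $b_{k1},\dots,b_{kk}\in L^2$ are linearly independent,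 $B_k$ is their linear span, $b^k(x)=(b_{k1}(x),\dots,b_{kk}(x))'$, and $\Pi_k:L^2\to B_k$ is the orthogonal projection. The dimension $k=k(n)\to\infty$ as $n\to\infty$. $\mathbf G=\mathbb E[b^k(X_t)b^k(X_t)']$ (nonsingular) and $\mathbf M=\mathbb E[b^k(X_t)m(X_t,X_{t+1})b^k(X_{t+1})']$. From data $X_0,\dots,X_n$, $\widehat{\mathbf G}=\frac1n\sum_{t=0}^{n-1}b^k(X_t)b^k(X_t)'$ and $\widehat{\mathbf M}=\frac1n\sum_{t=0}^{n-1}b^k(X_t)m(X_t,X_{t+1})b^k(X_{t+1})'$. $\hat\rho$ is the largest real generalized eigenvalue of $(\widehat{\mathbf M},\widehat{\mathbf G})$ (well defined with probability approaching one). $\mathbf M^o=\mathbf G^{-1/2}\mathbf M\mathbf G^{-1/2}$, $\widehat{\mathbf G}^o=\mathbf G^{-1/2}\widehat{\mathbf G}\mathbf G^{-1/2}$, $\widehat{\mathbf M}^o=\mathbf G^{-1/2}\widehat{\mathbf M}\mathbf G^{-1/2}$; $\mathbf I$ is the $k\times k$ identity. *)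

(* Defs.v *)
From HB Require Import structures.
From mathcomp Require Import all_boot all_order all_algebra.
From mathcomp Require Import all_classical all_reals all_analysis.

Set Implicit Arguments.
Unset Strict Implicit.
Unset Printing Implicit Defensive.

Import Order.TTheory GRing.Theory Num.Theory.
Import numFieldNormedType.Exports.

Local Open Scope classical_set_scope.
Local Open Scope ring_scope.

(* A set E of points of R^d as a measurable type, with the trace of the Borel
   sigma-algebra. Measurable types are pointed in the library, hence the
   argument x0, which serves no other purpose. *)
Definition subspace_pt (R : realType) (d : nat)
  (E : set (d.-tuple (measurableTypeR R))) (x0 : E) : Type := E.

HB.instance Definition _ (R : realType) (d : nat)
    (E : set (d.-tuple (measurableTypeR R))) (x0 : E) :=
  Choice.copy (subspace_pt x0) E.
HB.instance Definition _ (R : realType) (d : nat)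
    (E : set (d.-tuple (measurableTypeR R))) (x0 : E) :=
  isPointed.Build (subspace_pt x0) x0.

Definition borel_subspace (R : realType) (d : nat)
    (E : set (d.-tuple (measurableTypeR R))) (x0 : E) :=
  g_sigma_algebra_preimageType
    (fun x : subspace_pt x0 => set_val x : d.-tuple (measurableTypeR R)).

Section process.
Context {R : realType} {dO : measure_display} {Om : measurableType dO}
  {dS : measure_display} {S : measurableType dS}.
Variables (P : probability Om R) (X : nat -> Om -> S).

(* The sigma-algebra generated by X_0, ..., X_t. *)
Definition history (t : nat) : set (set Om) :=
  <<s [set E | exists s B, [/\ (s <= t)%N, measurable B & E = X s @^-1` B]] >>.

(* P(X_{t+1} \in B | X_0, ..., X_t) = kappa (X_t, B), with the same transition
   kernel kappa at every date t. *)
Definition homogeneous_markov (kappa : R.-pker S ~> S) : Prop :=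
  forall (t : nat) (E : set Om) (B : set S), history t E -> measurable B ->
    P (E `&` X t.+1 @^-1` B) = (\int[P]_(w in E) kappa (X t w) B)%E.

Definition path_measurable : set (set (nat -> S)) :=
  <<s [set C | exists t B, measurable B /\ C = (fun u => u t) @^-1` B] >>.

Definition strictly_stationary : Prop :=
  forall A, path_measurable A ->
    P [set w | A (fun t => X t.+1 w)] = P [set w | A (fun t => X t w)].

Definition ergodic_process : Prop :=
  forall A, path_measurable A -> [set u | A (fun t => u t.+1)] = A ->
    P [set w | A (fun t => X t w)] = 0%E \/
    P [set w | A (fun t => X t w)] = 1%E.

End process.

(* Functions in L^2(Q) are represented by the elements of Lfun Q 2; equality
   in L^2(Q) is then equality Q-almost everywhere. Operators on L^2(Q) are
   represented by maps on functions, only used on Lfun Q 2. *)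
Section L2.
Context {R : realType} {dS : measure_display} {S : measurableType dS}.
Variable Q : probability S R.
Implicit Types (f g psi : S -> R) (A B : (S -> R) -> (S -> R)).

Definition L2 : set (S -> R) := [set f | f \in Lfun Q 2%:E].

Definition L2norm f : R := fine (Lnorm Q 2%:E (EFin \o f)).

Definition inner f g : R := \int[Q]_x (f x * g x).

Definition ae_positive f : Prop := {ae Q, forall x, 0 < f x}.

Definition bounded_op A : Prop :=
  exists C : R, forall f, L2 f -> L2 (A f) /\ L2norm (A f) <= C * L2norm f.

Definition opnorm A : \bar R :=
  ereal_sup [set Lnorm Q 2%:E (EFin \o A f) |
             f in [set f | L2 f /\ L2norm f <= 1]].

Definition is_adjoint A B : Prop :=
  forall f g, L2 f -> L2 g -> L2 (B g) /\ inner (A f) g = inner f (B g).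

Definition eigenfunction A (l : R) f : Prop :=
  [/\ L2 f, ~ (f = cst 0 %[ae Q]) & A f = (fun x => l * f x) %[ae Q]].

Definition eigenvalue_op A (l : R) : Prop := exists f, eigenfunction A l f.

Definition simple_eigenvalue A (l : R) : Prop :=
  eigenvalue_op A l /\
  forall f g, eigenfunction A l f -> eigenfunction A l g ->
    exists c : R, g = (fun x => c * f x) %[ae Q].

Definition largest_eigenvalue A (l : R) : Prop :=
  eigenvalue_op A l /\ forall l', eigenvalue_op A l' -> l' <= l.

(* The spectrum is that of the complexification of A. The equation
   (A - (a + i b)) (u + i v) = f + i g reads, in real and imaginary parts,
   A u - a u + b v = f and A v - a v - b u = g. The point a + i b is in the
   resolvent set if A - (a + i b) is a bijection with a bounded inverse. *)
Definition resolvent_eq A (a b : R) (u v f g : S -> R) : Prop :=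
  (fun x => A u x - a * u x + b * v x) = f %[ae Q] /\
  (fun x => A v x - a * v x - b * u x) = g %[ae Q].

Definition resolvent_set A (a b : R) : Prop :=
  (forall u v, L2 u -> L2 v -> resolvent_eq A a b u v (cst 0) (cst 0) ->
     u = cst 0 %[ae Q] /\ v = cst 0 %[ae Q]) /\
  (exists C : R, forall f g, L2 f -> L2 g ->
     exists u v, [/\ L2 u, L2 v, resolvent_eq A a b u v f g &
       L2norm u + L2norm v <= C * (L2norm f + L2norm g)]).

Definition isolated_eigenvalue A (l : R) : Prop :=
  eigenvalue_op A l /\
  exists2 e : R, 0 < e &
    forall a b : R, ~ resolvent_set A a b ->
      Num.sqrt ((a - l) ^+ 2 + b ^+ 2) < e -> a = l /\ b = 0.

Definition lin_indep k (b : 'I_k -> S -> R) : Prop :=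
  forall c : 'I_k -> R,
    (fun x => \sum_i c i * b i x) = cst 0 %[ae Q] -> forall i, c i = 0.

Definition lin_span k (b : 'I_k -> S -> R) : set (S -> R) :=
  [set f | exists c : 'I_k -> R, f = fun x => \sum_i c i * b i x].

Definition orth_projection k (b : 'I_k -> S -> R) A : Prop :=
  forall f, L2 f -> lin_span b (A f) /\
    forall g, lin_span b g -> inner (fun x => f x - A f x) g = 0.

End L2.

Section operator.
Context {R : realType} {dS : measure_display} {S : measurableType dS}.
Variables (Q : probability S R) (kappa : R.-pker S ~> S) (m : S * S -> R).

(* E[m(X_t, X_{t+1}) psi(X_{t+1}) | X_t = x], where kappa x is the conditional
   distribution of X_{t+1} given X_t = x. *)
Definition Mop (psi : S -> R) : S -> R :=
  fun x => \int[kappa x]_y (m (x, y) * psi y).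

(* Rintegral takes a default value on non-integrable functions; this says that
   the conditional expectations defining Mop exist. *)
Definition Mop_defined : Prop :=
  forall psi, L2 Q psi ->
    {ae Q, forall x, (kappa x).-integrable setT (fun y => (m (x, y) * psi y)%:E)}.

End operator.

Section matrices.
Context {R : realType}.

Definition vnorm k (v : 'cV[R]_k) : R := Num.sqrt (\sum_i v i 0 ^+ 2).

Definition mxopnorm k (A : 'M[R]_k) : R :=
  sup [set vnorm (A *m v) | v in [set v : 'cV[R]_k | vnorm v <= 1]].

(* H = G^{-1/2}: the symmetric positive semidefinite square root of G^{-1}. *)
Definition is_inv_sqrt k (G H : 'M[R]_k) : Prop :=
  [/\ G \in unitmx, H^T = H,
      forall v : 'cV[R]_k, 0 <= (v^T *m H *m v) 0 0 & H *m H = invmx G].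

Definition gen_eigenvalue k (A B : 'M[R]_k) (l : R) : Prop :=
  exists2 v : 'cV[R]_k, v != 0 & A *m v = l *: (B *m v).

Definition largest_gen_eigenvalue k (A B : 'M[R]_k) (l : R) : Prop :=
  gen_eigenvalue A B l /\ forall l', gen_eigenvalue A B l' -> l' <= l.

End matrices.

Section sieve.
Context {R : realType} {dO : measure_display} {Om : measurableType dO}
  {dS : measure_display} {S : measurableType dS}.
Variables (P : probability Om R) (X : nat -> Om -> S) (m : S * S -> R).
Context {k : nat}.
Variable b : 'I_k -> S -> R.

Definition bvec (x : S) : 'cV[R]_k := \col_i b i x.

Definition Gmat : 'M[R]_k :=
  \matrix_(i, j) fine 'E_P[fun w => (b i (X 0 w) * b j (X 0 w))%R]%E.

Definition Mmat : 'M[R]_k :=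
  \matrix_(i, j) fine 'E_P[fun w =>
    (b i (X 0 w) * m (X 0 w, X 1 w) * b j (X 1 w))%R]%E.

Definition Ghat (n : nat) (w : Om) : 'M[R]_k :=
  n%:R^-1 *: \sum_(t < n) bvec (X t w) *m (bvec (X t w))^T.

Definition Mhat (n : nat) (w : Om) : 'M[R]_k :=
  n%:R^-1 *: \sum_(t < n)
    m (X t w, X t.+1 w) *: (bvec (X t w) *m (bvec (X t.+1 w))^T).

End sieve.

Section asymptotics.
Context {R : realType} {dO : measure_display} {Om : measurableType dO}.
Variable P : probability Om R.

(* Y_n = o_p(r_n) *)
Definition small_op (Y : nat -> Om -> R) (r : nat -> R) : Prop :=
  forall e : R, 0 < e ->
    P [set w | e * r n < `|Y n w|] @[n --> \oo] --> (0%E : \bar R).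

(* The library's normal_prob is not a point mass when its standard deviation
   is 0. *)
Definition normal_law (v : R) : probability (measurableTypeR R) R :=
  if v == 0 then [the probability (measurableTypeR R) R of
                  dirac (0 : measurableTypeR R)]
  else [the probability (measurableTypeR R) R of normal_prob 0 (Num.sqrt v)].

(* mu = N(0, W) on R^2, W possibly singular: every linear form a'z is
   N(0, a'Wa) under mu. *)
Definition is_normal2 (W : 'M[R]_2)
    (mu : probability (measurableTypeR R * measurableTypeR R)%type R) : Prop :=
  [/\ W^T = W, forall a : 'cV[R]_2, 0 <= (a^T *m W *m a) 0 0 &
      forall (a : 'cV[R]_2) (B : set (measurableTypeR R)), measurable B ->
        mu [set z | B (a 0 0 * z.1 + a 1 0 * z.2)] =
        normal_law ((a^T *m W *m a) 0 0) B].

Definition cvg_law (Y : nat -> Om -> R) (mu : probability (measurableTypeR R) R)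
  : Prop :=
  forall f : R -> R, continuous f -> (exists C : R, forall x, `|f x| <= C) ->
    'E_P[fun w => f (Y n w)]%E @[n --> \oo] --> (\int[mu]_x (f x)%:E)%E.

Definition cvg_law2 (Y : nat -> Om -> R * R)
    (mu : probability (measurableTypeR R * measurableTypeR R)%type R) : Prop :=
  forall f : R * R -> R, continuous f -> (exists C : R, forall x, `|f x| <= C) ->
    'E_P[fun w => f (Y n w)]%E @[n --> \oo] --> (\int[mu]_z (f z)%:E)%E.

End asymptotics.

Section influence.
Context {R : realType} {dO : measure_display} {Om : measurableType dO}
  {dS : measure_display} {S : measurableType dS}.
Variables (P : probability Om R) (X : nat -> Om -> S) (m : S * S -> R).

Definition Elogm : R := fine 'E_P[fun w => ln (m (X 0 w, X 1 w))]%E.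

Definition psi_rho (phi phis : S -> R) (rho : R) (t : nat) (w : Om) : R :=
  phis (X t w) * m (X t w, X t.+1 w) * phi (X t.+1 w)
  - rho * phis (X t w) * phi (X t w).

Definition psi_lm (t : nat) (w : Om) : R :=
  ln (m (X t w, X t.+1 w)) - Elogm.

Definition Lpop (rho : R) : R := ln rho - Elogm.

Definition Lhat (rhohat : nat -> Om -> R) (n : nat) (w : Om) : R :=
  ln (rhohat n w) - n%:R^-1 * \sum_(t < n) ln (m (X t w, X t.+1 w)).

Definition hbar (rho : R) : 'cV[R]_2 :=
  \col_i (if i == 0 then rho^-1 else -1).

End influence.

(* Main.v *)
(* Since M is the norm limit of the finite-rank operators Pi_k M, it is compact.
   The pairing <phi, phi^*> = 1 rules out generalized eigenvectors, so
   |f| <= C (|(M - rho) f| + |<f, phi^*>|), and M - l is bounded below uniformly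
   for real l in compact intervals above rho. By compactness both estimates hold
   for the sieve operators Pi_k M with k large, uniformly in k, and they persist
   when the matrices G and M are replaced by estimates at a small distance delta.
   Bordering the sample pencil with the coordinates c, c^* of Pi_k phi and
   Pi_k phi^* yields an invertible matrix, and a sign change of the corner entry
   of its inverse produces a real eigenvalue near rho, necessarily the largest.

   Pairing the eigenvalue equation with c^* gives
     rhohat - rho = c^*' (Mhat - rho Ghat) c + O((delta + eta)^2),
   where eta is the projection error of phi and phi^*. By positivity of m,
   boundedness of M and Cauchy-Schwarz, the leading term differs from the sample
   mean of psi_rho by O(eta) in L^1. As delta = o_p(n^{-1/4}) and
   eta = o(n^{-1/2}), expanding the logarithm and Slutsky's lemma conclude. *)

(* The coordinates given by G^{-1/2} identify R^k isometrically with the sieve space, so matrix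
   norms and operator norms on L^2 compare with constants that do not depend on k.

   Two obstacles shape the argument. First, the sample pencil is real but not symmetric, so the
   existence of a real eigenvalue near rho is not automatic; a determinant that changes sign
   supplies it. Only real values of l matter, since rhohat is the largest real eigenvalue. Second,
   delta is merely o_p(n^{-1/4}), so it may enter the remainder only squared, whereas eta, being
   o(n^{-1/2}), may also enter linearly. The first-order term is therefore kept as an exact sample
   average.

   The half-width eps of the window around rho is fixed before delta and eta are made small: the
   lower bound beyond the window holds on an interval starting at rho + eps, and its constant
   depends on eps. The eigenvalue analysis is deterministic, at one sample point and for arbitrary
   delta; probability enters only through the events where the deviations exceed a multiple of
   n^{-1/4}, and through Markov's inequality. *)
Require Import Defs.
From HB Require Import structures.
From mathcomp Require Import all_boot all_order all_algebra.
From mathcomp Require Import all_classical all_reals all_analysis.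
From mathcomp Require Import measurable_realfun.
From mathcomp Require Import ring lra.

Set Implicit Arguments.
Unset Strict Implicit.
Unset Printing Implicit Defensive.

Import Order.TTheory GRing.Theory Num.Theory.
Import numFieldNormedType.Exports.

Local Open Scope classical_set_scope.
Local Open Scope ring_scope.

(** * Vectors and matrices *)

Section column_vectors.
Context {R : realType}.

(** The discriminant argument behind both Cauchy-Schwarz inequalities, [dot_le] and [inner_le],
    isolated on real numbers so that both can use it. *)
Lemma sqr_le_mul_of_quadratic_ge0 (a b c : R) : 0 <= c ->
  (forall t, 0 <= a + 2 * t * b + t ^+ 2 * c) -> b ^+ 2 <= a * c.
Proof.
move=> c0 h; have [c_eq0|cN0] := eqVneq c 0.
  have [->|b0] := eqVneq b 0; first by rewrite c_eq0 expr0n/= mulr0.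
  (* At this point the affine function [a + 2 * t * b] takes the value -1. *)
  have := h (- (a + 1) / (2 * b)).
  rewrite c_eq0 mulr0 addr0 (_ : 2 * _ * b = - (a + 1)); last first.
    by field.
  lra.
have cgt0 : 0 < c by rewrite lt_neqAle eq_sym cN0.
(* The minimizer of the quadratic. *)
have := h (- b / c).
rewrite (_ : a + _ + _ = (a * c - b ^+ 2) / c); last by field.
by rewrite pmulr_lge0 ?invr_gt0// subr_ge0.
Qed.

Definition dot k (u v : 'cV[R]_k) : R := \sum_i u i 0 * v i 0.

Lemma dotC k (u v : 'cV[R]_k) : dot u v = dot v u.
Proof. by apply: eq_bigr => i _; rewrite mulrC. Qed.

Lemma dotDr k (u v w : 'cV[R]_k) : dot u (v + w) = dot u v + dot u w.
Proof. by rewrite -big_split; apply: eq_bigr => i _; rewrite mxE mulrDr. Qed.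

Lemma dotZr k a (u v : 'cV[R]_k) : dot u (a *: v) = a * dot u v.
Proof. by rewrite mulr_sumr; apply: eq_bigr => i _; rewrite mxE mulrCA. Qed.

Lemma dotNr k (u v : 'cV[R]_k) : dot u (- v) = - dot u v.
Proof. by rewrite -scaleN1r dotZr mulN1r. Qed.

Lemma dotBr k (u v w : 'cV[R]_k) : dot u (v - w) = dot u v - dot u w.
Proof. by rewrite dotDr dotNr. Qed.

Lemma dot_trmx k (u v : 'cV[R]_k) : dot u v = (u^T *m v) 0 0.
Proof. by rewrite mxE; apply: eq_bigr => i _; rewrite mxE. Qed.

Lemma dot_mulmxl k (A : 'M[R]_k) (u v : 'cV[R]_k) :
  dot (A *m u) v = dot u (A^T *m v).
Proof. by rewrite !dot_trmx trmx_mul mulmxA. Qed.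

Lemma sqr_vnorm k (v : 'cV[R]_k) : vnorm v ^+ 2 = dot v v.
Proof.
rewrite sqr_sqrtr; last by apply: sumr_ge0 => i _; exact: sqr_ge0.
by apply: eq_bigr => i _; rewrite expr2.
Qed.

Lemma vnorm_ge0 k (v : 'cV[R]_k) : 0 <= vnorm v.
Proof. exact: sqrtr_ge0. Qed.

Lemma vnorm0 k : vnorm (0 : 'cV[R]_k) = 0.
Proof.
rewrite /vnorm big1 ?sqrtr0// => i _; by rewrite mxE expr0n.
Qed.

Lemma vnorm_eq0 k (v : 'cV[R]_k) : vnorm v = 0 -> v = 0.
Proof.
move=> v0; have := sqr_vnorm v; rewrite v0 expr0n/= /dot => /esym/eqP.
rewrite psumr_eq0; last by move=> i _; rewrite -expr2 sqr_ge0.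
move=> /allP h; apply/matrixP => i j; rewrite ord1 mxE.
by have := h i (mem_index_enum _); rewrite /= mulf_eq0 orbb => /eqP.
Qed.

Lemma vnormZ k a (v : 'cV[R]_k) : vnorm (a *: v) = `|a| * vnorm v.
Proof.
rewrite /vnorm; under eq_bigr do rewrite mxE exprMn.
by rewrite -mulr_sumr sqrtrM ?sqr_ge0// sqrtr_sqr.
Qed.

Lemma vnormN k (v : 'cV[R]_k) : vnorm (- v) = vnorm v.
Proof. by rewrite -scaleN1r vnormZ normrN1 mul1r. Qed.

Lemma dot_le k (u v : 'cV[R]_k) : `|dot u v| <= vnorm u * vnorm v.
Proof.
rewrite -(@ler_pXn2r _ 2)// ?nnegrE ?mulr_ge0 ?vnorm_ge0//.
rewrite real_normK ?num_real// exprMn !sqr_vnorm.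
apply: sqr_le_mul_of_quadratic_ge0 => [|t]; first by rewrite -sqr_vnorm sqr_ge0.
rewrite (_ : _ + _ = dot (u + t *: v) (u + t *: v)).
  by rewrite -sqr_vnorm sqr_ge0.
by rewrite dotDr dotZr !(dotC (u + _)) !dotDr !dotZr (dotC v u); ring.
Qed.

Lemma vnormD k (u v : 'cV[R]_k) : vnorm (u + v) <= vnorm u + vnorm v.
Proof.
rewrite -(@ler_pXn2r _ 2)// ?nnegrE ?addr_ge0 ?vnorm_ge0//.
rewrite sqr_vnorm dotDr !(dotC (u + _)) !dotDr (dotC v u) -!sqr_vnorm sqrrD.
by have := le_trans (ler_norm _) (dot_le u v); lra.
Qed.

Lemma vnormB k (u v : 'cV[R]_k) : vnorm (u - v) <= vnorm u + vnorm v.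
Proof. by rewrite -(vnormN v) vnormD. Qed.

Lemma vnorm_le_sum k (v : 'cV[R]_k) : vnorm v <= \sum_i `|v i 0|.
Proof.
rewrite -(@ler_pXn2r _ 2)// ?nnegrE ?vnorm_ge0 ?sumr_ge0// sqr_vnorm /dot.
rewrite expr2 mulr_sumr; apply: ler_sum => i _.
rewrite -expr2 -real_normK ?num_real// expr2 ler_wpM2r//.
by rewrite (bigD1 i)//= lerDl sumr_ge0.
Qed.

Lemma coord_le_vnorm k (v : 'cV[R]_k) i : `|v i 0| <= vnorm v.
Proof.
rewrite -(@ler_pXn2r _ 2)// ?nnegrE ?vnorm_ge0// sqr_vnorm /dot.
rewrite real_normK ?num_real// (bigD1 i)//= -expr2 lerDl sumr_ge0// => j _.
by rewrite -expr2 sqr_ge0.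
Qed.

(** [mxopnorm] is a [sup], which is an upper bound only when the set is bounded above. The sum of
    the row norms is a crude bound that settles this. *)
Lemma vnorm_mulmx_bounded k (A : 'M[R]_k) :
  exists2 K, 0 <= K & forall v, vnorm (A *m v) <= K * vnorm v.
Proof.
exists (\sum_i vnorm (row i A)^T) => [|v].
  by rewrite sumr_ge0// => i _; exact: vnorm_ge0.
apply: le_trans (vnorm_le_sum _) _; rewrite mulr_suml; apply: ler_sum => i _.
apply: le_trans (dot_le _ _); rewrite le_eqVlt; apply/orP; left; apply/eqP.
by congr `| _ |; rewrite mxE; apply: eq_bigr => j _; rewrite !mxE.
Qed.

Lemma vnorm_mulmx_le k (A : 'M[R]_k) v : vnorm (A *m v) <= mxopnorm A * vnorm v.
Proof.
have [K K0 hK] := vnorm_mulmx_bounded A.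
have ub : has_ubound [set vnorm (A *m v) | v in [set v : 'cV[R]_k | vnorm v <= 1]].
  exists K => _ [u /= u1 <-]; apply: le_trans (hK u) _.
  by rewrite -[leRHS]mulr1 ler_wpM2l.
have [v0|vN0] := eqVneq (vnorm v) 0.
  by rewrite (vnorm_eq0 v0) mulmx0 vnorm0 mulr0.
have v0 : 0 < vnorm v by rewrite lt_neqAle eq_sym vN0 vnorm_ge0.
rewrite -ler_pdivrMr//; apply: ub_le_sup => //.
exists ((vnorm v)^-1 *: v) => /=.
  by rewrite vnormZ ger0_norm ?invr_ge0 ?vnorm_ge0// mulVf.
by rewrite -scalemxAr vnormZ ger0_norm ?invr_ge0 ?vnorm_ge0// mulrC.
Qed.

Lemma mxopnorm_ge0 k (A : 'M[R]_k) : 0 <= mxopnorm A.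
Proof.
have [K K0 hK] := vnorm_mulmx_bounded A.
apply: ub_le_sup; last first.
  by exists 0 => /=; rewrite ?mulmx0 vnorm0// ler01.
exists K => _ [u /= u1 <-]; apply: le_trans (hK u) _.
by rewrite -[leRHS]mulr1 ler_wpM2l.
Qed.

Lemma rat_vector_dense k (v : 'cV[R]_k) (e : R) : 0 < e ->
  exists q : 'cV[rat]_k, vnorm (v - map_mx ratr q) < e.
Proof.
move=> e0; have d0 : 0 < e / k.+1%:R by rewrite divr_gt0.
have /choice[q hq] : forall i, exists q : rat, `|v i 0 - ratr q| < e / k.+1%:R.
  move=> i; have : v i 0 < v i 0 + e / k.+1%:R by rewrite ltrDl.
  move=> /rat_in_itvoo[q]; rewrite in_itv/= => /andP[q1 q2]; exists q.
  by rewrite distrC ger0_norm ?subr_ge0 1?ltW// ltrBlDl.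
exists (\col_i q i); apply: le_lt_trans (vnorm_le_sum _) _.
apply: (@le_lt_trans _ _ (\sum_(i < k) e / k.+1%:R)).
  by apply: ler_sum => i _; rewrite !mxE ltW// hq.
rewrite sumr_const card_ord -[ltLHS]mulr_natr mulrAC ltr_pdivrMr//.
by rewrite ltr_pM2l// ltr_nat.
Qed.

(** The condition is homogeneous in the vector, so a witness need not stay in the unit ball and can
    be moved to a nearby rational vector. This turns the event in [measurable_mxopnorm_gt] into a
    countable union. *)
Lemma mxopnorm_gtP k (A : 'M[R]_k) (c : R) : 0 <= c ->
  c < mxopnorm A <-> exists q : 'cV[rat]_k,
    c * vnorm (map_mx ratr q : 'cV[R]_k) < vnorm (A *m map_mx ratr q).
Proof.
move=> c0; split; last first.
  move=> [q /lt_le_trans /(_ (vnorm_mulmx_le _ _))].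
  by apply: contraTT; rewrite -!leNgt => h; rewrite ler_wpM2r ?vnorm_ge0.
have [K K0 hK] := vnorm_mulmx_bounded A.
move=> /sup_gt[|_ [v /= v1 <-] cv].
  by exists (vnorm (A *m 0)), 0 => //=; rewrite vnorm0 ler01.
(* Moving [v] by r changes the two sides by at most [K * r] and [c * r], so a displacement below
   this quotient preserves the strict inequality; the 1 keeps the denominator positive. *)
have e0 : 0 < (vnorm (A *m v) - c) / (K + c + 1).
  by rewrite divr_gt0 ?subr_gt0// ltr_wpDl// addr_ge0.
have [q hq] := rat_vector_dense v e0; exists q.
set u := map_mx ratr q in hq *.
have Av : vnorm (A *m v) <= vnorm (A *m u) + K * vnorm (v - u).
  apply: le_trans (lerD (lexx _) (hK _)); apply: le_trans _ (vnormD _ _).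
  by rewrite mulmxBr addrC subrK.
have uv : vnorm u <= vnorm v + vnorm (v - u).
  rewrite -(vnormN (v - u)); apply: le_trans _ (vnormD _ _).
  by rewrite opprB addrC subrK.
move: hq; rewrite ltr_pdivlMr; last by rewrite ltr_wpDl// addr_ge0.
have : c * vnorm u <= c * (1 + vnorm (v - u)).
  by rewrite ler_wpM2l//; lra.
have := vnorm_ge0 (v - u).
lra.
Qed.

Lemma measurable_mxopnorm_gt d (Om : measurableType d) k (A : Om -> 'M[R]_k) c :
  (forall i j, measurable_fun setT (fun w => A w i j)) ->
  measurable [set w | c < `|mxopnorm (A w)|].
Proof.
move=> mA; have [c0|c0] := ltP c 0.
  rewrite (_ : [set _ | _] = setT)//.
  by apply/seteqP; split=> // w _; rewrite /= (lt_le_trans c0).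
rewrite (_ : [set _ | _] = \bigcup_(q : 'cV[rat]_k) [set w |
    c * vnorm (map_mx ratr q : 'cV[R]_k) < vnorm (A w *m map_mx ratr q)]).
  apply: countable_bigcupT_measurable => [|q]; first exact: countableP.
  have mAq : measurable_fun setT (fun w => vnorm (A w *m map_mx ratr q)).
    rewrite /vnorm; apply: (measurableT_comp (f := @Num.sqrt R)).
      by apply: continuous_measurable_fun; exact: sqrt_continuous.
    apply: measurable_sum => i; apply: measurable_funX.
    rewrite (_ : (fun _ => _) = (fun w => \sum_j A w i j * ratr (q j 0))).
      by apply: measurable_sum => j; exact: measurable_funM.
    by apply/funext => w; rewrite mxE; apply: eq_bigr => j _; rewrite !mxE.
  rewrite -[X in measurable X]setTI.
  have := measurable_fun_ltr (measurable_cst (c * vnorm (map_mx ratr q))) mAq.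
  by move=> /(_ measurableT [set true]); apply.
apply/seteqP; split=> w /=.
  by rewrite ger0_norm ?mxopnorm_ge0// => /(mxopnorm_gtP _ c0)[q hq]; exists q.
move=> [q _ hq]; rewrite ger0_norm ?mxopnorm_ge0//.
by apply/(mxopnorm_gtP _ c0); exists q.
Qed.

End column_vectors.

(** * Square-integrable functions *)

Section square_integrable.
Context {R : realType} {d : measure_display} {T : measurableType d}.
Variable Q : probability T R.
Implicit Types f g h : T -> R.

Lemma L2_measurable f : L2 Q f -> measurable_fun setT f.
Proof. by rewrite /L2/= inE => /andP[/set_mem]. Qed.

Lemma L2_integrable_mul f g : L2 Q f -> L2 Q g ->
  Q.-integrable setT (EFin \o (fun x => f x * g x)).
Proof. by move=> hf hg; apply/Lfun1_integrable; exact: Lfun2_mul_Lfun1. Qed.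

Lemma L2_integrable_sqr f : L2 Q f ->
  Q.-integrable setT (EFin \o (fun x => f x ^+ 2)).
Proof. exact: Lfun2_integrable_sqr. Qed.

Lemma L2_sqr_lty f : measurable_fun setT f ->
  (\int[Q]_x (f x ^+ 2)%:E < +oo)%E -> L2 Q f.
Proof.
move=> mf fy; rewrite /L2/= inE; apply/andP; split; first exact: mem_set.
apply: mem_set; rewrite /= /finite_norm unlock poweR_lty//.
apply: le_lt_trans fy; rewrite le_eqVlt; apply/orP; left; apply/eqP.
apply: eq_integral => x _ /=.
by rewrite powR_mulrn// real_normK ?num_real.
Qed.

Lemma L2_cst0 : L2 Q (cst 0).
Proof.
apply: L2_sqr_lty; first exact: measurable_cst.
by rewrite integral0_eq// => x _; rewrite /= expr0n.
Qed.

Lemma L2_comb (a b : R) f g : L2 Q f -> L2 Q g -> L2 Q (fun x => a * f x + b * g x).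
Proof.
move=> hf hg; have mf := L2_measurable hf; have mg := L2_measurable hg.
apply: L2_sqr_lty.
  by apply: measurable_funD; apply: measurable_funM.
apply: (@le_lt_trans _ _ (\int[Q]_x (2 * a ^+ 2 * f x ^+ 2 + 2 * b ^+ 2 * g x ^+ 2)%:E)%E).
  apply: ge0_le_integral => //.
  - by move=> x _; rewrite lee_fin sqr_ge0.
  - apply/measurable_EFinP; apply: measurable_funX.
    by apply: measurable_funD; apply: measurable_funM.
  - apply/measurable_EFinP; apply: measurable_funD; apply: measurable_funM => //;
      exact: measurable_funX.
  - move=> x _; rewrite lee_fin.
    by have := sqr_ge0 (a * f x - b * g x); nra.
apply/integrable_lty => //.
under eq_fun do rewrite EFinD !EFinM.
by apply: integrableD => //; apply: integrableZl => //; exact: L2_integrable_sqr.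
Qed.

Lemma L2D f g : L2 Q f -> L2 Q g -> L2 Q (fun x => f x + g x).
Proof.
move=> hf hg; rewrite (_ : (fun _ => _) = fun x => 1 * f x + 1 * g x).
  exact: L2_comb.
by apply/funext => x; rewrite !mul1r.
Qed.

Lemma L2B f g : L2 Q f -> L2 Q g -> L2 Q (fun x => f x - g x).
Proof.
move=> hf hg; rewrite (_ : (fun _ => _) = fun x => 1 * f x + (- 1) * g x).
  exact: L2_comb.
by apply/funext => x; rewrite mul1r mulN1r.
Qed.

Lemma L2Z (a : R) f : L2 Q f -> L2 Q (fun x => a * f x).
Proof.
move=> hf; rewrite (_ : (fun _ => _) = fun x => a * f x + 0 * f x).
  exact: L2_comb.
by apply/funext => x; rewrite mul0r addr0.
Qed.

Lemma L2_sum k (c : 'I_k -> R) (b : 'I_k -> T -> R) :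
  (forall i, L2 Q (b i)) -> L2 Q (fun x => \sum_i c i * b i x).
Proof.
elim: k c b => [|k IH] c b hb.
  rewrite (_ : (fun _ => _) = cst 0); first exact: L2_cst0.
  by apply/funext => x; rewrite big_ord0.
under eq_fun do rewrite big_ord_recr/=.
by apply: L2D; [exact: IH|exact: L2Z].
Qed.

Lemma L2_norm f : L2 Q f -> L2 Q (fun x => `|f x|).
Proof.
move=> hf; apply: L2_sqr_lty.
  by apply: measurableT_comp => //; exact: L2_measurable.
under eq_integral do rewrite real_normK ?num_real//.
by apply/integrable_lty => //; exact: L2_integrable_sqr.
Qed.

Lemma innerC f g : inner Q f g = inner Q g f.
Proof. by apply: eq_Rintegral => x _; rewrite mulrC. Qed.

Lemma inner_comb (a b : R) f g h : L2 Q f -> L2 Q g -> L2 Q h ->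
  inner Q (fun x => a * f x + b * g x) h = a * inner Q f h + b * inner Q g h.
Proof.
move=> hf hg hh; rewrite /inner.
under eq_Rintegral do rewrite mulrDl -!mulrA.
have ih := L2_integrable_mul hf hh; have ig := L2_integrable_mul hg hh.
rewrite RintegralD//; last 2 first.
- have -> : EFin \o (fun x => a * (f x * h x)) = (fun x => a%:E * (f x * h x)%:E)%E.
    by apply/funext => x /=; rewrite EFinM.
  exact: integrableZl.
- have -> : EFin \o (fun x => b * (g x * h x)) = (fun x => b%:E * (g x * h x)%:E)%E.
    by apply/funext => x /=; rewrite EFinM.
  exact: integrableZl.
by rewrite !RintegralZl.
Qed.

Lemma innerD f g h : L2 Q f -> L2 Q g -> L2 Q h ->
  inner Q (fun x => f x + g x) h = inner Q f h + inner Q g h.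
Proof.
move=> hf hg hh; rewrite -[inner Q f h]mul1r -[inner Q g h]mul1r -inner_comb//.
by congr inner; apply/funext => x; rewrite !mul1r.
Qed.

Lemma innerB f g h : L2 Q f -> L2 Q g -> L2 Q h ->
  inner Q (fun x => f x - g x) h = inner Q f h - inner Q g h.
Proof.
move=> hf hg hh; rewrite -[inner Q f h]mul1r -[- inner Q g h]mulN1r -inner_comb//.
by congr inner; apply/funext => x; rewrite mul1r mulN1r.
Qed.

Lemma innerZ (a : R) f h : L2 Q f -> L2 Q h ->
  inner Q (fun x => a * f x) h = a * inner Q f h.
Proof.
move=> hf hh; have := inner_comb a 0 hf hf hh; rewrite mul0r addr0 => <-.
by congr inner; apply/funext => x; rewrite mul0r addr0.
Qed.

Lemma inner_sum k (c : 'I_k -> R) (b : 'I_k -> T -> R) h :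
  (forall i, L2 Q (b i)) -> L2 Q h ->
  inner Q (fun x => \sum_i c i * b i x) h = \sum_i c i * inner Q (b i) h.
Proof.
move=> hb hh; elim: k c b hb => [|k IH] c b hb.
  rewrite big_ord0 /inner; under eq_Rintegral do rewrite big_ord0 mul0r.
  by rewrite Rintegral_cst// mul0r.
under [X in inner _ X _]eq_fun do rewrite big_ord_recr/=.
by rewrite innerD//; [rewrite IH// innerZ// big_ord_recr|exact: L2_sum|exact: L2Z].
Qed.

Lemma L2norm_ge0 f : 0 <= L2norm Q f.
Proof. by rewrite fine_ge0// Lnorm_ge0. Qed.

Lemma Lnorm_L2norm f : L2 Q f -> Lnorm Q 2%:E (EFin \o f) = (L2norm Q f)%:E.
Proof.
rewrite /L2/= inE => /andP[_ /set_mem]/=; rewrite /finite_norm => fy.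
by rewrite /L2norm fineK// ge0_fin_numE// Lnorm_ge0.
Qed.

Lemma sqr_L2norm f : L2 Q f -> L2norm Q f ^+ 2 = inner Q f f.
Proof.
move=> hf; apply: EFin_inj; rewrite -powR_mulrn ?L2norm_ge0// -poweR_EFin.
rewrite -Lnorm_L2norm// powR_Lnorm// /inner /Rintegral fineK; last first.
  by apply: integrable_fin_num => //; exact: L2_integrable_mul.
by apply: eq_integral => x _; rewrite -expr2 /= powR_mulrn// real_normK ?num_real.
Qed.

Lemma sqr_L2norm_integral f : L2 Q f ->
  (\int[Q]_x (f x ^+ 2)%:E)%E = (L2norm Q f ^+ 2)%:E.
Proof.
move=> hf; rewrite sqr_L2norm// /inner /Rintegral fineK; last first.
  by apply: integrable_fin_num => //; exact: L2_integrable_mul.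
by apply: eq_integral => x _; rewrite -expr2.
Qed.

Lemma inner_le f g : L2 Q f -> L2 Q g -> `|inner Q f g| <= L2norm Q f * L2norm Q g.
Proof.
move=> hf hg; rewrite -(@ler_pXn2r _ 2)// ?nnegrE ?mulr_ge0 ?L2norm_ge0//.
rewrite real_normK ?num_real// exprMn.
apply: sqr_le_mul_of_quadratic_ge0 => [|t]; first by rewrite sqr_ge0.
rewrite !sqr_L2norm//.
have h := L2_comb 1 t hf hg.
have := sqr_ge0 (L2norm Q (fun x => 1 * f x + t * g x)).
rewrite sqr_L2norm// inner_comb// ![inner Q _ (fun x => _ + _)]innerC !inner_comb//.
by rewrite (innerC g f); lra.
Qed.

Lemma L2normD f g : L2 Q f -> L2 Q g ->
  L2norm Q (fun x => f x + g x) <= L2norm Q f + L2norm Q g.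
Proof.
move=> hf hg; rewrite -(@ler_pXn2r _ 2)// ?nnegrE ?addr_ge0 ?L2norm_ge0//.
have h := L2D hf hg; rewrite sqr_L2norm// innerD// ![inner Q _ (fun x => _ + _)]innerC.
rewrite !innerD// (innerC g f) -!sqr_L2norm// sqrrD.
by have := le_trans (ler_norm _) (inner_le hf hg); lra.
Qed.

Lemma L2normZ (a : R) f : L2 Q f -> L2norm Q (fun x => a * f x) = `|a| * L2norm Q f.
Proof.
move=> hf; apply/eqP; rewrite -(@eqrXn2 _ 2)// ?mulr_ge0 ?L2norm_ge0//.
rewrite exprMn real_normK ?num_real// !sqr_L2norm//; last exact: L2Z.
by rewrite innerZ//; [rewrite innerC innerZ// mulrA -expr2|exact: L2Z].
Qed.

Lemma L2norm_cst0 : L2norm Q (cst 0) = 0.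
Proof.
have := L2normZ 0 L2_cst0; rewrite normr0 mul0r => h; rewrite -[RHS]h.
by congr L2norm; apply/funext => x; rewrite mul0r.
Qed.

Lemma L2normN f : L2 Q f -> L2norm Q (fun x => - f x) = L2norm Q f.
Proof.
move=> hf; rewrite -[RHS]mul1r -(normrN1 R) -L2normZ//.
by congr L2norm; apply/funext => x; rewrite mulN1r.
Qed.

Lemma L2norm_distC f g : L2 Q f -> L2 Q g ->
  L2norm Q (fun x => f x - g x) = L2norm Q (fun x => g x - f x).
Proof.
move=> hf hg; rewrite -[RHS]L2normN; last exact: L2B.
by congr L2norm; apply/funext => x; rewrite opprB.
Qed.

Lemma L2norm_dist_trans f g h : L2 Q f -> L2 Q g -> L2 Q h ->
  L2norm Q (fun x => f x - h x) <=
  L2norm Q (fun x => f x - g x) + L2norm Q (fun x => g x - h x).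
Proof.
move=> hf hg hh; apply: le_trans (L2normD (L2B hf hg) (L2B hg hh)).
by rewrite le_eqVlt; apply/orP; left; apply/eqP; congr L2norm; apply/funext => x; ring.
Qed.

Lemma L2norm_le_dist f g : L2 Q f -> L2 Q g ->
  L2norm Q f <= L2norm Q g + L2norm Q (fun x => f x - g x).
Proof.
move=> hf hg; apply: le_trans (L2normD hg (L2B hf hg)).
by rewrite le_eqVlt; apply/orP; left; apply/eqP; congr L2norm; apply/funext => x; ring.
Qed.

Lemma L2norm_abs f : L2 Q f -> L2norm Q (fun x => `|f x|) = L2norm Q f.
Proof.
move=> hf; apply/eqP; rewrite -(@eqrXn2 _ 2)// ?L2norm_ge0//.
rewrite !sqr_L2norm//; last exact: L2_norm.
apply/eqP; apply: eq_Rintegral => x _.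
by rewrite -!expr2 real_normK ?num_real.
Qed.

Lemma eq_L2norm_ae f g : L2 Q f -> L2 Q g -> f = g %[ae Q] -> L2norm Q f = L2norm Q g.
Proof.
move=> hf hg fg; apply/eqP; rewrite -(@eqrXn2 _ 2)// ?L2norm_ge0//.
rewrite !sqr_L2norm//; apply/eqP; congr fine; apply: ae_eq_integral => //.
- by apply/measurable_EFinP; apply: measurable_funM; exact: L2_measurable.
- by apply/measurable_EFinP; apply: measurable_funM; exact: L2_measurable.
- by apply: filterS fg => x /= /(_ I) fgx _; rewrite fgx.
Qed.

Lemma L2norm_eq0_ae f : L2 Q f -> L2norm Q f = 0 -> f = cst 0 %[ae Q].
Proof.
move=> hf f0; have /measurable_EFinP mf := L2_measurable hf.
have := Lnorm_eq0_eq0 (mu := Q) mf (p := 2%:E) ltac:(by rewrite lte_fin).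
rewrite Lnorm_L2norm// f0 => /(_ erefl); apply: filterS => x /(_ I) h _.
by case: h.
Qed.

Lemma ae_L2norm_dist_eq0 f g : L2 Q f -> L2 Q g ->
  f = g %[ae Q] <-> L2norm Q (fun x => f x - g x) = 0.
Proof.
move=> hf hg; split=> [fg|/(L2norm_eq0_ae (L2B hf hg))]; last first.
  by apply: filterS => x /(_ I)/= h _; apply/eqP; rewrite -subr_eq0 h.
rewrite -[RHS]L2norm_cst0.
apply: eq_L2norm_ae; [exact: L2B|exact: L2_cst0|].
by apply: filterS fg => x /(_ I)/= -> _; rewrite subrr.
Qed.

End square_integrable.

(** * Completeness of L^2, with a rate *)

Section L2_completeness.
Context {R : realType} {d : measure_display} {T : measurableType d}.
Variable Q : probability T R.

Lemma limn_einf_ge0 (u : (\bar R)^nat) : (forall n, 0 <= u n)%E -> (0 <= limn_einf u)%E.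
Proof.
move=> u0; rewrite limn_einf_lim; apply: lime_ge; first exact: is_cvg_einfs.
by apply: nearW => n; apply: le_ereal_inf_tmp => _ [m _ <-].
Qed.

Lemma limn_einf_le (u : (\bar R)^nat) (N : nat) b :
  (forall n, (N <= n)%N -> (u n <= b)%E) -> (limn_einf u <= b)%E.
Proof.
move=> ub; rewrite limn_einf_lim; apply: lime_le; first exact: is_cvg_einfs.
near=> n; apply: (@le_trans _ _ (u n)).
  by apply: ereal_inf_lbound; exists n => /=.
by apply: ub; near: n; exact: nbhs_infty_ge.
Unshelve. all: by end_near. Qed.

(** Cauchy-Schwarz against the constant 1, whose norm is 1 under a probability. *)
Lemma integral_abs_le_L2norm (f : T -> R) : L2 Q f ->
  (\int[Q]_x (`|f x|)%:E <= (L2norm Q f)%:E)%E.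
Proof.
move=> hf; have h1 : L2 Q (cst (1 : R)) by exact: Lfun_cst.
have n1 : L2norm Q (cst (1 : R)) = 1.
  apply/eqP; rewrite -(@eqrXn2 _ 2)// ?L2norm_ge0// sqr_L2norm// expr1n /inner.
  under eq_Rintegral do rewrite mulr1.
  rewrite Rintegral_cst// mul1r; apply/eqP.
  by have := probability_setT Q; rewrite /= => /(congr1 fine).
have := le_trans (ler_norm _) (inner_le (L2_norm hf) h1).
rewrite n1 mulr1 L2norm_abs// -lee_fin /inner /Rintegral fineK.
  by under eq_integral do rewrite mulr1.
by apply: integrable_fin_num => //; apply: L2_integrable_mul => //; exact: L2_norm.
Qed.

Lemma L2_complete (g : nat -> T -> R) (C : R) : (forall i, L2 Q (g i)) ->
  (forall i j, (i <= j)%N ->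
     L2norm Q (fun x => g j x - g i x) <= C * 2^-1 ^+ i) ->
  exists2 f, L2 Q f & forall i, L2norm Q (fun x => g i x - f x) <= C * 2^-1 ^+ i.
Proof.
move=> hg gC.
have C0 : 0 <= C.
  by have := gC 0 0 (leqnn _); rewrite expr0 mulr1; apply: le_trans; exact: L2norm_ge0.
(* The increments are summable in L^1, hence almost everywhere, which gives a
   pointwise limit; Fatou's lemma turns it into a limit in norm. *)
pose h i x := `|g i.+1 x - g i x|.
have hL i : L2 Q (h i) by apply: L2_norm; exact: L2B.
have mh i : measurable_fun setT (fun x => (h i x)%:E).
  by apply/measurable_EFinP; exact: L2_measurable.
have ih i : (\int[Q]_x (h i x)%:E <= (C * 2^-1 ^+ i)%:E)%E.
  apply: le_trans (integral_abs_le_L2norm (L2B (hg i.+1) (hg i))) _.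
  by rewrite lee_fin gC.
have sumfin : (\int[Q]_x (\sum_(0 <= i <oo) (h i x)%:E) < +oo)%E.
  rewrite integral_nneseries//; last by move=> i x _; rewrite lee_fin normr_ge0.
  apply: (@le_lt_trans _ _ (C / (1 - 2^-1))%:E); last exact: ltry.
  apply: lime_le.
    by apply: is_cvg_nneseries => i _ _; apply: integral_ge0 => x _; rewrite lee_fin normr_ge0.
  apply: nearW => n; apply: (@le_trans _ _ (\sum_(0 <= i < n) (C * 2^-1 ^+ i)%:E)%E).
    by apply: lee_sum => i _; exact: ih.
  rewrite sumEFin lee_fin.
  by apply: (@geometric_le_lim R n C 2^-1) => //; rewrite ger0_norm// invf_lt1//; lra.
have msum : measurable_fun setT (fun x => (\sum_(0 <= i <oo) (h i x)%:E)%E).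
  by apply: ge0_emeasurable_sum => // i x _ _; rewrite lee_fin normr_ge0.
have sum_ge0 x : (0 <= \sum_(0 <= i <oo) (h i x)%:E)%E.
  by apply: nneseries_ge0 => i _ _; rewrite lee_fin normr_ge0.
have aecvg : {ae Q, forall x, cvgn (g ^~ x)}.
  have : Q.-integrable setT (fun x => (\sum_(0 <= i <oo) (h i x)%:E)%E).
    apply/integrableP; split => //; apply: le_lt_trans sumfin.
    by apply: ge0_le_integral => //; [exact: measurableT_comp|move=> x _; rewrite gee0_abs].
  move=> /(integrable_ae measurableT); apply: filterS => x /(_ I) fx.
  have cs : cvgn [normed series (telescope (g ^~ x))].
    apply: nondecreasing_is_cvgn => [m n mn|].
      by rewrite /series/=; apply: nondecreasing_series.
    exists (fine (\sum_(0 <= i <oo) (h i x)%:E)) => _ [n _ <-].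
    rewrite -lee_fin fineK// /series/= -sumEFin.
    by apply: (@nneseries_lim_ge _ (fun i => (h i x)%:E) xpredT 0 n) => i _ _; rewrite lee_fin normr_ge0.
  have := normed_cvg cs; rewrite telescopeK => c.
  rewrite (_ : g ^~ x = (fun n => (g n x - g 0%N x) + g 0%N x)).
    exact: is_cvgD c (is_cvg_cst _).
  by apply/funext => n /=; rewrite subrK.
(* The upper limit is measurable whether or not the sequence converges, and equals the limit
   wherever there is one. *)
pose f x := fine (limn_esup (fun i => (g i x)%:E)).
have mf : measurable_fun setT f.
  apply: (measurableT_comp (f := @fine R)); first exact: fine_measurable.
  by apply: measurable_fun_limn_esup => i; apply/measurable_EFinP; exact: L2_measurable.
have cvgf : {ae Q, forall x, g i x @[i --> \oo] --> f x}.
  apply: filterS aecvg => x /cvg_ex[/= l hl].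
  suff -> : f x = l by [].
  have : (g i x)%:E @[i --> \oo] --> l%:E by apply: cvg_EFin => //; exact: nearW.
  by rewrite /f => /cvg_limn_einf_sup[_ ->].
have main i : (\int[Q]_x ((g i x - f x) ^+ 2)%:E <= ((C * 2^-1 ^+ i) ^+ 2)%:E)%E.
  have mgj j : measurable_fun setT (fun x => ((g i x - g j x) ^+ 2)%:E).
    apply/measurable_EFinP/measurable_funX; apply: measurable_funB; exact: L2_measurable.
  apply: (@le_trans _ _ (\int[Q]_x limn_einf (fun j => ((g i x - g j x) ^+ 2)%:E))%E).
    apply: ae_ge0_le_integral => //.
    - by move=> x _; rewrite lee_fin sqr_ge0.
    - apply/measurable_EFinP/measurable_funX; apply: measurable_funB => //; exact: L2_measurable.
    - by move=> x _; apply: limn_einf_ge0 => j; rewrite lee_fin sqr_ge0.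
    - rewrite /limn_einf; apply: measurableT_comp => //.
      by apply: measurable_fun_limn_esup => j; exact: measurableT_comp.
    - apply: filterS cvgf => x gfx _.
      have : ((g i x - g j x) ^+ 2)%:E @[j --> \oo] --> ((g i x - f x) ^+ 2)%:E.
        apply: cvg_EFin; first exact: nearW.
        by under eq_fun do rewrite expr2; rewrite expr2;
          apply: cvgM; apply: cvgB => //; exact: cvg_cst.
      by move=> /cvg_limn_einf_sup[-> _].
  apply: le_trans (fatou Q measurableT mgj _) _.
    by move=> n x _; rewrite lee_fin sqr_ge0.
  apply: (limn_einf_le (N := i)) => j ij.
  rewrite sqr_L2norm_integral; last exact: L2B.
  rewrite lee_fin ler_pXn2r ?nnegrE ?mulr_ge0 ?L2norm_ge0 ?exprn_ge0//.
  by rewrite L2norm_distC// gC.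
have gfL : L2 Q (fun x => g 0%N x - f x).
  apply: L2_sqr_lty; last by apply: le_lt_trans (main 0%N) _; exact: ltry.
  by apply: measurable_funB => //; exact: L2_measurable.
have fL : L2 Q f.
  rewrite (_ : f = fun x => g 0%N x - (g 0%N x - f x)); first exact: L2B.
  by apply/funext => x; rewrite opprB addrC subrK.
exists f => // i; rewrite -(@ler_pXn2r _ 2)// ?nnegrE ?mulr_ge0 ?L2norm_ge0 ?exprn_ge0//.
by rewrite -lee_fin -sqr_L2norm_integral//; exact: L2B.
Qed.

End L2_completeness.

(** * Compact operators *)

Section compact_operator.
Context {R : realType} {d : measure_display} {T : measurableType d}.
Variable Q : probability T R.

Lemma geometric_small (C e : R) : 0 < e -> exists N, forall i, (N <= i)%N -> C * 2^-1 ^+ i <= e.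
Proof.
move=> e0; have [C0|C0] := leP C 0.
  exists 0%N => i _; apply: le_trans (ltW e0).
  by rewrite mulr_le0_ge0// exprn_ge0.
have : geometric C (2^-1 : R) i @[i --> \oo] --> (0 : R).
  by apply: cvg_geometric; rewrite ger0_norm// invf_lt1//; lra.
move=> /cvgrPdist_le/(_ _ e0)[N _ hN]; exists N => i /hN.
by rewrite /= sub0r normrN ger0_norm// mulr_ge0 ?exprn_ge0// ltW.
Qed.

Lemma geometric_le0 (C x : R) : (forall i, x <= C * 2^-1 ^+ i) -> x <= 0.
Proof.
move=> h; rewrite leNgt; apply/negP => x0.
have [N /(_ _ (leqnn N))] := @geometric_small C (x / 2) ltac:(by lra).
by have := h N; lra.
Qed.

Lemma L2norm_sum k (c : 'I_k -> R) (b : 'I_k -> T -> R) : (forall i, L2 Q (b i)) ->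
  L2norm Q (fun x => \sum_i c i * b i x) <= \sum_i `|c i| * L2norm Q (b i).
Proof.
elim: k c b => [|k IH] c b hb.
  under [X in L2norm _ X]eq_fun do rewrite big_ord0.
  rewrite big_ord0 le_eqVlt; apply/orP; left.
  by rewrite -[X in _ == X](L2norm_cst0 Q).
under [X in L2norm _ X]eq_fun do rewrite big_ord_recr/=.
rewrite big_ord_recr/=; apply: le_trans (L2normD _ _) _; [exact: L2_sum|exact: L2Z|].
by rewrite lerD ?IH// L2normZ.
Qed.

(** Equality holds only almost everywhere because [Mop] integrates with a default value at the
    points where the integrand is not integrable. *)
Definition ae_linear (A : (T -> R) -> T -> R) := forall a b f g, L2 Q f -> L2 Q g ->
  A (fun x => a * f x + b * g x) = (fun x => a * A f x + b * A g x) %[ae Q].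

(** A form of compactness: up to [e], the image of the unit ball lies in a bounded part of a
    finite-dimensional space. The coefficients [w f] need not be linear in [f]; only their
    boundedness is used, to extract limits. *)
Definition finite_rank_approximable (A : (T -> R) -> T -> R) := forall e : R, 0 < e ->
  exists k (b : 'I_k -> T -> R) (w : (T -> R) -> 'I_k -> R) (B : R),
    (forall i, L2 Q (b i)) /\
    forall f, L2 Q f -> L2norm Q f <= 1 ->
      (forall i, `|w f i| <= B) /\
      L2norm Q (fun x => A f x - \sum_i w f i * b i x) <= e.

Variable A : (T -> R) -> T -> R.
Hypothesis A_linear : ae_linear A.
Hypothesis A_bounded : bounded_op Q A.

Lemma bounded_op_ge0 : exists2 K, 0 <= K &
  forall f, L2 Q f -> L2 Q (A f) /\ L2norm Q (A f) <= K * L2norm Q f.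
Proof.
have [K hK] := A_bounded; exists `|K| => // f hf.
have [h1 h2] := hK f hf; split=> //; apply: le_trans h2 _.
by rewrite ler_wpM2r ?L2norm_ge0// ler_norm.
Qed.

Lemma op_L2 f : L2 Q f -> L2 Q (A f).
Proof. by move=> hf; have [K _ /(_ f hf)[]] := bounded_op_ge0. Qed.

Lemma op_lipschitz : exists2 K, 0 <= K & forall f g, L2 Q f -> L2 Q g ->
  L2norm Q (fun x => A f x - A g x) <= K * L2norm Q (fun x => f x - g x).
Proof.
have [K K0 hK] := bounded_op_ge0; exists K => // f g hf hg.
apply: le_trans _ (hK _ (L2B hf hg)).2.
rewrite le_eqVlt; apply/orP; left; apply/eqP; apply: eq_L2norm_ae.
- by apply: L2B; exact: op_L2.
- by apply: op_L2; exact: L2B.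
- have := A_linear 1 (-1) hf hg; apply: filterS => x /(_ I)/= h _.
  rewrite -[A f x]mul1r -[- A g x]mulN1r -h; congr (A _ x).
  by apply/funext => y; rewrite mul1r mulN1r.
Qed.

Hypothesis A_compact : finite_rank_approximable A.

(** Bolzano-Weierstrass without subsequences: along an ultrafilter a bounded sequence converges, so
    countably many sequences converge along the same filter. *)
Lemma ultra_bounded_cvg (U : set_system nat) (x : nat -> R) (B : R) :
  UltraFilter U -> (forall j, `|x j| <= B) -> exists l : R, x @ U --> l.
Proof.
move=> UU xB; have UP : ProperFilter U by exact: ultra_proper.
have [|l [_ hl]] := @segment_compact R (- B) B (x @ U) (fmap_proper_filter x UP).
  by apply: nearW => j; rewrite /= in_itv/= -ler_norml.
exists l => V Vl; have [//|UV] := in_ultra_setVsetC (x @^-1` V) UU.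
by have [y []] := hl (~` V) V UV Vl.
Qed.

(** Along the ultrafilter the finitely many coefficients of [A (f j)] converge, so these functions
    end up close to one fixed combination of the [b i]. Half of [e] pays for the finite-rank
    approximation, half for the coefficients. *)
Lemma ultra_op_close (U : set_system nat) (f : nat -> T -> R) (e : R) :
  UltraFilter U -> (forall j, L2 Q (f j)) -> (forall j, L2norm Q (f j) <= 1) -> 0 < e ->
  exists2 y, L2 Q y & U [set j | L2norm Q (fun x => A (f j) x - y x) <= e].
Proof.
move=> UU hf f1 e0; have e20 : 0 < e / 2 by rewrite divr_gt0.
have [k [b [w [B [hb hw]]]]] := A_compact e20.
have /choice[c hc] : forall i, exists l : R, w (f j) i @[j --> U] --> l.
  by move=> i; apply: (ultra_bounded_cvg (B := B)) => j; have [] := hw _ (hf j) (f1 j).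
exists (fun x => \sum_i c i * b i x); first exact: L2_sum.
have S0 : 0 < \sum_i L2norm Q (b i) + 1.
  by rewrite ltr_wpDl// sumr_ge0// => i _; exact: L2norm_ge0.
have e3 : 0 < e / 2 / (\sum_i L2norm Q (b i) + 1) by rewrite divr_gt0.
have : U [set j | forall i, `|c i - w (f j) i| <= e / 2 / (\sum_i L2norm Q (b i) + 1)].
  by apply: filter_forall => i; have /cvgrPdist_le := hc i; apply.
apply: filterS => j /= hj.
have hs c' : L2 Q (fun x => \sum_i c' i * b i x) by exact: L2_sum.
apply: le_trans (L2norm_dist_trans (op_L2 (hf j)) (hs (w (f j))) (hs c)) _.
rewrite [leRHS](splitr e) lerD//; first by have [] := hw _ (hf j) (f1 j).
rewrite (_ : (fun x => _ - _) = fun x => \sum_i (w (f j) i - c i) * b i x); last first.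
  by apply/funext => x; rewrite -sumrB; apply: eq_bigr => i _; rewrite mulrBl.
apply: le_trans (L2norm_sum _ hb) _.
apply: (@le_trans _ _ (\sum_i e / 2 / (\sum_i L2norm Q (b i) + 1) * L2norm Q (b i))).
  by apply: ler_sum => i _; rewrite ler_wpM2r ?L2norm_ge0// distrC.
rewrite -mulr_sumr mulrAC ler_pdivrMr// ler_wpM2l ?(ltW e20)//.
by rewrite lerDl.
Qed.

(* The limit is extracted along an ultrafilter on the indices. *)
Lemma approximate_eigenvectors_cluster (f : nat -> T -> R) (l : nat -> R) (a L : R) :
  0 < a -> (forall j, L2 Q (f j)) -> (forall j, L2norm Q (f j) = 1) ->
  (forall j, a <= l j <= L) ->
  (forall e, 0 < e -> exists N, forall j, (N <= j)%N ->
     L2norm Q (fun x => A (f j) x - l j * f j x) <= e) ->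
  exists g lam, [/\ L2 Q g, L2norm Q g = 1, a <= lam <= L,
    A g = (fun x => lam * g x) %[ae Q] &
    forall e N, 0 < e -> exists2 j, (N <= j)%N & L2norm Q (fun x => f j x - g x) <= e].
Proof.
move=> a0 hf f1 laL hAf.
have [U [UU ooU]] := ultraFilterLemma (eventually_filter : ProperFilter (\oo : set_system nat)).
have [lam hlam] : exists lam : R, l @ U --> lam.
  apply: (@ultra_bounded_cvg U l L UU) => j; have /andP[h1 h2] := laL j.
  by rewrite ger0_norm// (le_trans (ltW a0)).
have h2i i : 0 < 2^-1 ^+ i :> R by rewrite exprn_gt0.
have /choice[y hy] : forall i, exists y, L2 Q y /\
    U [set j | L2norm Q (fun x => A (f j) x - y x) <= 2^-1 ^+ i].
  move=> i; have [|y] := ultra_op_close UU hf _ (h2i i).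
    by move=> j; rewrite f1.
  by exists y.
pose V i := [set j | [/\ (i <= j)%N, L2norm Q (fun x => A (f j) x - y i x) <= 2^-1 ^+ i,
  `|lam - l j| <= 2^-1 ^+ i & L2norm Q (fun x => A (f j) x - l j * f j x) <= 2^-1 ^+ i]].
have UV i : U (V i).
  have [N hN] := hAf _ (h2i i).
  have u1 : U [set j | (i <= j)%N] by apply: ooU; exact: nbhs_infty_ge.
  have u2 : U [set j | (N <= j)%N] by apply: ooU; exact: nbhs_infty_ge.
  have u3 : U [set j | `|lam - l j| <= 2^-1 ^+ i] by have /cvgrPdist_le := hlam; apply.
  apply: filterS (filterI (filterI u1 u2) (filterI (hy i).2 u3)) => j /=.
  by move=> [[? /hN ?] [? ?]]; split.
(* A diagonal choice: [s i] satisfies the first i+1 conditions at once, so any two later terms lie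
   within [2^-1 ^+ i] of the same function [y i]. Hence the constant 2 in the Cauchy estimate
   below. *)
have /choice[s hs] : forall i, exists j, forall i', (i' <= i)%N -> V i' j.
  move=> i; have : U [set j | forall i' : 'I_i.+1, V i' j].
    exact: (@filter_forall _ _ (fun i' : 'I_i.+1 => V i') U _ (fun i' => UV i')).
  by move=> /filter_ex[j hj]; exists j => i' i'i; exact: (hj (Ordinal (i'i : (i' < i.+1)%N))).
have hA j := op_L2 (hf j).
have [|h hL hh] := L2_complete (C := 2) (fun i => hA (s i)).
  move=> i j ij; have [_ h1 _ _] := hs j i ij; have [_ h2 _ _] := hs i i (leqnn i).
  apply: le_trans (L2norm_dist_trans (hA _) (hy i).1 (hA _)) _.
  rewrite [X in _ + X]L2norm_distC//; last exact: (hy i).1.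
  lra.
have lam_close i : `|lam - l (s i)| <= 2^-1 ^+ i by have [] := hs i i (leqnn i).
have alam : a <= lam.
  rewrite -subr_le0; apply: (geometric_le0 (C := 1)) => i; rewrite mul1r.
  apply: le_trans (lam_close i); have /andP[h1 _] := laL (s i).
  by rewrite distrC; apply: le_trans (ler_norm _); rewrite lerB.
have lamL : lam <= L.
  rewrite -subr_le0; apply: (geometric_le0 (C := 1)) => i; rewrite mul1r.
  apply: le_trans (lam_close i); have /andP[_ h1] := laL (s i).
  by apply: le_trans (ler_norm _); rewrite lerB.
have lam0 : 0 < lam by exact: lt_le_trans alam.
(* Since [A (f (s i))] tends to [h] and differs little from [lam * f (s i)], the vectors themselves
   tend to [h / lam]. This is where the lower bound [a > 0] on the eigenvalues is essential. *)
pose g x := lam^-1 * h x.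
have gL : L2 Q g by exact: L2Z.
(* The 4 is 1 for [lam - l (s i)], 1 for the eigenvector residual and 2 for the distance to [h];
   division by [lam], which is at least [a], gives [4 / a]. *)
have fg i : L2norm Q (fun x => f (s i) x - g x) <= 4 / a * 2^-1 ^+ i.
  have [_ _ h1 h2] := hs i i (leqnn i); have h3 := hh i.
  have e1 : L2norm Q (fun x => lam * (f (s i) x - g x)) <= 4 * 2^-1 ^+ i.
    have -> : (fun x => lam * (f (s i) x - g x)) =
        (fun x => ((lam - l (s i)) * f (s i) x - (A (f (s i)) x - l (s i) * f (s i) x))
                  + (A (f (s i)) x - h x)).
      by apply/funext => x; rewrite /g; field; rewrite gt_eqF.
    have m1 : L2 Q (fun x => (lam - l (s i)) * f (s i) x) by exact: L2Z.
    have m2 : L2 Q (fun x => A (f (s i)) x - l (s i) * f (s i) x) by apply: L2B => //; exact: L2Z.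
    apply: le_trans (L2normD (L2B m1 m2) (L2B (hA _) hL)) _.
    have := L2norm_le_dist (L2B m1 m2) m1.
    rewrite (_ : (fun x => _ - _ - _) = (fun x => - (A (f (s i)) x - l (s i) * f (s i) x))).
      by rewrite L2normN// L2normZ// f1; lra.
    by apply/funext => x; ring.
  move: e1; rewrite L2normZ ?(gtr0_norm lam0); last exact: L2B.
  have := L2norm_ge0 Q (fun x => f (s i) x - g x); set z := L2norm _ _ => z0 e1.
  rewrite mulrAC ler_pdivlMr//; apply: le_trans e1.
  by rewrite mulrC ler_wpM2r.
exists g, lam; split=> //.
- have up i : L2norm Q g - 1 <= 4 / a * 2^-1 ^+ i.
    by have := L2norm_le_dist gL (hf (s i)); rewrite f1 L2norm_distC//; have := fg i; lra.
  have lo i : 1 - L2norm Q g <= 4 / a * 2^-1 ^+ i.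
    by have := L2norm_le_dist (hf (s i)) gL; rewrite f1; have := fg i; lra.
  by apply/eqP; rewrite eq_le -subr_le0 -[X in _ && X]subr_le0 (geometric_le0 up) (geometric_le0 lo).
- by rewrite alam lamL.
- apply/ae_L2norm_dist_eq0; [exact: op_L2|exact: L2Z|].
  apply/eqP; rewrite eq_le L2norm_ge0 andbT.
  have [K K0 hK] := op_lipschitz.
  apply: (geometric_le0 (C := K * (4 / a) + 2)) => i.
  have hg : (fun x => A g x - lam * g x) = (fun x => A g x - h x).
    by apply/funext => x; rewrite [in X in _ - X]/g mulVKf// gt_eqF.
  rewrite hg; apply: le_trans (L2norm_dist_trans (op_L2 gL) (hA (s i)) hL) _.
  rewrite mulrDl lerD//; apply: le_trans (hK _ _ gL (hf _)) _.
  by rewrite -mulrA ler_wpM2l// L2norm_distC.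
- move=> e N e0; have [i0 hi0] := geometric_small (4 / a) e0.
  exists (s (maxn N i0)).
    by have [h1 _ _ _] := hs _ _ (leqnn (maxn N i0)); apply: leq_trans h1; exact: leq_maxl.
  by apply: le_trans (fg _) _; apply: hi0; exact: leq_maxr.
Qed.

End compact_operator.

(** * Perturbation of matrix pencils *)

Section largest_root.
Context {R : realType}.

Lemma exists_largest_root (p : {poly R}) : p != 0 -> (exists x, root p x) ->
  exists2 x, root p x & forall y, root p y -> y <= x.
Proof.
elim: (size p) {-2}p (leqnn (size p)) => [|n IH] {}p sp p0 [x px].
  by move: p0; rewrite -size_poly_eq0; move: sp; rewrite leqn0 => ->.
have /factor_theorem[q pq] := px.
have q0 : q != 0 by apply: contra_neq p0 => q0; rewrite pq q0 mul0r.
have rp y : root p y = root q y || (y == x).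
  by rewrite pq rootM root_XsubC.
have [[y qy]|noroot] := pselect (exists y, root q y); last first.
  exists x => // y; rewrite rp => /orP[qy|/eqP->//].
  by exfalso; apply: noroot; exists y.
have sq : (size q <= n)%N.
  by move: sp; rewrite pq size_Mmonic ?monicXsubC// size_XsubC addn2.
have [z qz zmax] := IH q sq q0 (ex_intro _ y qy).
exists (Num.max x z).
  by rewrite rp; case: (leP x z) => _; rewrite ?qz// eqxx orbT.
by move=> t; rewrite rp le_max => /orP[/zmax->|/eqP->]; rewrite ?lexx ?orbT.
Qed.

(** [det0P] provides row vectors in a left kernel, hence the passage through the transpose. *)
Lemma gen_eigenvalueP k (A B : 'M[R]_k) l :
  gen_eigenvalue A B l <-> \det (A - l *: B) = 0.
Proof.
split=> [[v v0 Av]|/eqP].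
  apply/eqP; rewrite -det_tr; apply/det0P; exists v^T.
    by apply: contra_neq v0 => /(congr1 trmx); rewrite trmxK trmx0.
  by rewrite -trmx_mul mulmxBl Av -scalemxAl subrr trmx0.
rewrite -det_tr => /det0P[w w0 wA]; exists w^T.
  by apply: contra_neq w0 => /(congr1 trmx); rewrite trmxK trmx0.
apply/eqP; rewrite -subr_eq0 scalemxAl -mulmxBl; apply/eqP/trmx_inj.
by rewrite trmx_mul trmxK trmx0.
Qed.

Definition pencil_poly k (A B : 'M[R]_k) : {poly R} :=
  \det (map_mx polyC A - 'X *: map_mx polyC B).

Lemma pencil_polyE k (A B : 'M[R]_k) l :
  (pencil_poly A B).[l] = \det (A - l *: B).
Proof.
rewrite /pencil_poly -horner_evalE -det_map_mx; congr (\det _).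
by apply/matrixP => i j; rewrite !mxE/= horner_evalE !hornerE.
Qed.

Lemma poly_ivt_sign (p : {poly R}) (a b : R) : a <= b -> p.[a] * p.[b] <= 0 ->
  exists2 x, a <= x <= b & root p x.
Proof.
move=> ab pab; have [pa|pa] := leP p.[a] 0; last first.
  have [|x xab] := @poly_ivt R (- p) a b ab.
    by rewrite !hornerN oppr_le0 oppr_ge0 ltW//= -(pmulr_rle0 _ pa).
  by rewrite rootN; exists x.
have [pb|pb] := leP 0 p.[b].
  by apply: (@poly_ivt R p a b ab); rewrite pa.
have pa0 : p.[a] = 0.
  by apply/eqP; rewrite eq_le pa/= -(nmulr_lle0 _ pb).
by exists a; [rewrite lexx|rewrite rootE pa0].
Qed.

(* The corner entry [s] of the inverse of the bordered pencil
   [[A - l B, c], [cs^T, 0]] is [det (A - l B)] divided by the determinant of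
   the bordered pencil. If the latter does not vanish between [a] and [b],
   a sign change of [s] therefore produces a generalized eigenvalue. *)
Lemma bordered_sign_change k (A B : 'M[R]_k) (c cs : 'cV[R]_k) (a b : R)
    (va vb : 'cV[R]_k) (sa sb : R) :
  a <= b ->
  (forall l v s, a <= l <= b -> (A - l *: B) *m v + s *: c = 0 -> dot cs v = 0 ->
     v = 0 /\ s = 0) ->
  (A - a *: B) *m va + sa *: c = 0 -> dot cs va = 1 ->
  (A - b *: B) *m vb + sb *: c = 0 -> dot cs vb = 1 ->
  sa * sb < 0 ->
  exists l, [/\ a <= l <= b, root (pencil_poly A B) l & pencil_poly A B != 0].
Proof.
move=> ab inj ra ta rb tb sab.
pose A' : 'M[R]_(k + 1) := block_mx A c cs^T 0.
pose B' : 'M[R]_(k + 1) := block_mx B 0 0 0.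
have A'B' l : A' - l *: B' = block_mx (A - l *: B) c cs^T 0.
  by rewrite scale_block_mx opp_block_mx add_block_mx !scaler0 !subr0.
(* The injectivity hypothesis says precisely that the bordered matrix has no kernel. *)
have D0 l : a <= l <= b -> (pencil_poly A' B').[l] != 0.
  move=> lab; rewrite pencil_polyE; apply/eqP => /gen_eigenvalueP[w w0 /eqP].
  rewrite -subr_eq0 scalemxAl -mulmxBl A'B' -[w]vsubmxK mul_block_col mul0mx addr0.
  rewrite -[X in _ == X]vsubmxK => /eqP /eq_col_mx; rewrite !linear0 => -[h1 h2].
  have [||v0 s0] := inj l (usubmx w) (dsubmx w 0 0) lab.
  - rewrite -[RHS]h1; congr (_ + _); apply/matrixP => i j.
    by rewrite !mxE ord1 big_ord1 !mxE mulrC.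
  - by rewrite dot_trmx h2 mxE.
  apply: (negP w0); apply/eqP; rewrite -[w]vsubmxK v0.
  have -> : dsubmx w = 0 by apply/matrixP => i j; rewrite !ord1 s0 mxE.
  by rewrite col_mx0.
have detE l v s : (A - l *: B) *m v + s *: c = 0 -> dot cs v = 1 ->
    (pencil_poly A B).[l] = (pencil_poly A' B').[l] * s.
  move=> rv tv; rewrite !pencil_polyE.
  (* Cramer's rule as a product of block matrices: completing [(v, s)] to a block triangular matrix
     of determinant [s] clears the border, and the right-hand side has determinant
     [\det (A - l *: B)]. *)
  have : (A' - l *: B') *m block_mx 1%:M v 0 (s%:M : 'M[R]_1) =
      block_mx (A - l *: B) 0 cs^T 1%:M.
    rewrite A'B' mulmx_block !mulmx1 !mulmx0 !addr0 !mul0mx addr0; congr block_mx.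
      by rewrite -[RHS]rv; congr (_ + _); rewrite mul_mx_scalar.
    by apply/matrixP => i j; rewrite !ord1 -dot_trmx tv !mxE.
  move=> /(congr1 determinant); rewrite det_mulmx det_ublock det_lblock !det1.
  by rewrite mul1r mulr1 det_scalar1.
have D0a : (pencil_poly A' B').[a] != 0 by apply: D0; rewrite lexx.
have D0b : (pencil_poly A' B').[b] != 0 by apply: D0; rewrite lexx andbT.
have signD : 0 < (pencil_poly A' B').[a] * (pencil_poly A' B').[b].
  rewrite lt_neqAle eq_sym mulf_neq0//= leNgt; apply/negP => neg.
  have [x xab] := poly_ivt_sign ab (ltW neg).
  by rewrite rootE => /eqP rx; have := D0 x xab; rewrite rx eqxx.
have pab : (pencil_poly A B).[a] * (pencil_poly A B).[b] < 0.
  by rewrite (detE _ _ _ ra ta) (detE _ _ _ rb tb) mulrACA pmulr_rlt0.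
have [l lab rl] := poly_ivt_sign ab (ltW pab); exists l; split=> //.
by apply: contraTneq pab => ->; rewrite horner0 mul0r ltxx.
Qed.

End largest_root.

(** * Largest eigenvalue of a perturbed pencil, with constants free of the dimension *)

Section pencil_perturbation.
Context {R : realType} {k : nat}.
Variables (M0 G1 M1 : 'M[R]_k) (c cs : 'cV[R]_k) (rho C0 K eps eta delta : R).
Hypotheses (rho0 : 0 < rho) (C01 : 1 <= C0) (K1 : 1 <= K).
Hypotheses (eps0 : 0 < eps) (eps1 : eps <= 1).
Hypotheses (eta0 : 0 <= eta) (eta2 : eta <= 2^-1) (delta0 : 0 <= delta).
Hypotheses (cK : vnorm c <= K) (csK : vnorm cs <= K).
Hypothesis coercive : forall v,
  vnorm v <= C0 * (vnorm (M0 *m v - rho *: v) + `|dot cs v|).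
Hypothesis c_eigen : vnorm (M0 *m c - rho *: c) <= eta.
Hypothesis cs_eigen : forall v,
  `|dot cs (M0 *m v) - rho * dot cs v| <= eta * vnorm v.
Hypothesis c_cs : `|dot cs c - 1| <= eta.
Hypothesis G1_close : forall v, vnorm (G1 *m v - v) <= delta * vnorm v.
Hypothesis M1_close : forall v, vnorm (M1 *m v - M0 *m v) <= delta * vnorm v.
(** The left-hand side multiplies [vnorm v] when [coercive] is applied to a solution of the bordered
    equation; at most 1/2, it is absorbed on the left. [small_sign] makes the error in the corner
    entry smaller than [eps] at both ends of the window. *)
Hypothesis small_coercive :
  C0 * (2 * K * (eta + K * (delta * (2 + rho) + eps))
        + (delta * (2 + rho) + eps)) <= 2^-1.
Hypothesis small_sign : 2 * C0 * (eta + K * (delta * (2 + rho))) < eps.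
Hypothesis no_larger : forall l, gen_eigenvalue M1 G1 l -> l <= rho + eps.

Let E (l : R) (v : 'cV[R]_k) := (M1 - l *: G1) *m v.

(** The factor [2 + rho] is 1 for the error of [M1] plus [|l| <= 1 + rho] for that of [G1]. *)
Lemma pencil_near l v : `|l - rho| <= eps ->
  vnorm (E l v - (M0 *m v - rho *: v)) <=
  (delta * (2 + rho) + `|l - rho|) * vnorm v.
Proof.
move: rho0 C01 K1 eps0 eps1 eta0 eta2 delta0 => hr hC hK he he1 ht ht2 hd.
move=> le; have l1 : `|l| <= 1 + rho.
  have : `|l| <= `|l - rho| + rho by rewrite -{2}(gtr0_norm rho0) -{1}(subrK rho l) ler_normD.
  by lra.
have -> : E l v - (M0 *m v - rho *: v) =
    (M1 *m v - M0 *m v) - l *: (G1 *m v - v) - (l - rho) *: v.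
  rewrite /E mulmxBl -scalemxAl; apply/matrixP => i j; rewrite !mxE; ring.
apply: le_trans (vnormB _ _) _; rewrite vnormZ mulrDl lerD//.
apply: le_trans (vnormB _ _) _; rewrite vnormZ.
apply: (@le_trans _ _ (delta * vnorm v + (1 + rho) * (delta * vnorm v))); last by lra.
by rewrite lerD// ler_pM ?vnorm_ge0.
Qed.

(** Tested against the approximate left eigenvector [cs], the pencil acts as the scalar
    [-(l - rho)]. Unlike in [pencil_near], the bound contains no [|l - rho|], so it remains of first
    order throughout the window. *)
Lemma dot_pencil_near l v : `|l - rho| <= eps ->
  `|dot cs (E l v) + (l - rho) * dot cs v| <=
  (eta + K * (delta * (2 + rho))) * vnorm v.
Proof.
move: rho0 C01 K1 eps0 eps1 eta0 eta2 delta0 => hr hC hK he he1 ht ht2 hd.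
move=> le; have l1 : `|l| <= 1 + rho.
  have : `|l| <= `|l - rho| + rho by rewrite -{2}(gtr0_norm rho0) -{1}(subrK rho l) ler_normD.
  by lra.
have -> : dot cs (E l v) + (l - rho) * dot cs v =
    (dot cs (M0 *m v) - rho * dot cs v) +
    (dot cs (M1 *m v - M0 *m v) - l * dot cs (G1 *m v - v)).
  by rewrite /E mulmxBl -scalemxAl !dotBr dotZr; ring.
apply: le_trans (ler_normD _ _) _; rewrite mulrDl lerD//.
apply: le_trans (ler_normB _ _) _; rewrite normrM.
have d1 : `|dot cs (M1 *m v - M0 *m v)| <= K * (delta * vnorm v).
  by apply: le_trans (dot_le _ _) _; rewrite ler_pM ?vnorm_ge0.
have d2 : `|dot cs (G1 *m v - v)| <= K * (delta * vnorm v).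
  by apply: le_trans (dot_le _ _) _; rewrite ler_pM ?vnorm_ge0.
apply: (@le_trans _ _ (K * (delta * vnorm v) + (1 + rho) * (K * (delta * vnorm v)))).
  by rewrite lerD// ler_pM.
by rewrite le_eqVlt; apply/orP; left; apply/eqP; ring.
Qed.

(** Testing the equation with [cs] determines [s] up to a small error, because [dot cs c] is close
    to 1. Then [s *: c] is small, [v] is nearly in the kernel of [M0 - rho], and coercivity controls
    it by its component along [cs]. *)
Lemma bordered_pencil_bound l v s : `|l - rho| <= eps -> E l v + s *: c = 0 ->
  vnorm v <= 2 * C0 * `|dot cs v| /\
  `|s * dot cs c - (l - rho) * dot cs v| <= (eta + K * (delta * (2 + rho))) * vnorm v.
Proof.
move: rho0 C01 K1 eps0 eps1 eta0 eta2 delta0 => hr hC hK he he1 ht ht2 hd.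
move=> le r0; have cs_s : s * dot cs c = - dot cs (E l v).
  by apply/eqP; rewrite -subr_eq0 opprK addrC -dotZr -dotDr r0 -{1}(scale0r 0) dotZr mul0r.
have near_s : `|s * dot cs c - (l - rho) * dot cs v| <=
    (eta + K * (delta * (2 + rho))) * vnorm v.
  by rewrite cs_s -opprD normrN; exact: dot_pencil_near.
split=> //.
have v0 := vnorm_ge0 v.
have small := small_coercive; set tau := delta * (2 + rho) + eps in small.
have tau0 : 0 <= tau.
  by rewrite addr_ge0 ?(ltW eps0)// mulr_ge0// addr_ge0// ltW.
have csv : `|dot cs v| <= K * vnorm v.
  by apply: le_trans (dot_le _ _) _; rewrite ler_wpM2r.
have s_le : `|s| <= 2 * (eta + K * tau) * vnorm v.
  have c2 : 2^-1 <= `|dot cs c|.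
    have : dot cs c <= `|dot cs c| by exact: ler_norm.
    move: c_cs; rewrite ler_norml => /andP[h _]; lra.
  have h1 : `|s| * `|dot cs c| <= (eta + K * tau) * vnorm v.
    rewrite -normrM -(subrK ((l - rho) * dot cs v) (s * dot cs c)).
    apply: le_trans (ler_normD _ _) _; rewrite normrM.
    have h2 : `|l - rho| * `|dot cs v| <= eps * (K * vnorm v) by rewrite ler_pM.
    by apply: le_trans (lerD near_s h2) _; rewrite /tau; lra.
  have h2 : `|s| * 2^-1 <= `|s| * `|dot cs c| by rewrite ler_wpM2l.
  lra.
have M0v : vnorm (M0 *m v - rho *: v) <= (2 * K * (eta + K * tau) + tau) * vnorm v.
  rewrite (_ : M0 *m v - rho *: v = - (s *: c) - (E l v - (M0 *m v - rho *: v))).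
    apply: le_trans (vnormB _ _) _; rewrite vnormN vnormZ.
    have h1 : `|s| * vnorm c <= 2 * (eta + K * tau) * vnorm v * K.
      by rewrite ler_pM ?vnorm_ge0.
    have h2 : (delta * (2 + rho) + `|l - rho|) * vnorm v <= tau * vnorm v.
      by rewrite ler_wpM2r// lerD2l.
    by apply: le_trans (lerD h1 (le_trans (pencil_near v le) h2)) _; lra.
  by rewrite opprB addrCA -opprD [s *: c + _]addrC r0 subr0.
have h1 : C0 * vnorm (M0 *m v - rho *: v) <= 2^-1 * vnorm v.
  apply: (@le_trans _ _ (C0 * (2 * K * (eta + K * tau) + tau) * vnorm v)).
    by rewrite -mulrA ler_wpM2l//; lra.
  by rewrite ler_wpM2r.
by have := coercive v; rewrite mulrDr; lra.
Qed.

Lemma bordered_pencil_inj l v s : `|l - rho| <= eps -> E l v + s *: c = 0 ->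
  dot cs v = 0 -> v = 0 /\ s = 0.
Proof.
move: rho0 C01 K1 eps0 eps1 eta0 eta2 delta0 => hr hC hK he he1 ht ht2 hd.
move=> le r0 t0; have [h1 h2] := bordered_pencil_bound le r0.
move: h1; rewrite t0 normr0 mulr0 => h1.
have v0 : v = 0 by apply: vnorm_eq0; apply/eqP; rewrite eq_le h1 vnorm_ge0.
split=> //; move: h2; rewrite t0 v0 vnorm0 !mulr0 subr0 normr_le0 mulf_eq0.
move=> /orP[/eqP//|/eqP c0]; exfalso.
by move: c_cs; rewrite c0 sub0r normrN normr1; lra.
Qed.

Lemma bordered_pencil_solve l : `|l - rho| <= eps ->
  exists v s, E l v + s *: c = 0 /\ dot cs v = 1.
Proof.
move: rho0 C01 K1 eps0 eps1 eta0 eta2 delta0 => hr hC hK he he1 ht ht2 hd.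
move=> le; pose B := block_mx (M1 - l *: G1) c cs^T 0 : 'M[R]_(k + 1).
have uB : B \in unitmx.
  rewrite unitmxE unitfE; apply/eqP => dB.
  (* With zero second matrix, [gen_eigenvalueP] yields a kernel vector of the singular matrix
     [B]. *)
  have /gen_eigenvalueP[w w0] : \det (B - 0 *: 0) = 0 by rewrite scale0r subr0.
  rewrite scale0r -[w]vsubmxK mul_block_col mul0mx addr0.
  rewrite -[X in _ = X]vsubmxK => /eq_col_mx; rewrite !linear0 => -[h1 h2].
  have [||v0 s0] := @bordered_pencil_inj l (usubmx w) (dsubmx w 0 0) le.
  - rewrite -[RHS]h1; congr (_ + _); apply/matrixP => i j.
    by rewrite !mxE ord1 big_ord1 !mxE mulrC.
  - by rewrite dot_trmx h2 mxE.
  apply: (negP w0); apply/eqP; rewrite -[w]vsubmxK v0.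
  have -> : dsubmx w = 0 by apply/matrixP => i j; rewrite !ord1 s0 mxE.
  by rewrite col_mx0.
pose w := invmx B *m col_mx 0 1%:M.
have := mulKVmx uB (col_mx 0 1%:M : 'cV[R]_(k + 1)); rewrite -/w.
rewrite -[w]vsubmxK mul_block_col mul0mx addr0 => /eq_col_mx[h1 h2].
exists (usubmx w), (dsubmx w 0 0); split; last by rewrite dot_trmx h2 mxE.
rewrite -[RHS]h1; congr (_ + _); apply/matrixP => i j.
by rewrite !mxE ord1 big_ord1 !mxE mulrC.
Qed.

(** At an end of the window [s * dot cs c] differs from [l - rho] by less than [|l - rho|], so both
    have the same sign, and [dot cs c] is positive. *)
Lemma bordered_pencil_sign l v s : `|l - rho| = eps -> E l v + s *: c = 0 ->
  dot cs v = 1 -> 0 < s * (l - rho).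
Proof.
move: rho0 C01 K1 eps0 eps1 eta0 eta2 delta0 => hr hC hK he he1 ht ht2 hd.
move=> le r0 t1; have [|h1 h2] := @bordered_pencil_bound l v s _ r0; first by rewrite le.
move: h1 h2; rewrite t1 normr1 !mulr1 => h1 h2.
have h3 : `|s * dot cs c - (l - rho)| < eps.
  apply: le_lt_trans h2 (le_lt_trans _ small_sign).
  rewrite [leRHS]mulrC ler_wpM2l// addr_ge0// !mulr_ge0//; lra.
have c0 : 0 < dot cs c by move: c_cs; rewrite ler_norml => /andP[h _]; lra.
have : 0 < (s * dot cs c) * (l - rho).
  move: h3; set x := s * _; set y := l - rho => h3.
  have y0 : `|y| = eps by [].
  have [yp|yn] := leP 0 y.
    have y1 : y = eps by rewrite -y0 ger0_norm.
    by move: h3; rewrite ltr_norml => /andP[h _]; rewrite mulr_gt0; lra.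
  have y1 : y = - eps by rewrite -y0 ltr0_norm// opprK.
  by move: h3; rewrite ltr_norml => /andP[_ h]; rewrite nmulr_lgt0; lra.
by rewrite mulrAC pmulr_lgt0.
Qed.

Lemma pencil_eigenvalue_exists : exists l,
  [/\ rho - eps <= l <= rho + eps, root (pencil_poly M1 G1) l & pencil_poly M1 G1 != 0].
Proof.
move: rho0 C01 K1 eps0 eps1 eta0 eta2 delta0 => hr hC hK he he1 ht ht2 hd.
have na : `|rho - eps - rho| = eps by rewrite addrAC subrr sub0r normrN gtr0_norm.
have nb : `|rho + eps - rho| = eps by rewrite addrAC subrr add0r gtr0_norm.
have [|va [sa [ra ta]]] := @bordered_pencil_solve (rho - eps); first by rewrite na.
have [|vb [sb [rb tb]]] := @bordered_pencil_solve (rho + eps); first by rewrite nb.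
have sa0 := bordered_pencil_sign na ra ta.
have sb0 := bordered_pencil_sign nb rb tb.
apply: (bordered_sign_change _ _ ra ta rb tb); first lra.
- move=> l v s lab r t; apply: bordered_pencil_inj r t.
  by rewrite ler_norml; lra.
- move: sa0 sb0; rewrite addrAC subrr sub0r mulrN oppr_gt0 pmulr_llt0// => sa0.
  by rewrite addrAC subrr add0r pmulr_lgt0// => sb0; rewrite pmulr_llt0.
Qed.

(** [D1] bounds the eigenvalue error over [kap]: [K * (2 + rho)] from [dot_pencil_near] times the
    bound [2 * C0] on the normalized eigenvector. [D2] bounds the eigenvector error over [kap], and
    [D3] collects the products of two first-order errors. *)
Let kap := delta + eta.
Let D1 := 2 * C0 * (K * (2 + rho)).
Let D2 := C0 * ((2 + rho + D1) * (2 * C0) + 2).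
Let D3 := K * (2 + rho) * D2 + D1 * (K * (2 * C0)).

(** The largest root exceeds neither [rho + eps], by [no_larger], nor falls below the root already
    found in the window, so the window estimates apply to it. An eigenvector solves the bordered
    equation with [s = 0], which bounds the eigenvalue error, and coercivity then bounds the
    eigenvector error. *)
Lemma pencil_largest_eigenvalue_expansion : exists l,
  [/\ largest_gen_eigenvalue M1 G1 l, `|l - rho| <= D1 * kap &
      `|l - rho - dot cs ((M1 - rho *: G1) *m c)| <= D3 * kap ^+ 2].
Proof.
move: rho0 C01 K1 eps0 eps1 eta0 eta2 delta0 => hr hC hK he he1 ht ht2 hd.
have [l0 [l0ab rl0 p0]] := pencil_eigenvalue_exists.
have [l rl lmax] := exists_largest_root p0 (ex_intro _ l0 rl0).
have rootP x : root (pencil_poly M1 G1) x <-> gen_eigenvalue M1 G1 x.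
  by rewrite gen_eigenvalueP -pencil_polyE; split=> /rootP.
have lgen : gen_eigenvalue M1 G1 l by apply/rootP.
have le : `|l - rho| <= eps.
  by have := no_larger lgen; have := lmax _ rl0; rewrite ler_norml; lra.
have kap0 : 0 <= kap by rewrite addr_ge0.
have ek : eta + K * (delta * (2 + rho)) <= K * (2 + rho) * kap.
  have : 0 <= (K * (2 + rho) - 1) * eta.
    by rewrite mulr_ge0// subr_ge0; have := ler_pM ler01 ler01 K1 (_ : 1 <= 2 + rho); rewrite mulr1; apply; lra.
  by rewrite /kap; lra.
have D10 : 0 <= D1 by rewrite !mulr_ge0//; lra.
have KA0 : 0 <= K * (2 + rho) by rewrite mulr_ge0//; lra.
have [w w0 Ew] := lgen.
have Ew0 : E l w = 0 by rewrite /E mulmxBl Ew scalemxAl subrr.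
have tw : dot cs w != 0.
  apply: contra_neq w0 => tw.
  by have [] := @bordered_pencil_inj l w 0 le _ tw; rewrite ?scale0r ?addr0.
(* This normalization makes [v - c] nearly orthogonal to [cs], so coercivity bounds it. *)
pose v := (dot cs w)^-1 *: w.
have Ev : E l v = 0 by rewrite /E /v -scalemxAr -/(E l w) Ew0 scaler0.
have tv : dot cs v = 1 by rewrite dotZr mulVf.
have [|vn lr] := @bordered_pencil_bound l v 0 le; first by rewrite scale0r addr0.
move: vn lr; rewrite tv normr1 !mulr1 mul0r sub0r normrN => vn lr.
have lD1 : `|l - rho| <= D1 * kap.
  apply: le_trans lr _; apply: le_trans (ler_pM _ _ ek vn) _.
  - by rewrite addr_ge0// !mulr_ge0//; lra.
  - exact: vnorm_ge0.
  - by rewrite /D1; lra.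
exists l; split=> //.
  by split=> // l' /rootP; exact: lmax.
have M0v : vnorm (M0 *m v - rho *: v) <= (2 + rho + D1) * (2 * C0) * kap.
  rewrite -[_ - _]opprK -[- (_ - _)]add0r -Ev vnormN.
  apply: le_trans (pencil_near v le) _.
  rewrite mulrAC; apply: ler_pM => //; [|exact: vnorm_ge0|].
    by rewrite addr_ge0// mulr_ge0//; lra.
  have : 0 <= (2 + rho) * eta by rewrite mulr_ge0//; lra.
  by rewrite /kap mulrDl -/kap; move: lD1; rewrite /kap; lra.
have vc : vnorm (v - c) <= D2 * kap.
  apply: le_trans (coercive _) _; rewrite /D2 -mulrA ler_wpM2l//; first lra.
  rewrite mulmxBr scalerBr dotBr tv (distrC 1) mulrDl.
  have -> : M0 *m v - M0 *m c - (rho *: v - rho *: c) =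
     (M0 *m v - rho *: v) - (M0 *m c - rho *: c).
    by apply/matrixP => i j; rewrite !mxE; ring.
  have := vnormB (M0 *m v - rho *: v) (M0 *m c - rho *: c).
  have : eta <= kap by rewrite lerDr.
  by move: M0v c_eigen c_cs; lra.
have e0 : `|rho - rho| <= eps by rewrite subrr normr0 ltW.
(* The remainder becomes two products of first-order factors: the residual of [cs] at [rho] against
   [v - c], and the eigenvalue error against the error of [G1]. The null term [rho - rho] gives it
   the form of [dot_pencil_near] at [l = rho]. *)
have -> : l - rho - dot cs ((M1 - rho *: G1) *m c) =
    (dot cs (E rho (v - c)) + (rho - rho) * dot cs (v - c))
    - (l - rho) * dot cs (G1 *m v - v).
  have dotE x u : dot cs (E x u) = dot cs (M1 *m u) - x * dot cs (G1 *m u).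
    by rewrite /E mulmxBl -scalemxAl dotBr dotZr.
  have : dot cs (E l v) = 0 by rewrite Ev -(scale0r 0) dotZr mul0r.
  rewrite -/(E rho c) !dotE !mulmxBr !dotBr tv; lra.
apply: le_trans (ler_normB _ _) _; rewrite /D3 [leRHS]mulrDl lerD//.
  apply: le_trans (dot_pencil_near (v - c) e0) _.
  rewrite expr2 mulrACA; apply: ler_pM => //; last exact: vnorm_ge0.
  by rewrite addr_ge0// !mulr_ge0//; lra.
rewrite normrM expr2 mulrACA; apply: ler_pM => //.
apply: le_trans (dot_le _ _) _; rewrite -mulrA; apply: ler_pM => //; try exact: vnorm_ge0.
apply: le_trans (G1_close _) _; rewrite mulrC; apply: ler_pM => //; first exact: vnorm_ge0.
by rewrite lerDl.
Qed.

End pencil_perturbation.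

(** * Sieve approximation *)

Section large_eigenvalues.
Context {R : realType} {k : nat}.

(** Coercivity is available only on a bounded interval, so an eigenvalue above [a] is first confined
    by norms to [2 * K + 1]; there the eigenvector violates coercivity. *)
Lemma gen_eigenvalue_le (M0 G1 M1 : 'M[R]_k) (K C1 a delta l : R) :
  0 < a -> 0 <= K -> 0 <= C1 -> 0 <= delta -> delta <= 2^-1 ->
  (forall v, vnorm (M0 *m v) <= K * vnorm v) ->
  (forall v, vnorm (G1 *m v - v) <= delta * vnorm v) ->
  (forall v, vnorm (M1 *m v - M0 *m v) <= delta * vnorm v) ->
  (forall x v, a <= x <= 2 * K + 1 -> vnorm v <= C1 * vnorm (M0 *m v - x *: v)) ->
  C1 * (delta * (2 * K + 2)) <= 2^-1 ->
  gen_eigenvalue M1 G1 l -> l <= a.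
Proof.
move=> a0 K0 C0 d0 d2 M0K Gd Md coer small [v v0 Mv]; rewrite leNgt; apply/negP => al.
have l0 : 0 < l by exact: lt_trans al.
have vp : 0 < vnorm v.
  rewrite lt_neqAle vnorm_ge0 andbT eq_sym; apply: contra_neq v0; exact: vnorm_eq0.
(* From [l <= K + delta + l * delta] with [delta <= 1/2]. *)
have l1 : l <= 2 * K + 1.
  have e1 : l *: v = M0 *m v + (M1 *m v - M0 *m v) - l *: (G1 *m v - v).
    by rewrite Mv scalerBr; apply/matrixP => i j; rewrite !mxE; ring.
  have : l * vnorm v <= (K + delta + l * delta) * vnorm v.
    rewrite -{1}(gtr0_norm l0) -vnormZ e1; apply: le_trans (vnormB _ _) _.
    rewrite vnormZ (gtr0_norm l0) mulrDl -mulrA lerD ?ler_wpM2l ?(ltW l0)//.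
    by apply: le_trans (vnormD _ _) _; rewrite mulrDl lerD.
  rewrite ler_pM2r// => h.
  have : l * delta <= l * 2^-1 by rewrite ler_wpM2l// ltW.
  by lra.
have := coer l v; rewrite (ltW al) l1 => /(_ isT) h.
have h2 : vnorm (M0 *m v - l *: v) <= delta * (2 * K + 2) * vnorm v.
  have -> : M0 *m v - l *: v = l *: (G1 *m v - v) - (M1 *m v - M0 *m v).
    by rewrite Mv scalerBr; apply/matrixP => i j; rewrite !mxE; ring.
  apply: le_trans (vnormB _ _) _; rewrite vnormZ (gtr0_norm l0).
  apply: (@le_trans _ _ (l * (delta * vnorm v) + delta * vnorm v)).
    by rewrite lerD// ler_wpM2l// ltW.
  have : l * (delta * vnorm v) <= (2 * K + 1) * (delta * vnorm v).
    by rewrite ler_wpM2r// mulr_ge0// ltW.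
  by lra.
have h3 : C1 * vnorm (M0 *m v - l *: v) <= 2^-1 * vnorm v.
  apply: (@le_trans _ _ (C1 * (delta * (2 * K + 2)) * vnorm v)).
    by rewrite -mulrA ler_wpM2l.
  by rewrite ler_wpM2r// ltW.
lra.
Qed.

End large_eigenvalues.

(** * Orthonormal coordinates on the sieve space *)

Section sieve_coordinates.
Context {R : realType} {d : measure_display} {T : measurableType d}.
Variable Q : probability T R.
Variables (k : nat) (b : 'I_k -> T -> R).
Hypothesis bL2 : forall i, L2 Q (b i).
Variables (H : 'M[R]_k) (Pi : (T -> R) -> T -> R).
Hypothesis H_inv_sqrt : is_inv_sqrt (\matrix_(i, j) inner Q (b i) (b j)) H.
Hypothesis Pi_proj : orth_projection Q b Pi.
Let G : 'M[R]_k := \matrix_(i, j) inner Q (b i) (b j).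

(** Applying [H], the inverse square root of the Gram matrix, makes [v] a vector of coordinates in
    an orthonormal basis, so that this map is an isometry. *)
Definition sieve_fun (v : 'cV[R]_k) (x : T) : R := \sum_i (H *m v) i 0 * b i x.

Lemma sieve_fun_L2 v : L2 Q (sieve_fun v).
Proof. exact: L2_sum. Qed.

Lemma inv_sqrt_conj : H *m G *m H = 1%:M.
Proof.
have [uG HT _ HH] := H_inv_sqrt.
have : (G *m H) *m H = 1%:M by rewrite -mulmxA HH mulmxV.
by move=> /mulmx1C; rewrite mulmxA.
Qed.

Lemma inv_sqrt_unit : H \in unitmx.
Proof. by have /mulmx1_unit[] := esym (esym inv_sqrt_conj). Qed.

Lemma inner_sieve_fun u v : inner Q (sieve_fun u) (sieve_fun v) = dot u v.
Proof.
have [_ HT _ _] := H_inv_sqrt.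
transitivity (dot (H *m u) (G *m (H *m v))).
  rewrite inner_sum//; last exact: sieve_fun_L2.
  apply: eq_bigr => i _; congr (_ * _); rewrite innerC inner_sum//.
  by rewrite [RHS]mxE; apply: eq_bigr => j _; rewrite mulrC; congr (_ * _); rewrite [RHS]mxE innerC.
by rewrite dot_mulmxl HT !mulmxA inv_sqrt_conj mul1mx.
Qed.

Lemma L2norm_sieve_fun v : L2norm Q (sieve_fun v) = vnorm v.
Proof.
apply/eqP; rewrite -(@eqrXn2 _ 2)// ?L2norm_ge0 ?vnorm_ge0//.
by rewrite sqr_L2norm ?inner_sieve_fun ?sqr_vnorm//; exact: sieve_fun_L2.
Qed.

Lemma sieve_fun_span g : lin_span b g -> exists w, g = sieve_fun w.
Proof.
move=> [c ->]; exists (invmx H *m \col_i c i); apply/funext => x.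
apply: eq_bigr => i _; rewrite mulKVmx ?mxE//; exact: inv_sqrt_unit.
Qed.

Lemma projection_coords f : L2 Q f ->
  exists2 w, Pi f = sieve_fun w & forall u, dot u w = inner Q (sieve_fun u) f.
Proof.
move=> hf; have [/sieve_fun_span[w fw] orth] := Pi_proj hf.
exists w => // u; have hu := sieve_fun_L2 u; have hw := sieve_fun_L2 w.
have : lin_span b (sieve_fun u) by exists (fun i => (H *m u) i 0).
move=> /orth; rewrite fw innerB// => /eqP; rewrite subr_eq0 => /eqP.
by rewrite inner_sieve_fun innerC => ->; rewrite dotC.
Qed.

(** Bessel's inequality, obtained by testing the coordinates against themselves. *)
Lemma vnorm_coords_le w f : L2 Q f ->
  (forall u, dot u w = inner Q (sieve_fun u) f) -> vnorm w <= L2norm Q f.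
Proof.
move=> hf hw; have [->|w0] := eqVneq (vnorm w) 0; first exact: L2norm_ge0.
have wp : 0 < vnorm w by rewrite lt_neqAle eq_sym w0 vnorm_ge0.
rewrite -(ler_pM2l wp) -expr2 sqr_vnorm hw -L2norm_sieve_fun.
by apply: le_trans (ler_norm _) (inner_le _ _) => //; exact: sieve_fun_L2.
Qed.

Variable A : (T -> R) -> T -> R.
Hypothesis A_linear : ae_linear Q A.
Hypothesis A_bounded : bounded_op Q A.

Lemma inner_op_comb a c f g h : L2 Q f -> L2 Q g -> L2 Q h ->
  inner Q (A (fun x => a * f x + c * g x)) h = a * inner Q (A f) h + c * inner Q (A g) h.
Proof.
move=> hf hg hh; have hA f' := @op_L2 _ _ _ _ _ A_bounded f'.
rewrite -inner_comb//; try exact: hA.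
congr fine; apply: ae_eq_integral => //.
- by apply: (measurable_int Q); apply: L2_integrable_mul hh; apply: hA; exact: L2_comb.
- apply: (measurable_int Q).
  by apply: (L2_integrable_mul (f := fun x => a * A f x + c * A g x)) => //; apply: L2_comb; exact: hA.
- by apply: filterS (A_linear a c hf hg) => x /(_ I)/= -> _.
Qed.

Lemma inner_op_sum n (c : 'I_n -> R) (f : 'I_n -> T -> R) h :
  (forall i, L2 Q (f i)) -> L2 Q h ->
  inner Q (A (fun x => \sum_i c i * f i x)) h = \sum_i c i * inner Q (A (f i)) h.
Proof.
move=> hf hh; elim: n c f hf => [|n IH] c f hf.
  have z := L2_cst0 Q.
  rewrite big_ord0; have := inner_op_comb 0 0 z z hh; rewrite !mul0r addr0 => e0.
  rewrite -[RHS]e0; congr (inner _ (A _) _); apply/funext => x.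
  by rewrite big_ord0 !mul0r addr0.
have hS : L2 Q (fun x => \sum_i c (widen_ord (leqnSn n) i) * f (widen_ord (leqnSn n) i) x).
  exact: L2_sum.
have := inner_op_comb 1 (c ord_max) hS (hf ord_max) hh; rewrite IH// mul1r big_ord_recr/= => e0.
rewrite -[RHS]e0; congr (inner _ (A _) _); apply/funext => x.
by rewrite big_ord_recr/= mul1r.
Qed.

Let M : 'M[R]_k := \matrix_(i, j) inner Q (b i) (A (b j)).
Let M0 := H *m M *m H.

Lemma inner_sieve_fun_op u v :
  inner Q (sieve_fun u) (A (sieve_fun v)) = dot u (M0 *m v).
Proof.
have [_ HT _ _] := H_inv_sqrt.
transitivity (dot (H *m u) (M *m (H *m v))); last first.
  by rewrite dot_mulmxl HT /M0 !mulmxA.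
have hA f := @op_L2 _ _ _ _ _ A_bounded f.
rewrite inner_sum//; last by apply: hA; exact: sieve_fun_L2.
apply: eq_bigr => i _; congr (_ * _); rewrite innerC inner_op_sum//.
by rewrite [RHS]mxE; apply: eq_bigr => j _; rewrite mulrC; congr (_ * _); rewrite [RHS]mxE innerC.
Qed.

Lemma dot_inj (w w' : 'cV[R]_k) : (forall u, dot u w = dot u w') -> w = w'.
Proof.
move=> h; apply/eqP; rewrite -subr_eq0; apply/eqP/vnorm_eq0/eqP.
by rewrite -sqrf_eq0 sqr_vnorm dotBr h subrr.
Qed.

Lemma projection_op v : Pi (A (sieve_fun v)) = sieve_fun (M0 *m v).
Proof.
have hA := op_L2 A_bounded (sieve_fun_L2 v).
have [w -> hw] := projection_coords hA; congr sieve_fun.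
by apply: dot_inj => u; rewrite hw inner_sieve_fun_op.
Qed.

(** [M0 *m v - l *: w] are the coordinates of the projection of [A (sieve_fun v) - l f], and
    projection does not increase norms. The case [f = phi] is the one used. *)
Lemma vnorm_op_residual_le v f (l : R) w : L2 Q f ->
  (forall u, dot u w = inner Q (sieve_fun u) f) ->
  vnorm (M0 *m v - l *: w) <= L2norm Q (fun x => A (sieve_fun v) x - l * f x).
Proof.
move=> hf hw; have hA := op_L2 A_bounded (sieve_fun_L2 v).
apply: vnorm_coords_le; first by apply: L2B => //; exact: L2Z.
move=> u; rewrite innerC innerB//; [|exact: L2Z|exact: sieve_fun_L2].
rewrite innerZ//; last exact: sieve_fun_L2.
by rewrite dotBr dotZr hw ![inner Q _ (sieve_fun u)]innerC inner_sieve_fun_op.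
Qed.

Lemma vnorm_M0_le (K : R) v : (forall f, L2 Q f -> L2norm Q (A f) <= K * L2norm Q f) ->
  vnorm (M0 *m v) <= K * vnorm v.
Proof.
move=> hK; rewrite -[vnorm v]L2norm_sieve_fun; apply: le_trans (hK _ (sieve_fun_L2 v)).
apply: vnorm_coords_le => [|u]; first exact: op_L2 (sieve_fun_L2 v).
by rewrite inner_sieve_fun_op.
Qed.

(** The converse passage, from an approximate eigenvector of the matrix to one of [A]; it costs only
    the projection defect. *)
Lemma L2norm_op_residual_le v (l : R) :
  L2norm Q (fun x => A (sieve_fun v) x - l * sieve_fun v x) <=
  L2norm Q (fun x => Pi (A (sieve_fun v)) x - A (sieve_fun v) x) + vnorm (M0 *m v - l *: v).
Proof.
have hF := sieve_fun_L2; have hA := op_L2 A_bounded (hF v).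
rewrite projection_op (L2norm_distC (hF (M0 *m v)) hA) -L2norm_sieve_fun.
apply: le_trans (L2norm_dist_trans hA (hF (M0 *m v)) (L2Z l (hF v))) _.
rewrite lerD2l le_eqVlt; apply/orP; left; apply/eqP; congr L2norm.
apply/funext => x; rewrite /sieve_fun mulr_sumr -sumrB; apply: eq_bigr => i _.
by rewrite mulmxBr -scalemxAr !mxE mulrBl mulrA.
Qed.

End sieve_coordinates.

(** * Lower bounds uniform in the sieve dimension *)

Section sieve_coercivity.
Context {R : realType} {d : measure_display} {T : measurableType d}.
Variable Q : probability T R.
Variables (b : forall k, 'I_k -> T -> R) (H : forall k, 'M[R]_k).
Arguments b : clear implicits.
Variables (Pi : nat -> (T -> R) -> T -> R) (k : nat -> nat).
Hypothesis bL2 : forall n i, L2 Q (b n i).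
Hypothesis H_inv_sqrt :
  forall n, is_inv_sqrt (\matrix_(i, j) inner Q (b n i) (b n j)) (H n).
Hypothesis Pi_proj : forall n, orth_projection Q (b n) (Pi n).
Variable A : (T -> R) -> T -> R.
Hypothesis A_linear : ae_linear Q A.
Hypothesis A_bounded : bounded_op Q A.
Hypothesis Pi_A_cvg : forall e : R, 0 < e -> exists N, forall n, (N <= n)%N ->
  forall f, L2 Q f -> L2norm Q f <= 1 ->
    L2norm Q (fun x => Pi (k n) (A f) x - A f x) <= e.

Definition sieve_op n : 'M[R]_n :=
  H n *m (\matrix_(i, j) inner Q (b n i) (A (b n j))) *m H n.

(** The bound on the coefficients involves [mxopnorm (H n)], which is not controlled as n grows;
    this is harmless because each [e] uses a single index. *)
Lemma sieve_op_finite_rank : finite_rank_approximable Q A.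
Proof.
move=> e e0; have [N hN] := Pi_A_cvg e0; pose n := k N.
have [K K0 hK] := bounded_op_ge0 A_bounded.
have /choice[w hw] : forall f, exists w : 'cV[R]_n, L2 Q f ->
    Pi n (A f) = sieve_fun (b n) (H n) w /\ vnorm w <= K * L2norm Q f.
  move=> f; have [hf|nf] := pselect (L2 Q f); last by exists 0 => /nf.
  have [hA hAK] := hK f hf.
  have [w fw ew] := projection_coords (@bL2 n) (H_inv_sqrt n) (@Pi_proj n) hA.
  exists w => _; split=> //.
  exact: le_trans (vnorm_coords_le (@bL2 n) (H_inv_sqrt n) hA ew) hAK.
exists n, (b n), (fun f i => (H n *m w f) i 0), (mxopnorm (H n) * K).
split; first exact: bL2.
move=> f hf f1; have [fw wK] := hw f hf; split=> [i|].
  apply: le_trans (coord_le_vnorm _ _) _; apply: le_trans (vnorm_mulmx_le _ _) _.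
  rewrite ler_wpM2l ?mxopnorm_ge0//; apply: le_trans wK _.
  by rewrite -[leRHS]mulr1 ler_wpM2l.
have := hN N (leqnn N) f hf f1; rewrite -/n fw L2norm_distC//; last exact: op_L2.
exact: sieve_fun_L2.
Qed.

(* A sequence of unit vectors violating coercivity yields approximate
   eigenvectors of the operator itself. *)
Lemma sieve_coercive_of_no_limit (a L : R) (psi : T -> R) : 0 < a -> L2 Q psi ->
  (forall g lam, L2 Q g -> L2norm Q g = 1 -> a <= lam <= L ->
     A g = (fun x => lam * g x) %[ae Q] -> inner Q g psi <> 0) ->
  exists2 C, 1 <= C & exists N, forall n, (N <= n)%N -> forall l v, a <= l <= L ->
    vnorm v <= C * (vnorm (sieve_op (k n) *m v - l *: v)
                    + `|inner Q (sieve_fun (b (k n)) (H (k n)) v) psi|).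
Proof.
move=> a0 hpsi nolim; apply: contrapT => nex.
have /choice[fl hfl] : forall j : nat, exists fl : (T -> R) * R,
    [/\ L2 Q fl.1, L2norm Q fl.1 = 1, a <= fl.2 <= L,
      L2norm Q (fun x => A fl.1 x - fl.2 * fl.1 x) <= 2^-1 ^+ j &
      `|inner Q fl.1 psi| <= 2^-1 ^+ j].
  (* Half of [2^-1 ^+ j] is reserved for the projection defect and half for the matrix residual;
     hence the violated constant [2 ^+ j.+1]. *)
  move=> j; have e0 : 0 < 2^-1 ^+ j.+1 :> R by rewrite exprn_gt0.
  have [N hN] := Pi_A_cvg e0.
  have : exists n, (N <= n)%N /\ exists l v, a <= l <= L /\
      2 ^+ j.+1 * (vnorm (sieve_op (k n) *m v - l *: v)
          + `|inner Q (sieve_fun (b (k n)) (H (k n)) v) psi|) < vnorm v.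
    apply: contrapT => nn; apply: nex; exists (2 ^+ j.+1).
      by rewrite exprn_ege1//; lra.
    exists N => n Nn l v al; rewrite leNgt; apply/negP => h.
    by apply: nn; exists n; split=> //; exists l, v.
  move=> [n [Nn [l [v [al lt_v]]]]].
  have hb := @bL2 (k n); have hH := H_inv_sqrt (k n).
  have v0 : 0 < vnorm v.
    apply: le_lt_trans lt_v; rewrite mulr_ge0 ?exprn_ge0//.
    by rewrite addr_ge0 ?vnorm_ge0.
  pose u := (vnorm v)^-1 *: v.
  have u1 : vnorm u = 1.
    by rewrite vnormZ ger0_norm ?invr_ge0 ?vnorm_ge0// mulVf ?gt_eqF.
  have hF := sieve_fun_L2 hb (H (k n)).
  have n1 : L2norm Q (sieve_fun (b (k n)) (H (k n)) u) = 1.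
    by rewrite (L2norm_sieve_fun hb hH).
  have small : vnorm (sieve_op (k n) *m u - l *: u) +
      `|inner Q (sieve_fun (b (k n)) (H (k n)) u) psi| <= 2^-1 ^+ j.+1.
    have -> : sieve_op (k n) *m u - l *: u =
        (vnorm v)^-1 *: (sieve_op (k n) *m v - l *: v).
      by rewrite /u -scalemxAr scalerBr !scalerA mulrC.
    have -> : sieve_fun (b (k n)) (H (k n)) u =
        fun x => (vnorm v)^-1 * sieve_fun (b (k n)) (H (k n)) v x.
      apply/funext => x; rewrite /sieve_fun mulr_sumr; apply: eq_bigr => i _.
      by rewrite /u -scalemxAr mxE mulrA.
    rewrite innerZ// vnormZ normrM -mulrDr [X in X * _]ger0_norm ?invr_ge0 ?(ltW v0)//.
    rewrite ler_pdivrMl// exprVn ler_pdivlMr ?exprn_gt0//.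
    by rewrite mulrC ltW.
  have half : 2^-1 ^+ j.+1 <= 2^-1 ^+ j :> R.
    by rewrite exprS ger_pMl ?exprn_gt0// invf_le1//; lra.
  exists (sieve_fun (b (k n)) (H (k n)) u, l); split=> //=.
  - apply: le_trans (L2norm_op_residual_le hb hH (@Pi_proj (k n)) A_linear A_bounded u l) _.
    have p1 : L2norm Q (fun x => Pi (k n) (A (sieve_fun (b (k n)) (H (k n)) u)) x -
        A (sieve_fun (b (k n)) (H (k n)) u) x) <= 2^-1 ^+ j.+1.
      by apply: hN => //; rewrite n1.
    have p2 : vnorm (sieve_op (k n) *m u - l *: u) <= 2^-1 ^+ j.+1.
      by apply: le_trans small; rewrite lerDl.
    apply: le_trans (lerD p1 p2) _; rewrite exprS; lra.
  - by apply: le_trans half; apply: le_trans small; rewrite lerDr vnorm_ge0.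
have [||||g [lam [gL g1 alam eig close]]] := @approximate_eigenvectors_cluster
    _ _ _ _ _ A_linear A_bounded sieve_op_finite_rank (fun j => (fl j).1)
    (fun j => (fl j).2) a L a0.
- by move=> j; have [] := hfl j.
- by move=> j; have [] := hfl j.
- by move=> j; have [] := hfl j.
- move=> e e0; have [N hN] := geometric_small 1 e0; exists N => j /hN.
  by have [_ _ _ h _] := hfl j; rewrite mul1r; exact: le_trans.
apply: (nolim g lam gL g1 alam eig); apply/eqP; rewrite -normr_le0; apply/ler_addgt0Pl => e e0.
rewrite addr0; have e2 : 0 < e / 2 / (L2norm Q psi + 1).
  by rewrite divr_gt0 ?divr_gt0// ltr_wpDl// L2norm_ge0.
have [N hN] := @geometric_small R 1 (e / 2) ltac:(by rewrite divr_gt0).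
have [j Nj fg] := close _ N e2; have [fL _ _ _ fpsi] := hfl j.
have -> : inner Q g psi = inner Q (fl j).1 psi - inner Q (fun x => (fl j).1 x - g x) psi.
  by rewrite innerB// opprB addrC subrK.
apply: le_trans (ler_normB _ _) _; rewrite [leRHS](splitr e) lerD//.
  by apply: le_trans fpsi _; rewrite -[leLHS]mul1r; exact: hN.
apply: le_trans (inner_le (L2B fL gL) hpsi) _.
apply: (@le_trans _ _ (e / 2 / (L2norm Q psi + 1) * (L2norm Q psi + 1))).
  by apply: ler_pM; rewrite ?L2norm_ge0// lerDl.
by rewrite divfK// gt_eqF// ltr_wpDl// L2norm_ge0.
Qed.

End sieve_coercivity.

(** * Expansion of the largest sample eigenvalue *)

Section sample_eigenvalue.
Context {R : realType} {d : measure_display} {T : measurableType d}.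
Variable Q : probability T R.
Variables (b : forall k, 'I_k -> T -> R) (H : forall k, 'M[R]_k).
Arguments b : clear implicits.
Variables (Pi : nat -> (T -> R) -> T -> R) (k : nat -> nat).
Hypothesis bL2 : forall n i, L2 Q (b n i).
Hypothesis H_inv_sqrt :
  forall n, is_inv_sqrt (\matrix_(i, j) inner Q (b n i) (b n j)) (H n).
Hypothesis Pi_proj : forall n, orth_projection Q (b n) (Pi n).
Variables A Astar : (T -> R) -> T -> R.
Hypothesis A_linear : ae_linear Q A.
Hypothesis A_bounded : bounded_op Q A.
Hypothesis A_adjoint : is_adjoint Q A Astar.
Hypothesis Pi_A_cvg : forall e : R, 0 < e -> exists N, forall n, (N <= n)%N ->
  forall f, L2 Q f -> L2norm Q f <= 1 ->
    L2norm Q (fun x => Pi (k n) (A f) x - A f x) <= e.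
Variables (phi phis : T -> R) (rho : R).
Hypotheses (phiL2 : L2 Q phi) (phisL2 : L2 Q phis) (rho_gt0 : 0 < rho).
Hypothesis A_phi : A phi = (fun x => rho * phi x) %[ae Q].
Hypothesis Astar_phis : Astar phis = (fun x => rho * phis x) %[ae Q].
Hypothesis rho_simple : simple_eigenvalue Q A rho.
Hypothesis rho_largest : largest_eigenvalue Q A rho.
Hypothesis phi_norm : L2norm Q phi = 1.
Hypothesis phi_phis : inner Q phi phis = 1.

Lemma inner_ae f g h : L2 Q f -> L2 Q g -> L2 Q h -> f = g %[ae Q] ->
  inner Q f h = inner Q g h.
Proof.
move=> hf hg hh /(ae_L2norm_dist_eq0 hf hg) fg0.
apply/eqP; rewrite -subr_eq0 -innerB// -normr_le0.
by apply: le_trans (inner_le (L2B hf hg) hh) _; rewrite fg0 mul0r.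
Qed.

Lemma L2norm1_not_ae0 f : L2 Q f -> L2norm Q f = 1 -> ~ f = cst 0 %[ae Q].
Proof.
move=> hf f1 /(ae_L2norm_dist_eq0 hf (L2_cst0 Q)).
rewrite (_ : (fun x => f x - _) = f) ?f1; last by apply/funext => x /=; rewrite subr0.
by move/eqP; rewrite oner_eq0.
Qed.

(* The pairing [<phi, phis> = 1] makes the geometrically simple eigenvalue
   algebraically simple: no other eigenvector is orthogonal to [phis]. *)
Lemma eigenvector_not_orthogonal g : L2 Q g -> L2norm Q g = 1 ->
  A g = (fun x => rho * g x) %[ae Q] -> inner Q g phis <> 0.
Proof.
move=> hg g1 Ag; have [_ simple] := rho_simple.
have [c gc] : exists c : R, g = (fun x => c * phi x) %[ae Q].
  by apply: simple; split=> //; exact: L2norm1_not_ae0.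
have := inner_ae hg (L2Z c phiL2) phisL2 gc; rewrite innerZ// phi_phis mulr1 => -> c0.
apply: (L2norm1_not_ae0 hg g1); apply: filterS gc => x /(_ I) /= gx _.
by rewrite gx c0 mul0r.
Qed.

Let M0 n : 'M[R]_n := sieve_op Q b H A n.
Let proj_err n := L2norm Q (fun x => Pi n phi x - phi x)
                + L2norm Q (fun x => Pi n phis x - phis x).
Hypothesis proj_err_cvg :
  forall e : R, 0 < e -> exists N, forall n, (N <= n)%N -> proj_err (k n) <= e.

Definition coords_of n f (c : 'cV[R]_n) := Pi n f = sieve_fun (b n) (H n) c /\
  forall u, dot u c = inner Q (sieve_fun (b n) (H n) u) f.

Lemma proj_err_ge n : L2norm Q (fun x => Pi n phi x - phi x) <= proj_err n /\
  L2norm Q (fun x => Pi n phis x - phis x) <= proj_err n.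
Proof. by rewrite lerDl lerDr !L2norm_ge0. Qed.

(** As [A phi = rho phi], the residual is the projection of [A] applied to the projection error of
    [phi]. *)
Lemma sieve_eigenvector_residual (K : R) n (c : 'cV[R]_n) : 0 <= K ->
  (forall f g, L2 Q f -> L2 Q g ->
    L2norm Q (fun x => A f x - A g x) <= K * L2norm Q (fun x => f x - g x)) ->
  coords_of phi c -> vnorm (M0 n *m c - rho *: c) <= K * proj_err n.
Proof.
move=> K0 hK [Pc hc].
have hF := sieve_fun_L2 (@bL2 n) (H n) c; have hAF := op_L2 A_bounded hF.
apply: le_trans (vnorm_op_residual_le (@bL2 n) (H_inv_sqrt n) A_linear A_bounded c rho phiL2 hc) _.
rewrite (eq_L2norm_ae (g := fun x => A (sieve_fun (b n) (H n) c) x - A phi x)).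
- apply: le_trans (hK _ _ hF phiL2) _; rewrite ler_wpM2l// -Pc.
  by have [] := proj_err_ge n.
- by apply: L2B => //; exact: L2Z.
- by apply: L2B => //; exact: (op_L2 A_bounded phiL2).
- by apply: (filterS _ A_phi) => x /(_ I) /= -> _.
Qed.

(** Both terms are inner products with [A (sieve_fun b H v)], one for the projection of [phis] and
    one for [phis] itself by adjunction, so only the projection error of [phis] remains. *)
Lemma sieve_adjoint_residual (K : R) n (cs v : 'cV[R]_n) : 0 <= K ->
  (forall f, L2 Q f -> L2 Q (A f) /\ L2norm Q (A f) <= K * L2norm Q f) ->
  coords_of phis cs ->
  `|dot cs (M0 n *m v) - rho * dot cs v| <= K * proj_err n * vnorm v.
Proof.
move=> K0 hK [Pc hc].
have hF u := sieve_fun_L2 (@bL2 n) (H n) u; have [hAF hAFK] := hK _ (hF v).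
have [hs adj] := A_adjoint (hF v) phisL2.
have e1 : rho * dot cs v = inner Q phis (A (sieve_fun (b n) (H n) v)).
  rewrite dotC hc innerC -innerZ// [RHS]innerC adj [RHS]innerC.
  apply: inner_ae => //; first exact: L2Z.
  by apply: (filterS _ Astar_phis) => x /(_ I) /= -> _.
rewrite e1 -(inner_sieve_fun_op (@bL2 n) (H_inv_sqrt n) A_linear A_bounded) -innerB//.
apply: le_trans (inner_le (L2B (hF cs) phisL2) hAF) _.
rewrite [K * _]mulrC -mulrA; apply: ler_pM; rewrite ?L2norm_ge0//.
  by rewrite -Pc; have [] := proj_err_ge n.
by apply: le_trans hAFK _; rewrite (L2norm_sieve_fun (@bL2 n) (H_inv_sqrt n)).
Qed.

Lemma sieve_pairing n (c cs : 'cV[R]_n) : coords_of phi c -> coords_of phis cs ->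
  `|dot cs c - 1| <= proj_err n.
Proof.
move=> [Pc hc] [Pcs hcs]; have hF u := sieve_fun_L2 (@bL2 n) (H n) u.
rewrite hc -phi_phis (innerC Q phi) -innerB//.
apply: le_trans (inner_le (L2B (hF cs) phisL2) phiL2) _.
by rewrite phi_norm mulr1 -Pcs; have [] := proj_err_ge n.
Qed.

(** The constants are chosen before the matrices, so they serve all sample points and all large n.
    The order matters: [C0] determines [eps], which determines [C1], and only then is the threshold
    [t] fixed. *)
Lemma largest_sample_eigenvalue_expansion :
  exists K, 0 < K /\ exists t D, [/\ 0 < t, 0 <= D & exists N, forall n, (N <= n)%N ->
    forall (M1 G1 : 'M[R]_(k n)) c cs delta, coords_of phi c -> coords_of phis cs ->
    0 <= delta -> delta <= t ->
    (forall v, vnorm (G1 *m v - v) <= delta * vnorm v) ->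
    (forall v, vnorm (M1 *m v - M0 (k n) *m v) <= delta * vnorm v) ->
    exists l, [/\ largest_gen_eigenvalue M1 G1 l,
      `|l - rho| <= D * (delta + K * proj_err (k n)) &
      `|l - rho - dot cs ((M1 - rho *: G1) *m c)| <=
        D * (delta + K * proj_err (k n)) ^+ 2]].
Proof.
have hr := rho_gt0.
have [K1 K10 hK1] := bounded_op_ge0 A_bounded.
have [K2 K20 hK2] := op_lipschitz A_linear A_bounded.
pose K := 1 + K1 + K2 + L2norm Q phis.
have np0 := L2norm_ge0 Q phis.
have Kge1 : 1 <= K by rewrite /K; lra.
have K0 : 0 <= K by lra.
have hKA f : L2 Q f -> L2 Q (A f) /\ L2norm Q (A f) <= K * L2norm Q f.
  move=> hf; have [h1 h2] := hK1 f hf; split=> //; apply: le_trans h2 _.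
  by rewrite ler_wpM2r ?L2norm_ge0// /K; lra.
have hKL f g : L2 Q f -> L2 Q g ->
    L2norm Q (fun x => A f x - A g x) <= K * L2norm Q (fun x => f x - g x).
  move=> hf hg; apply: le_trans (hK2 f g hf hg) _.
  by rewrite ler_wpM2r ?L2norm_ge0// /K; lra.
(* The interval is reduced to [rho], with the functional given by [phis]. *)
have [|C0 C01 [N0 coer0]] := @sieve_coercive_of_no_limit _ _ _ _ _ _ _ _ bL2 H_inv_sqrt
    Pi_proj _ A_linear A_bounded Pi_A_cvg rho rho phis rho_gt0 phisL2.
  move=> g lam hg g1 lr Ag; apply: eigenvector_not_orthogonal => //.
  by have -> : rho = lam by apply/eqP; rewrite eq_le.
(* [C0 * W] is the coefficient of [eps] in [small_coercive]. The choice of [eps] makes that part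
   1/4, leaving another 1/4 for [delta] and [eta]. *)
pose W := 2 * K ^+ 2 + 1.
have W0 : 1 <= W by rewrite /W; have := sqr_ge0 K; lra.
pose eps := (4 * (C0 * W))^-1.
have CW : 1 <= C0 * W by have := ler_pM ler01 ler01 C01 W0; rewrite mulr1.
have eps0 : 0 < eps by rewrite invr_gt0; lra.
have epsE : C0 * W * eps = 4^-1 by rewrite /eps invfM mulrCA mulfV ?mulr1// gt_eqF//; lra.
have eps1 : eps <= 1.
  by rewrite /eps invf_le1; lra.
(* With the zero functional, the condition on limits says that [A] has no eigenvalue in the
   interval, which holds above the largest one. *)
have [||C1 C11 [N1 coer1]] := @sieve_coercive_of_no_limit _ _ _ _ _ _ _ _ bL2 H_inv_sqrt
    Pi_proj _ A_linear A_bounded Pi_A_cvg (rho + eps) (2 * K + 1) (cst 0) _ (L2_cst0 Q).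
- by lra.
- move=> g lam hg g1 /andP[lr _] Ag; have [_ /(_ lam)] := rho_largest.
  have -> : lam <= rho = false by apply/negbTE; rewrite -ltNge; lra.
  have eig : eigenvalue_op Q A lam by exists g; split=> //; exact: L2norm1_not_ae0.
  by move=> /(_ eig).
(* [S] dominates every coefficient of [delta] or [eta] in the smallness conditions, so with
   [t = eps / 8 / S] each such product is at most [eps / 8]. *)
pose S := 1 + C0 * W * (2 + rho) + 2 * K * C0 + 2 * C0 + 2 * C0 * (K * (2 + rho))
  + C1 * (2 * K + 2).
have s1 : 0 <= C0 * W * (2 + rho) by rewrite mulr_ge0//; lra.
have s2 : 0 <= 2 * K * C0 by rewrite mulr_ge0//; lra.
have s3 : 0 <= 2 * C0 by lra.
have s4 : 0 <= 2 * C0 * (K * (2 + rho)) by rewrite !mulr_ge0//; lra.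
have s5 : 0 <= C1 * (2 * K + 2) by rewrite mulr_ge0//; lra.
have S1 : 1 <= S by rewrite /S; lra.
pose t := eps / 8 / S.
have t0 : 0 < t by rewrite !divr_gt0//; lra.
have tS a : 0 <= a -> a <= S -> forall x, 0 <= x -> x <= t -> a * x <= eps / 8.
  move=> a0 aS x x0 xt; have -> : eps / 8 = S * t by rewrite /t [RHS]mulrC divfK// gt_eqF//; lra.
  exact: ler_pM.
have Kt0 : 0 < t / K by rewrite divr_gt0//; lra.
have [N2 hN2] := proj_err_cvg Kt0.
pose D1 := 2 * C0 * (K * (2 + rho)).
pose D2 := C0 * ((2 + rho + D1) * (2 * C0) + 2).
pose D3 := K * (2 + rho) * D2 + D1 * (K * (2 * C0)).
have KA0 : 0 <= K * (2 + rho) by rewrite mulr_ge0//; lra.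
have D10 : 0 <= D1 := s4.
have D20 : 0 <= D2.
  rewrite mulr_ge0//; first lra.
  by rewrite addr_ge0// mulr_ge0//; lra.
have D30 : 0 <= D3.
  by rewrite addr_ge0//; apply: mulr_ge0 => //; rewrite mulr_ge0//; lra.
exists K; split; first lra.
exists t, (D1 + D3); split; [exact: t0|exact: addr_ge0|].
exists (maxn N0 (maxn N1 N2)) => n; rewrite !geq_max => /and3P[nN0 nN1 nN2].
move=> M1 G1 c cs delta hc hcs d0 dt G1d M1d.
set eta := K * proj_err (k n).
have pe0 : 0 <= proj_err (k n) by rewrite addr_ge0// L2norm_ge0.
have eta0 : 0 <= eta by exact: mulr_ge0.
have etat : eta <= t by have := hN2 n nN2; rewrite ler_pdivlMr ?[_ * K]mulrC//; lra.
have b1 := tS _ s1 _ _ d0 dt; have b2 := tS _ s2 _ _ eta0 etat.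
have b3 := tS _ s3 _ _ eta0 etat; have b4 := tS _ s4 _ _ d0 dt.
have b5 := tS _ s5 _ _ d0 dt.
have b6 := tS 1 ler01 S1 _ eta0 etat; have b7 := tS 1 ler01 S1 _ d0 dt.
have {}b1 := b1 ltac:(rewrite /S; lra). have {}b2 := b2 ltac:(rewrite /S; lra).
have {}b3 := b3 ltac:(rewrite /S; lra). have {}b4 := b4 ltac:(rewrite /S; lra).
have {}b5 := b5 ltac:(rewrite /S; lra).
have nolarge l : gen_eigenvalue M1 G1 l -> l <= rho + eps.
  apply: (gen_eigenvalue_le (M0 := M0 (k n)) (K := K) (C1 := C1) (delta := delta)) => //.
  - by lra.
  - by lra.
  - by lra.
  - move=> v; have hK' f (hf : L2 Q f) := (hKA f hf).2.
    exact: (vnorm_M0_le (@bL2 (k n)) (H_inv_sqrt (k n)) A_linear A_bounded).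
  - move=> x v hx; have := coer1 n nN1 x v hx.
    have -> : inner Q (sieve_fun (b (k n)) (H (k n)) v) (cst 0) = 0.
      apply/eqP; rewrite -normr_le0.
      apply: le_trans (inner_le (sieve_fun_L2 (@bL2 (k n)) _ v) (L2_cst0 Q)) _.
      by rewrite L2norm_cst0 mulr0.
    by rewrite normr0 addr0.
  - by lra.
have coer v : vnorm v <= C0 * (vnorm (M0 (k n) *m v - rho *: v) + `|dot cs v|).
  have [_ e] := hcs; rewrite dotC e; apply: coer0 => //; exact/andP.
have cn : vnorm c <= K.
  have [_ e] := hc.
  by apply: le_trans (vnorm_coords_le (@bL2 (k n)) (H_inv_sqrt (k n)) phiL2 e) _; rewrite phi_norm.
have csn : vnorm cs <= K.
  have [_ e] := hcs.
  apply: le_trans (vnorm_coords_le (@bL2 (k n)) (H_inv_sqrt (k n)) phisL2 e) _.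
  by rewrite /K; lra.
have pair : `|dot cs c - 1| <= eta.
  apply: le_trans (sieve_pairing hc hcs) _; rewrite -[leLHS]mul1r /eta.
  by rewrite ler_wpM2r.
have [|||l [l1 l2 l3]] := @pencil_largest_eigenvalue_expansion _ _ (M0 (k n)) G1 M1 c cs rho
    C0 K eps eta delta rho_gt0 C01 Kge1 eps0 eps1 eta0 _ d0 cn csn coer
    (sieve_eigenvector_residual K0 hKL hc)
    (fun v => sieve_adjoint_residual v K0 hKA hcs) pair G1d M1d _ _ nolarge.
- by lra.
- have -> : C0 * (2 * K * (eta + K * (delta * (2 + rho) + eps)) + (delta * (2 + rho) + eps))
     = 2 * K * C0 * eta + C0 * W * (2 + rho) * delta + C0 * W * eps.
    by rewrite /W; ring.
  by rewrite epsE; lra.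
- by lra.
exists l; split=> //.
- apply: le_trans l2 _; rewrite ler_wpM2r ?addr_ge0//.
  by rewrite -[leLHS]/D1; lra.
- apply: le_trans l3 _; rewrite ler_wpM2r ?sqr_ge0//.
  by rewrite -[leLHS]/D3; lra.
Qed.

End sample_eigenvalue.

(** * Consecutive states of the Markov process *)

Section pair_kernel.
Context {R : realType} {d : measure_display} {S : measurableType d}.
Variable kappa : R.-pker S ~> S.
Local Open Scope ereal_scope.

(* The unit factor only serves to fit the domain of [kcomp]. *)
Definition pair_kernel (z : unit * S) (A : set (S * S)) : \bar R :=
  kappa z.2 (xsection A z.2).

Let pair_kernel0 z : pair_kernel z set0 = 0.
Proof. by rewrite /pair_kernel xsection0 measure0. Qed.

Let pair_kernel_ge0 z A : 0 <= pair_kernel z A.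
Proof. exact: measure_ge0. Qed.

Let pair_kernel_sigma_additive z : semi_sigma_additive (pair_kernel z).
Proof.
move=> F mF tF mUF; rewrite /pair_kernel xsection_bigcup.
apply: measure_semi_sigma_additive.
- by move=> n; exact: measurable_xsection.
- exact: trivIset_xsection.
- by rewrite -xsection_bigcup; exact: measurable_xsection.
Qed.

HB.instance Definition _ z := isMeasure.Build _ _ _ (pair_kernel z)
  (pair_kernel0 z) (pair_kernel_ge0 z) (@pair_kernel_sigma_additive z).

Definition mpair_kernel : unit * S -> {measure set (S * S) -> \bar R} := pair_kernel.

Let measurable_pair_kernel U : measurable U ->
  measurable_fun [set: unit * S] (mpair_kernel ^~ U).
Proof.
move=> mU; apply: (measurableT_comp (f := fun x => kappa x (xsection U x))) => //.
by apply: measurable_fun_xsection_finite_kernel; exact/mem_set.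
Qed.

HB.instance Definition _ := isKernel.Build _ _ _ _ _ mpair_kernel measurable_pair_kernel.

Let pair_kernel_setT z : mpair_kernel z [set: S * S] = 1.
Proof.
rewrite /mpair_kernel/= /pair_kernel (_ : xsection _ _ = setT) ?prob_kernel//.
by apply/seteqP; split=> y //= _; rewrite /xsection/= inE.
Qed.

HB.instance Definition _ := Kernel_isProbability.Build _ _ _ _ _ mpair_kernel pair_kernel_setT.

Lemma integral_pair_kernel z (h : S * S -> \bar R) : measurable_fun setT h ->
  (forall y, 0 <= h y) ->
  \int[mpair_kernel z]_y h y = \int[kappa z.2]_y h (z.2, y).
Proof.
move=> mh h0.
transitivity (\int[pushforward (kappa z.2) (pair z.2)]_y h y).
  apply: eq_measure_integral => A mA _; rewrite /mpair_kernel/= /pair_kernel /pushforward.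
  by congr (kappa _ _); apply/seteqP; split=> y; rewrite /xsection/= inE.
by rewrite ge0_integral_pushforward.
Qed.

Variable Q : probability S R.

(** Composed with [mpair_kernel], this constant kernel gives the measure Q(dx) kappa(x, dy) on
    pairs, with its iterated integral supplied by [integral_kcomp]. *)
Definition start_kernel : R.-pker unit ~> S := kprobability
  (measurable_cst (Q : pprobability S R) :
   measurable_fun [set: unit] (cst (Q : pprobability S R))).

Lemma integral_start_pair_kernel (h : S * S -> \bar R) : measurable_fun setT h ->
  (forall y, 0 <= h y) ->
  \int[kcomp start_kernel mpair_kernel tt]_z h z = \int[Q]_x \int[kappa x]_y h (x, y).
Proof.
move=> mh h0; rewrite integral_kcomp//.
by apply: eq_integral => x _; rewrite integral_pair_kernel.
Qed.

End pair_kernel.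

Section markov_pair_law.
Context {R : realType} {dO : measure_display} {Om : measurableType dO}
  {d : measure_display} {S : measurableType d}.
Variables (P : probability Om R) (X : nat -> {RV P >-> S}).
Variables (kappa : R.-pker S ~> S) (Q : probability S R).
Hypothesis X_markov : homogeneous_markov P X kappa.
Hypothesis X_law : forall t A, measurable A -> P (X t @^-1` A) = Q A.

Let mX t : measurable_fun setT (X t).
Proof. exact: measurable_funPT. Qed.

Lemma integral_marginal_law t (A : set S) (h : S -> \bar R) : measurable A ->
  measurable_fun setT h -> (forall x, 0 <= h x)%E ->
  (\int[P]_(w in X t @^-1` A) h (X t w) = \int[Q]_(x in A) h x)%E.
Proof.
move=> mA mh h0.
transitivity (\int[pushforward P (X t)]_(x in A) h x)%E.
  by rewrite ge0_integral_pushforward//; exact: measurable_funS mh.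
by apply: eq_measure_integral => B mB _; exact: X_law.
Qed.

(** The law of two consecutive states is identified on rectangles, which form a generating family
    closed under intersection; there the Markov property applies to the event that [X t] lies in
    [A]. *)
Lemma integral_pair_law t (h : S * S -> \bar R) : measurable_fun setT h ->
  (forall z, 0 <= h z)%E ->
  (\int[P]_w h (X t w, X t.+1 w) = \int[Q]_x \int[kappa x]_y h (x, y))%E.
Proof.
move=> mh h0.
have mXX : measurable_fun setT (fun w => (X t w, X t.+1 w)) by exact: measurable_fun_pair.
rewrite -integral_start_pair_kernel//.
transitivity (\int[pushforward P (fun w => (X t w, X t.+1 w))]_z h z)%E.
  by rewrite ge0_integral_pushforward.
pose XX : {mfun Om >-> (S * S)%type} :=
  HB.pack (fun w => (X t w, X t.+1 w)) (isMeasurableFun.Build _ _ _ _ _ mXX).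
apply: eq_measure_integral => U mU _.
apply: (@measure_unique _ R (S * S)%type
  [set A `*` B | A in measurable & B in measurable] (fun=> setT) _ _ _ _
  (distribution P XX) (mkcomp (start_kernel Q) (mpair_kernel kappa) tt)) => //.
- exact: measurable_prod_measurableType.
- move=> _ _ [A1 mA1 [B1 mB1 <-]] [A2 mA2 [B2 mB2 <-]].
  exists (A1 `&` A2); first exact: measurableI.
  by exists (B1 `&` B2); [exact: measurableI|rewrite setXI].
- by move=> _; exists setT => //; exists setT => //; rewrite setXTT.
- by apply/seteqP; split=> // z _; exists 0%N.
- move=> _ [A mA [B mB <-]].
  transitivity (P (X t @^-1` A `&` X t.+1 @^-1` B)); first by [].
  rewrite (X_markov _ mB); last first.
    by apply: sub_sigma_algebra; exists t, A.
  rewrite (integral_marginal_law t (h := fun x => kappa x B))//; last exact: measurable_kernel.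
  rewrite integral_mkcond; apply: eq_integral => x _.
  rewrite /mpair_kernel/= /pair_kernel /= patchE; case: ifPn => xA.
    by rewrite in_xsectionX.
  by rewrite notin_xsectionX// measure0.
- by move=> _; rewrite /= /distribution /pushforward/= preimage_setT probability_setT ltry.
Qed.

Variable m : S * S -> R.
Hypothesis m_meas : measurable_fun setT m.
Hypothesis m_gt0 : forall z, 0 < m z.
Hypothesis M_defined : Mop_defined Q kappa m.
Hypothesis M_bounded : bounded_op Q (Mop kappa m).
Let M := Mop kappa m.

Lemma Mop_linear : ae_linear Q M.
Proof.
move=> a c f g hf hg; apply: filterS2 (M_defined hf) (M_defined hg) => x /= hfx hgx _.
rewrite /M /Mop -!RintegralZl// -RintegralD//.
- by apply: eq_Rintegral => y _; ring.
- rewrite (_ : EFin \o _ = fun y => a%:E * (m (x, y) * f y)%:E)%E; first exact: integrableZl.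
  by apply/funext => y /=; rewrite EFinM.
- rewrite (_ : EFin \o _ = fun y => c%:E * (m (x, y) * g y)%:E)%E; first exact: integrableZl.
  by apply/funext => y /=; rewrite EFinM.
Qed.

Let mf_pair (f g : S -> R) : measurable_fun setT f -> measurable_fun setT g ->
  measurable_fun setT (fun z : S * S => f z.1 * m z * g z.2).
Proof.
move=> mf mg; apply: measurable_funM; first apply: measurable_funM => //.
- exact: (measurableT_comp mf).
- exact: (measurableT_comp mg).
Qed.

(** Nonnegativity allows the iterated integral to be used before integrability is known;
    integrability then follows because [M g] lies in L^2. *)
Lemma integral_pair_nonneg t (f g : S -> R) : L2 Q f -> L2 Q g ->
  (forall x, 0 <= f x) -> (forall x, 0 <= g x) ->
  (\int[P]_w (f (X t w) * m (X t w, X t.+1 w) * g (X t.+1 w))%:E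
   = (inner Q f (M g))%:E)%E.
Proof.
move=> hf hg f0 g0; have mf := L2_measurable hf; have mg := L2_measurable hg.
have hMg := op_L2 M_bounded hg.
pose h (z : S * S) := (f z.1 * m z * g z.2)%:E.
have mh : measurable_fun setT h by apply/measurable_EFinP; exact: mf_pair.
have h0 z : (0 <= h z)%E by rewrite lee_fin !mulr_ge0// ltW.
rewrite -/(h _) (integral_pair_law t mh h0) /inner /Rintegral fineK; last first.
  by apply: integrable_fin_num => //; exact: L2_integrable_mul.
apply: ge0_ae_eq_integral => //.
- exact: (measurable_fun_integral_finite_kernel (fun z => h z) kappa).
- by apply: (measurable_int Q); exact: L2_integrable_mul.
- by move=> x _; apply: integral_ge0.
- by move=> x _; rewrite lee_fin mulr_ge0// Rintegral_ge0// => y _; rewrite mulr_ge0// ltW.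
- apply: filterS (M_defined hg) => x /= hx _.
  rewrite /M /Mop EFinM /Rintegral fineK; last exact: integrable_fin_num.
  rewrite -integralZl//; apply: eq_integral => y _.
  by rewrite /h/= -EFinM mulrA.
Qed.

(** No moment of [m] itself is available. Since [m] is positive, absolute values fall on [f] and [g]
    alone, and the bound on the operator replaces one on [m]. *)
Lemma integral_pair_abs_le t (f g : S -> R) (K : R) :
  (forall f, L2 Q f -> L2norm Q (M f) <= K * L2norm Q f) -> L2 Q f -> L2 Q g ->
  (\int[P]_w (`|f (X t w) * m (X t w, X t.+1 w) * g (X t.+1 w)|)%:E
   <= (K * (L2norm Q f * L2norm Q g))%:E)%E.
Proof.
move=> hK hf hg; have hf' := L2_norm hf; have hg' := L2_norm hg.
under eq_integral do rewrite !normrM (gtr0_norm (m_gt0 _)).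
rewrite (integral_pair_nonneg t hf' hg')// lee_fin.
apply: le_trans (ler_norm _) _; apply: le_trans (inner_le hf' (op_L2 M_bounded hg')) _.
rewrite L2norm_abs// mulrCA ler_wpM2l ?L2norm_ge0//.
by apply: le_trans (hK _ hg') _; rewrite L2norm_abs.
Qed.

Lemma integrable_pair t (f g : S -> R) : L2 Q f -> L2 Q g ->
  P.-integrable setT
    (fun w => (f (X t w) * m (X t w, X t.+1 w) * g (X t.+1 w))%:E).
Proof.
move=> hf hg; apply/integrableP; split.
  apply/measurable_EFinP.
  apply: (measurableT_comp (mf_pair (L2_measurable hf) (L2_measurable hg)) (g := fun w => (X t w, X t.+1 w))).
  exact: measurable_fun_pair.
have [K _ hK] := bounded_op_ge0 M_bounded.
have hK' f' (hf' : L2 Q f') := (hK f' hf').2.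
by apply: le_lt_trans (integral_pair_abs_le t hK' hf hg) _; exact: ltry.
Qed.

Lemma expectation_pair t (f g : S -> R) : L2 Q f -> L2 Q g ->
  fine 'E_P[fun w => f (X t w) * m (X t w, X t.+1 w) * g (X t.+1 w)] = inner Q f (M g).
Proof.
move=> hf hg.
(* Both sides are bilinear: reduce to the positive and negative parts
   [(|f| + f) / 2] and [(|f| - f) / 2]. *)
pose p (f : S -> R) x := 2^-1 * `|f x| + 2^-1 * f x.
pose q (f : S -> R) x := 2^-1 * `|f x| + (- 2^-1) * f x.
have pL f' : L2 Q f' -> L2 Q (p f') by move=> h; apply: L2_comb => //; exact: L2_norm.
have qL f' : L2 Q f' -> L2 Q (q f') by move=> h; apply: L2_comb => //; exact: L2_norm.
have p0 f' x : 0 <= p f' x by rewrite /p; have := lerNnormlW (lexx `|f' x|); lra.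
have q0 f' x : 0 <= q f' x by rewrite /q; have := ler_norm (f' x); lra.
have fpq f' x : f' x = 1 * p f' x + (-1) * q f' x by rewrite /p /q; lra.
pose I (f g : S -> R) w := f (X t w) * m (X t w, X t.+1 w) * g (X t.+1 w).
have EI f' g' : L2 Q f' -> L2 Q g' -> (forall x, 0 <= f' x) -> (forall x, 0 <= g' x) ->
    \int[P]_w I f' g' w = inner Q f' (M g').
  by move=> h1 h2 h3 h4; rewrite /Rintegral integral_pair_nonneg.
have iI f' g' : L2 Q f' -> L2 Q g' -> P.-integrable setT (EFin \o I f' g').
  exact: integrable_pair.
have hF := pL _ hf; have hF' := qL _ hf; have hG := pL _ hg; have hG' := qL _ hg.
have -> : fine 'E_P[fun w => f (X t w) * m (X t w, X t.+1 w) * g (X t.+1 w)] =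
    \int[P]_w I f g w by rewrite unlock.
have -> : \int[P]_w I f g w = \int[P]_w ((I (p f) (p g) w - I (p f) (q g) w) -
    (I (q f) (p g) w - I (q f) (q g) w)).
  apply: eq_Rintegral => w _; rewrite /I (fpq f) (fpq g); ring.
rewrite RintegralB//; last 2 first.
- exact: (integrableB measurableT (iI _ _ hF hG) (iI _ _ hF hG')).
- exact: (integrableB measurableT (iI _ _ hF' hG) (iI _ _ hF' hG')).
rewrite !RintegralB//; try exact: iI.
rewrite !EI//.
have hM f' : L2 Q f' -> L2 Q (M f') by exact: (op_L2 M_bounded).
have splitg f' : L2 Q f' -> inner Q f' (M g) = inner Q f' (M (p g)) - inner Q f' (M (q g)).
  move=> hf'; have := inner_op_comb Mop_linear M_bounded 1 (-1) hG hG' hf'.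
  rewrite mul1r mulN1r !(innerC Q (M _)) => <-.
  by congr (inner _ _ (M _)); exact/funext/fpq.
have splitf h : L2 Q h -> inner Q f h = inner Q (p f) h - inner Q (q f) h.
  move=> hh; have := inner_comb 1 (-1) hF hF' hh; rewrite mul1r mulN1r => <-.
  by congr (inner _ _ _); exact/funext/fpq.
by rewrite (splitf _ (hM _ hg)) !splitg.
Qed.

Lemma integral_marginal_abs_le t (f g : S -> R) : L2 Q f -> L2 Q g ->
  (\int[P]_w (`|f (X t w) * g (X t w)|)%:E <= (L2norm Q f * L2norm Q g)%:E)%E.
Proof.
move=> hf hg; have hf' := L2_norm hf; have hg' := L2_norm hg.
have := integral_marginal_law t (A := setT) (h := fun x => (`|f x| * `|g x|)%:E) measurableT.
rewrite preimage_setT; under eq_integral do rewrite -normrM.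
move=> ->; last 2 first.
- by apply: (measurable_int Q); exact: (L2_integrable_mul hf' hg').
- by move=> x; rewrite lee_fin mulr_ge0.
have -> : (\int[Q]_x (`|f x| * `|g x|)%:E = (inner Q (fun x => `|f x|) (fun x => `|g x|))%:E)%E.
  rewrite /inner /Rintegral fineK//; apply: integrable_fin_num => //.
  exact: (L2_integrable_mul hf' hg').
rewrite lee_fin; apply: le_trans (ler_norm _) _; apply: le_trans (inner_le hf' hg') _.
by rewrite !L2norm_abs.
Qed.

Lemma expectation_marginal t (f g : S -> R) : L2 Q f -> L2 Q g ->
  fine 'E_P[fun w => f (X t w) * g (X t w)] = inner Q f g.
Proof.
move=> hf hg; rewrite unlock /inner /Rintegral; congr fine.
transitivity (\int[pushforward P (X t)]_x (f x * g x)%:E)%E; last first.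
  by apply: eq_measure_integral => B mB _; exact: X_law.
have mfg : measurable_fun setT (fun x => (f x * g x)%:E).
  by apply: (measurable_int Q); exact: L2_integrable_mul.
rewrite integral_pushforward//; apply/integrableP; split.
  exact: (measurableT_comp mfg).
by apply: le_lt_trans (integral_marginal_abs_le t hf hg) _; exact: ltry.
Qed.

End markov_pair_law.

(** * Convergence in law *)

Section slutsky.
Context {R : realType}.

(** Heine's theorem: two bounded sequences violating it, with distances tending to 0, share a limit
    along an ultrafilter, where continuity is contradicted. *)
Lemma uniformly_continuous_segment (f : R -> R) (K e : R) : continuous f -> 0 < e ->
  exists2 del, 0 < del & forall x y, `|x| <= K -> `|y| <= K -> `|x - y| <= del ->
    `|f x - f y| <= e.
Proof.
move=> cf e0; apply: contrapT => nex.
have /choice[xy hxy] : forall j : nat, exists xy : R * R, [/\ `|xy.1| <= K, `|xy.2| <= K,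
    `|xy.1 - xy.2| <= 2^-1 ^+ j & e < `|f xy.1 - f xy.2| ].
  move=> j; apply: contrapT => nj; apply: nex; exists (2^-1 ^+ j).
    by rewrite exprn_gt0.
  move=> x y xK yK xyj; rewrite leNgt; apply/negP => h.
  by apply: nj; exists (x, y).
have [U [UU ooU]] := ultraFilterLemma (eventually_filter : ProperFilter (\oo : set_system nat)).
have UP : ProperFilter U by exact: ultra_proper.
have [l hl] : exists l : R, (xy j).1 @[j --> U] --> l.
  by apply: (@ultra_bounded_cvg R U _ K UU) => j; have [] := hxy j.
have hl2 : (xy j).2 @[j --> U] --> l.
  have d0 : (xy j).1 - (xy j).2 @[j --> U] --> (0 : R).
    apply/cvgrPdist_le => eps eps0; have [N hN] := geometric_small 1 eps0.
    have : U [set j | (N <= j)%N] by apply: ooU; exact: nbhs_infty_ge.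
    apply: filterS => j /= /hN; rewrite mul1r sub0r normrN; apply: le_trans.
    by have [] := hxy j.
  rewrite (_ : (fun j => (xy j).2) = fun j => (xy j).1 - ((xy j).1 - (xy j).2)).
    by rewrite -[X in _ --> X](subr0 l); exact: cvgB.
  by apply/funext => j; rewrite opprB addrC subrK.
have c1 : f (xy j).1 @[j --> U] --> f l by exact: (cvg_comp _ _ hl (cf l)).
have c2 : f (xy j).2 @[j --> U] --> f l by exact: (cvg_comp _ _ hl2 (cf l)).
have e2 : 0 < e / 2 by rewrite divr_gt0.
have /cvgrPdist_le/(_ _ e2) u1 := c1; have /cvgrPdist_le/(_ _ e2) u2 := c2.
have [j [h1 h2]] := filter_ex (filterI u1 u2).
have [_ _ _] := hxy j; apply/negP; rewrite -leNgt.
rewrite -(subrK (f l) (f (xy j).1)) -addrA; apply: le_trans (ler_normD _ _) _.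
by rewrite [leRHS](splitr e) lerD// distrC.
Qed.

Context {dO : measure_display} {Om : measurableType dO}.
Variable P : probability Om R.

Lemma bounded_integrable d (T : measurableType d) (mu : probability T R) (f : T -> R) (C : R) :
  measurable_fun setT f -> (forall x, `|f x| <= C) -> mu.-integrable setT (EFin \o f).
Proof.
move=> mf fC; apply: (@le_integrable _ _ _ mu setT measurableT _ (EFin \o cst C)).
- exact/measurable_EFinP.
- by move=> x _; rewrite /= lee_fin; apply: le_trans (fC x) (ler_norm _).
- by apply/Lfun1_integrable; exact: Lfun_cst.
Qed.

(** A continuous substitute for the indicator of [|x| > K], admissible as a test function for
    [cvg_law]; it carries tightness from the limit law to [U n]. *)
Definition tail_cutoff (K x : R) : R := Num.min 1 (Num.max 0 (`|x| - K)).

Lemma tail_cutoff_continuous K : continuous (tail_cutoff K).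
Proof.
move=> x.
have c1 : {for x, continuous (fun y : R => `|y| - K : R^o)}.
  by apply: cvgB; [apply: cvg_norm; exact: cvg_id|exact: cvg_cst].
have c0 (a : R) : {for x, continuous (fun _ : R => a : R^o)} by apply: cvg_cst.
exact: (continuous_min (c0 1) (continuous_max (c0 0) c1)).
Qed.

Lemma tail_cutoff_ge0 K x : 0 <= tail_cutoff K x.
Proof. by rewrite le_min ler01 le_max lexx. Qed.

Lemma tail_cutoff_le1 K x : tail_cutoff K x <= 1.
Proof. by rewrite ge_min lexx. Qed.

Lemma tail_cutoff_eq1 K x : K + 1 <= `|x| -> tail_cutoff K x = 1.
Proof.
by move=> h; apply/min_idPl; rewrite le_max; apply/orP; right; rewrite lerBrDl.
Qed.

Lemma tail_cutoff_eq0 K x : `|x| <= K -> tail_cutoff K x = 0.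
Proof.
move=> h; rewrite /tail_cutoff (max_idPl _) ?subr_le0//.
by apply/min_idPr; exact: ler01.
Qed.

Lemma tail_cutoff_small (mu : probability (measurableTypeR R) R) (e : R) : 0 < e ->
  exists K, 0 <= K /\ \int[mu]_x tail_cutoff K x <= e.
Proof.
move=> e0.
have mc K : measurable_fun [set: measurableTypeR R] (tail_cutoff K).
  by apply: continuous_measurable_fun; exact: tail_cutoff_continuous.
have [] := @dominated_convergence _ (measurableTypeR R) R mu setT measurableT
    (fun n x => (tail_cutoff n%:R x)%:E) (cst 0%E) (cst 1%E).
- by move=> n; exact/measurable_EFinP.
- by exact: measurable_cst.
- apply: aeW => x _; apply: cvg_near_cst; near=> n.
  rewrite tail_cutoff_eq0//; near: n; exact: nbhs_infty_ger.
- by apply/Lfun1_integrable; exact: Lfun_cst.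
- by apply: aeW => x n _; rewrite /= lee_fin ger0_norm ?tail_cutoff_ge0// tail_cutoff_le1.
move=> _ _; rewrite integral0 => /fine_cvgP[_ /cvgrPdist_le/(_ _ e0)] [N _ hN].
exists N%:R; split; first exact: ler0n.
have := hN N (leqnn N); rewrite /= sub0r normrN; apply: le_trans.
exact: ler_norm.
Unshelve. all: by end_near. Qed.

Lemma Rintegral_cvg_law (Y : nat -> Om -> R) (mu : probability (measurableTypeR R) R) (f : R -> R) (C : R) :
  (forall n, measurable_fun setT (Y n)) -> continuous f -> (forall x, `|f x| <= C) ->
  ('E_P[fun w => f (Y n w)]%E @[n --> \oo] --> (\int[mu]_x (f x)%:E)%E) <->
  (\int[P]_w f (Y n w) @[n --> \oo] --> \int[mu]_x f x).
Proof.
move=> mY cf fC.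
have mf : measurable_fun [set: measurableTypeR R] f by exact: continuous_measurable_fun.
have fin n : 'E_P[fun w => f (Y n w)]%E \is a fin_num.
  rewrite unlock; apply: integrable_fin_num => //.
  exact: (bounded_integrable P (measurableT_comp mf (mY n)) (fun w => fC (Y n w))).
have finmu : (\int[mu]_x (f x)%:E)%E \is a fin_num.
  by apply: integrable_fin_num => //; exact: (bounded_integrable mu mf fC).
have -> : (fun n => \int[P]_w f (Y n w)) = (fun n => fine 'E_P[fun w => f (Y n w)]%E).
  by apply/funext => n; rewrite unlock.
rewrite -[in X in X <-> _](fineK finmu); split.
  by move=> /fine_cvgP[].
by move=> h; apply/fine_cvgP; split=> //; exact: nearW.
Qed.

Lemma cvg_law_slutsky (Y U : nat -> Om -> R) (mu : probability (measurableTypeR R) R) :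
  (forall n, measurable_fun setT (Y n)) -> (forall n, measurable_fun setT (U n)) ->
  (forall e : R, 0 < e -> P [set w | e < `|Y n w - U n w|] @[n --> \oo] --> 0%E) ->
  cvg_law P U mu -> cvg_law P Y mu.
Proof.
move=> mY mU YU lawU f cf [C fC].
have C0 : 0 <= C by apply: le_trans (fC 0).
have mf : measurable_fun [set: measurableTypeR R] f by exact: continuous_measurable_fun.
apply/(Rintegral_cvg_law mu mY cf fC).
have /(Rintegral_cvg_law mu mU cf fC) cU : 'E_P[fun w => f (U n w)]%E @[n --> \oo] -->
  (\int[mu]_x (f x)%:E)%E by apply: lawU => //; exists C.
suff d0 : \int[P]_w f (Y n w) - \int[P]_w f (U n w) @[n --> \oo] --> (0 : R).
  rewrite -[X in _ --> X]add0r.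
  rewrite (_ : (fun n => _) = (fun n => (\int[P]_w f (Y n w) - \int[P]_w f (U n w)) +
    \int[P]_w f (U n w))); first exact: cvgD.
  by apply/funext => n; rewrite subrK.
apply/cvgrPdist_le => e e0.
have C1 : 0 < 8 * (C + 1) by rewrite mulr_gt0// ltr_wpDl.
(* Three such units are spent: one on the probability that [Y n] and [U n] are far apart, two on the
   tail of [U n]. Multiplied by [2 * C] they stay below [6 * e / 8], and uniform continuity takes
   the other [e / 4]. *)
have e1 : 0 < e / (8 * (C + 1)) by rewrite divr_gt0.
have [K [K0 tailK]] := tail_cutoff_small mu e1.
have tc := @tail_cutoff_continuous K.
have tb x : `|tail_cutoff K x| <= 1 by rewrite ger0_norm ?tail_cutoff_ge0 ?tail_cutoff_le1.
have /(Rintegral_cvg_law mu mU tc tb)/cvgrPdist_le/(_ _ e1) nearT :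
    'E_P[fun w => tail_cutoff K (U n w)]%E @[n --> \oo] --> (\int[mu]_x (tail_cutoff K x)%:E)%E.
  by apply: lawU => //; exists 1.
have e2 : 0 < e / 4 by rewrite divr_gt0.
(* Outside the tail [|U n| < K + 1], and [del <= 1] keeps [Y n] within [K + 2]. *)
have [del0 del00 unif] := uniformly_continuous_segment (K + 2) cf e2.
pose del := Num.min del0 1.
have del_gt0 : 0 < del by rewrite lt_min del00 ltr01.
have /fine_cvgP[finP /cvgrPdist_le/(_ _ e1) nearP] := YU del del_gt0.
near=> n.
have hT : `|\int[mu]_x tail_cutoff K x - \int[P]_w tail_cutoff K (U n w)| <= e / (8 * (C + 1)).
  by near: n.
have hP : `|0 - fine (P [set w | del < `|Y n w - U n w|])| <= e / (8 * (C + 1)).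
  by near: n.
rewrite sub0r normrN.
pose Bad := [set w | del < `|Y n w - U n w|].
have mYU : measurable_fun setT (fun w => `|Y n w - U n w|).
  by apply: measurableT_comp => //; exact: measurable_funB.
have mBad : measurable Bad.
  rewrite -[Bad]setTI; have := measurable_fun_ltr (measurable_cst del) mYU.
  by move=> /(_ measurableT [set true]); apply.
have ifY : P.-integrable setT (EFin \o (fun w => f (Y n w))).
  exact: (bounded_integrable P (measurableT_comp mf (mY n)) (fun w => fC (Y n w))).
have ifU : P.-integrable setT (EFin \o (fun w => f (U n w))).
  exact: (bounded_integrable P (measurableT_comp mf (mU n)) (fun w => fC (U n w))).
have mtc : measurable_fun [set: measurableTypeR R] (tail_cutoff K).
  by apply: continuous_measurable_fun.
have ifT : P.-integrable setT (EFin \o (fun w => tail_cutoff K (U n w))).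
  exact: (bounded_integrable P (measurableT_comp mtc (mU n)) (fun w => tb (U n w))).
have ifB : P.-integrable setT (EFin \o (\1_Bad : Om -> R)).
  apply: (bounded_integrable P (C := 1)) => //.
  by move=> x; rewrite indicE; case: (_ \in _); rewrite ?normr1 ?normr0.
rewrite -RintegralB//.
have ifYU : P.-integrable setT (EFin \o (fun w => f (Y n w) - f (U n w))).
  exact: (integrableB measurableT ifY ifU).
apply: le_trans (le_normr_Rintegral measurableT ifYU) _.
pose maj w := e / 4 + 2 * C * (\1_Bad w + tail_cutoff K (U n w)).
have icst : P.-integrable setT (EFin \o (fun=> e / 4)).
  by apply/Lfun1_integrable; exact: Lfun_cst.
have iBT : P.-integrable setT
    (EFin \o (fun w => 2 * C * (\1_Bad w + tail_cutoff K (U n w)))).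
  rewrite (_ : EFin \o _ =
      fun w => ((2 * C)%:E * ((\1_Bad w)%:E + (tail_cutoff K (U n w))%:E))%E).
    by apply: integrableZl => //; exact: (integrableD measurableT ifB ifT).
  by apply/funext => w /=; rewrite EFinM EFinD.
have imaj : P.-integrable setT (EFin \o maj).
  exact: (integrableD measurableT icst iBT).
apply: (@le_trans _ _ (\int[P]_w maj w)).
  apply: le_Rintegral => //; first exact: (integrable_norm ifYU).
  move=> w _; rewrite /maj.
  have t0 := tail_cutoff_ge0 K (U n w).
  have two : `|f (Y n w) - f (U n w)| <= 2 * C.
    by apply: le_trans (ler_normB _ _) _; have := fC (Y n w); have := fC (U n w); lra.
  rewrite indicE; have [_|] := boolP (w \in Bad).
    apply: le_trans two _; rewrite mulrDr mulr1.
    have : 0 <= 2 * C * tail_cutoff K (U n w) by rewrite mulr_ge0// mulr_ge0.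
    lra.
  rewrite notin_setE /Bad/= => /negP; rewrite -leNgt le_min => /andP[d1 d2].
  rewrite add0r; have [Ubig|Usmall] := leP (K + 1) `|U n w|.
    by rewrite tail_cutoff_eq1// mulr1; apply: le_trans two _; rewrite lerDr ltW.
  have : `|f (Y n w) - f (U n w)| <= e / 4.
    apply: unif => //; last by apply: le_trans (ltW Usmall) _; lra.
    have -> : Y n w = (Y n w - U n w) + U n w by rewrite subrK.
    by apply: le_trans (ler_normD _ _) _; lra.
  move/le_trans; apply; rewrite lerDl mulr_ge0// mulr_ge0//.
have -> : \int[P]_w maj w = e / 4 + 2 * C * (fine (P Bad) + \int[P]_w tail_cutoff K (U n w)).
  rewrite /maj RintegralD//.
  - rewrite Rintegral_cst// RintegralZl//; last exact: (integrableD measurableT ifB ifT).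
    rewrite RintegralD//; congr (_ + _ * (_ + _)).
      by have := probability_setT P; rewrite /= => /(congr1 fine)/= ->; rewrite mulr1.
    by rewrite /Rintegral integral_indic// setIT.
have hB : fine (P Bad) <= e / (8 * (C + 1)).
  by move: hP; rewrite sub0r normrN; apply: le_trans; exact: ler_norm.
have hT2 : \int[P]_w tail_cutoff K (U n w) <= 2 * (e / (8 * (C + 1))).
  move: hT; rewrite ler_norml => /andP[h _]; lra.
have e8 : (C + 1) * (e / (8 * (C + 1))) = e / 8.
  by field; rewrite gt_eqF// ltr_wpDl.
have h3 : 2 * C * (fine (P Bad) + \int[P]_w tail_cutoff K (U n w)) <=
    2 * C * (3 * (e / (8 * (C + 1)))).
  by rewrite ler_wpM2l//; [rewrite mulr_ge0//; lra|lra].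
have h4 : 2 * C * (3 * (e / (8 * (C + 1)))) <= 6 * (e / 8).
  by rewrite -e8; lra.
lra.
Unshelve. all: by end_near. Qed.

End slutsky.

(** * The eigenvalue estimator *)

Section scalar_estimates.
Context {R : realType}.

(** Both bounds come from [ln (1 + x) <= x], the lower one by applying it to [(1 + x)^-1];
    [x >= -1/2] turns the resulting fraction into a quadratic. *)
Lemma ln_linearization (rho l : R) : 0 < rho -> `|l - rho| <= rho / 2 ->
  `|ln l - ln rho - rho^-1 * (l - rho)| <= 2 * (rho^-1 * (l - rho)) ^+ 2.
Proof.
move=> r0 lr; set x := rho^-1 * (l - rho).
have x2 : `|x| <= 2^-1.
  by rewrite normrM gtr0_norm ?invr_gt0// ler_pdivrMl// (mulrC rho) mulrC -[_ * _]/(rho / 2).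
have /andP[x2l x2r] : - 2^-1 <= x <= 2^-1 by rewrite -ler_norml.
have lE : l = rho * (1 + x) by rewrite /x; field; rewrite gt_eqF.
have x1 : 0 < 1 + x by lra.
have -> : ln l - ln rho = ln (1 + x) by rewrite lE lnM ?posrE// addrC addKr.
have up : ln (1 + x) <= x by apply: le_ln1Dx; lra.
have lo : x - 2 * x ^+ 2 <= ln (1 + x).
  have := @le_ln1Dx R ((1 + x)^-1 - 1); rewrite [1 + (_ - 1)]addrC subrK lnV ?posrE// => h.
  have i0 : 0 < (1 + x)^-1 by rewrite invr_gt0.
  have {}h : - ln (1 + x) <= (1 + x)^-1 - 1 by apply: h; lra.
  have h2 : (1 + x)^-1 <= 1 - x + 2 * x ^+ 2.
    rewrite -[leLHS]mul1r ler_pdivrMr//.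
    have := sqr_ge0 x => sq; have : 0 <= (1 + 2 * x) * x ^+ 2 by rewrite mulr_ge0//; lra.
    lra.
  lra.
by rewrite ler_norml; apply/andP; split; have := sqr_ge0 x; lra.
Qed.

Lemma powR_quarter_sqr (n : nat) : (0 < n)%N ->
  Num.sqrt n%:R * (n%:R `^ (- 4%:R^-1)) ^+ 2 = 1 :> R.
Proof.
move=> n0; have np : 0 < n%:R :> R by rewrite ltr0n.
rewrite -powR12_sqrt ?ler0n// -powR_mulrn ?powR_ge0// -powRrM -powRD; last first.
  by rewrite (gt_eqF np) implybT.
by rewrite (_ : _ + _ = 0) ?powRr0//; field.
Qed.

Lemma powR_quarter_le1 (n : nat) : (0 < n)%N -> n%:R `^ (- 4%:R^-1) <= 1 :> R.
Proof.
move=> n0; have p0 := powR_ge0 (n%:R : R) (- 4%:R^-1).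
have s1 : 1 <= Num.sqrt n%:R :> R.
  by rewrite -[X in X <= _]sqrtr1 ler_wsqrtr// ler1n.
rewrite -(@ler_pXn2r _ 2)// ?nnegrE ?expr1n// -[leRHS](powR_quarter_sqr n0).
by rewrite ler_peMl// sqr_ge0.
Qed.

Lemma markov_inequality {d} {T : measurableType d} (P : probability T R)
    (Y : T -> R) (a c : R) : 0 < a -> measurable_fun setT Y ->
  (\int[P]_w (`|Y w|%R)%:E <= c%:E)%E -> (P [set w | (a < `|Y w|)%R] <= (c / a)%:E)%E.
Proof.
move=> a0 mY Yc; have mYE : measurable_fun setT (EFin \o Y) by exact/measurable_EFinP.
have mn : measurable_fun setT (fun w => `|Y w|) by exact: measurableT_comp.
have m1 : measurable [set w | a < `|Y w|].
  rewrite -[X in measurable X]setTI; have := measurable_fun_ltr (measurable_cst a) mn.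
  by move=> /(_ measurableT [set true]); apply.
have m2 : measurable [set w | (a%:E <= `|(EFin \o Y) w|)%E].
  rewrite -[X in measurable X]setTI; have := measurable_fun_ler (measurable_cst a) mn.
  by move=> /(_ measurableT [set true]); apply.
have h := le_integral_abse P measurableT mYE a0; rewrite setTI in h.
rewrite mulrC EFinM lee_pdivlMl//; apply: le_trans Yc; apply: le_trans h.
rewrite lee_pmul2l//; apply: le_measure; rewrite ?inE//.
by move=> w /= /ltW; rewrite lee_fin.
Qed.

Section L1_bounds.
Context {d : measure_display} {T : measurableType d} (P : probability T R).

Lemma integral_abs_add_le (f g : T -> R) (c1 c2 : R) : measurable_fun setT f ->
  measurable_fun setT g -> (\int[P]_w (`|f w|%R)%:E <= c1%:E)%E ->
  (\int[P]_w (`|g w|%R)%:E <= c2%:E)%E ->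
  (\int[P]_w (`|f w + g w|%R)%:E <= (c1 + c2)%:E)%E.
Proof.
move=> mf mg fc gc.
have mf' : measurable_fun setT (fun w => (`|f w|%R)%:E).
  by apply/measurable_EFinP; exact: measurableT_comp.
have mg' : measurable_fun setT (fun w => (`|g w|%R)%:E).
  by apply/measurable_EFinP; exact: measurableT_comp.
apply: (@le_trans _ _ (\int[P]_w ((`|f w|%R)%:E + (`|g w|%R)%:E))%E).
  apply: ge0_le_integral => //.
  - by apply/measurable_EFinP; apply: measurableT_comp => //; exact: measurable_funD.
  - exact: emeasurable_funD.
  - by move=> w _; rewrite -EFinD lee_fin ler_normD.
by rewrite ge0_integralD// EFinD leeD.
Qed.

Lemma integral_abs_scale_le (f : T -> R) (a c : R) : measurable_fun setT f ->
  (\int[P]_w (`|f w|%R)%:E <= c%:E)%E ->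
  (\int[P]_w (`|a * f w|%R)%:E <= (`|a| * c)%:E)%E.
Proof.
move=> mf fc; under eq_integral do rewrite normrM EFinM.
rewrite ge0_integralZl//; last by apply/measurable_EFinP; exact: measurableT_comp.
by rewrite EFinM lee_wpmul2l// lee_fin.
Qed.

Lemma integral_abs_average_le (n : nat) (f : nat -> T -> R) (c : R) : 0 <= c ->
  (forall t, measurable_fun setT (f t)) ->
  (forall t, (\int[P]_w (`|f t w|%R)%:E <= c%:E)%E) ->
  (\int[P]_w (`|n%:R^-1 * \sum_(t < n) f t w|%R)%:E <= c%:E)%E.
Proof.
move=> c0 mf fc.
have sum_le j : (\int[P]_w (`|\sum_(t < j) f t w|%R)%:E <= (j%:R * c)%:E)%E.
  elim: j => [|j IH].
    by rewrite integral0_eq ?mul0r// => w _; rewrite big_ord0 normr0.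
  under eq_integral do rewrite big_ord_recr/=.
  rewrite -natr1 mulrDl mul1r; apply: integral_abs_add_le => //.
  exact: measurable_sum.
have ms : measurable_fun setT (fun w => \sum_(t < n) f t w) by exact: measurable_sum.
have h := integral_abs_scale_le n%:R^-1 ms (sum_le n).
apply: le_trans h _; rewrite lee_fin ger0_norm ?invr_ge0//.
have [->|n0] := posnP n; first by rewrite mul0r mulr0.
by rewrite mulKf// pnatr_eq0 -lt0n.
Qed.

End L1_bounds.

(** Needed because the expansion is proved in orthonormal coordinates, whereas [rhohat] is defined
    from the raw sample matrices. *)
Lemma gen_eigenvalue_conj k (H A B : 'M[R]_k) l : H \in unitmx -> H^T = H ->
  gen_eigenvalue (H *m A *m H) (H *m B *m H) l <-> gen_eigenvalue A B l.
Proof.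
move=> uH HT; split=> [[v v0 e]|[v v0 e]].
- exists (H *m v); first by apply: contra_neq v0 => h; rewrite -(mulKmx uH v) h mulmx0.
  apply: (can_inj (mulKmx uH)); rewrite !mulmxA e -!mulmxA.
  by rewrite -scalemxAr !mulmxA.
- exists (invmx H *m v); first by apply: contra_neq v0 => h; rewrite -(mulKVmx uH v) h mulmx0.
  by rewrite -!mulmxA mulKVmx// e -!scalemxAr.
Qed.

Lemma largest_gen_eigenvalue_conj k (H A B : 'M[R]_k) l : H \in unitmx -> H^T = H ->
  largest_gen_eigenvalue (H *m A *m H) (H *m B *m H) l -> largest_gen_eigenvalue A B l.
Proof.
move=> uH HT [h1 h2]; split; first exact/(gen_eigenvalue_conj _ _ _ uH HT).
by move=> l' /(gen_eigenvalue_conj _ _ _ uH HT) /h2.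
Qed.

End scalar_estimates.

Section sample_matrices.
Context {R : realType} {d : measure_display} {S : measurableType d} {k : nat}.
Variable b : 'I_k -> S -> R.

Lemma dot_outer (u v : 'cV[R]_k) x y :
  dot u (bvec b x *m (bvec b y)^T *m v) = (\sum_i u i 0 * b i x) * (\sum_i v i 0 * b i y).
Proof.
have -> : bvec b x *m (bvec b y)^T *m v = (\sum_i v i 0 * b i y) *: bvec b x.
  apply/matrixP => i j; rewrite ord1 -mulmxA !mxE big_ord1 !mxE mulrC; congr (_ * _).
  by apply: eq_bigr => l _; rewrite !mxE mulrC.
by rewrite dotZr mulrC; congr (_ * _); apply: eq_bigr => i _; rewrite mxE.
Qed.

Lemma dot_sum (u : 'cV[R]_k) n (v : 'I_n -> 'cV[R]_k) :
  dot u (\sum_t v t) = \sum_t dot u (v t).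
Proof.
elim/big_rec2: _ => [|t y z _ <-]; last by rewrite dotDr.
by rewrite -(scale0r 0) dotZr mul0r.
Qed.

End sample_matrices.

Section sample_matrices_measurable.
Context {R : realType} {dO : measure_display} {Om : measurableType dO}
  {d : measure_display} {S : measurableType d} {k : nat}.
Variables (P : probability Om R) (X : nat -> {RV P >-> S}) (m : S * S -> R).
Variable (b : 'I_k -> S -> R).
Hypothesis b_meas : forall i, measurable_fun setT (b i).
Hypothesis m_meas : measurable_fun setT m.

Let mX t : measurable_fun setT (X t).
Proof. exact: measurable_funPT. Qed.

Lemma measurable_sandwich (H C : 'M[R]_k) (A : Om -> 'M[R]_k) i j :
  (forall i j, measurable_fun setT (fun w => A w i j)) ->
  measurable_fun setT (fun w => (H *m A w *m H - C) i j).
Proof.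
move=> mA; rewrite (_ : (fun w => _) = fun w =>
  \sum_l (\sum_l' H i l' * A w l' l) * H l j - C i j).
  apply: measurable_funB => //; apply: measurable_sum => l; apply: measurable_funM => //.
  by apply: measurable_sum => l'; exact: measurable_funM.
apply/funext => w; rewrite !mxE; congr (_ - _); apply: eq_bigr => l _.
by rewrite mxE.
Qed.

Lemma measurable_Ghat n i j : measurable_fun setT (fun w => Ghat X b n w i j).
Proof.
rewrite (_ : (fun w => _) = fun w => n%:R^-1 * \sum_(t < n) b i (X t w) * b j (X t w)).
  apply: measurable_funM => //; apply: measurable_sum => t.
  by apply: measurable_funM; exact: (measurableT_comp (b_meas _)).
apply/funext => w; rewrite mxE summxE; congr (_ * _); apply: eq_bigr => t _.
by rewrite mxE big_ord1 !mxE.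
Qed.

Lemma measurable_Mhat n i j : measurable_fun setT (fun w => Mhat X m b n w i j).
Proof.
rewrite (_ : (fun w => _) = fun w => n%:R^-1 *
    \sum_(t < n) m (X t w, X t.+1 w) * (b i (X t w) * b j (X t.+1 w))).
  apply: measurable_funM => //; apply: measurable_sum => t.
  apply: measurable_funM.
    by apply: (measurableT_comp m_meas); exact: measurable_fun_pair.
  by apply: measurable_funM; exact: (measurableT_comp (b_meas _)).
apply/funext => w; rewrite mxE summxE; congr (_ * _); apply: eq_bigr => t _.
by rewrite mxE mxE big_ord1 !mxE.
Qed.

End sample_matrices_measurable.

Section eigenvalue_estimator.
Context {R : realType} {dO : measure_display} {Om : measurableType dO}
  {d : measure_display} {S : measurableType d}.
Variables (P : probability Om R) (X : nat -> {RV P >-> S}).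
Variables (kappa : R.-pker S ~> S) (Q : probability S R) (m : S * S -> R).
Hypothesis X_markov : homogeneous_markov P X kappa.
Hypothesis X_law : forall t A, measurable A -> P (X t @^-1` A) = Q A.
Hypothesis m_meas : measurable_fun setT m.
Hypothesis m_gt0 : forall z, 0 < m z.
Hypothesis M_defined : Mop_defined Q kappa m.
Hypothesis M_bounded : bounded_op Q (Mop kappa m).
Variable Mstar : (S -> R) -> S -> R.
Hypothesis M_adjoint : is_adjoint Q (Mop kappa m) Mstar.
Variables (b : forall k, 'I_k -> S -> R) (H : forall k, 'M[R]_k).
Arguments b : clear implicits.
Variables (Pi : nat -> (S -> R) -> S -> R) (k : nat -> nat).
Hypothesis bL2 : forall n i, L2 Q (b n i).
Hypothesis H_inv_sqrt : forall n, is_inv_sqrt (Gmat P X (b n)) (H n).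
Hypothesis Pi_proj : forall n, orth_projection Q (b n) (Pi n).
Hypothesis Pi_M_cvg :
  opnorm Q (fun f x => Pi (k n) (Mop kappa m f) x - Mop kappa m f x) @[n --> \oo] --> (0%E : \bar R).
Variables (phi phis : S -> R) (rho : R).
Hypotheses (phiL2 : L2 Q phi) (phisL2 : L2 Q phis) (rho_gt0 : 0 < rho).
Hypothesis M_phi : Mop kappa m phi = (fun x => rho * phi x) %[ae Q].
Hypothesis Mstar_phis : Mstar phis = (fun x => rho * phis x) %[ae Q].
Hypothesis rho_simple : simple_eigenvalue Q (Mop kappa m) rho.
Hypothesis rho_largest : largest_eigenvalue Q (Mop kappa m) rho.
Hypothesis phi_norm : L2norm Q phi = 1.
Hypothesis phi_phis : inner Q phi phis = 1.
Hypothesis Pi_phi_cvg :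
  Num.sqrt n%:R * L2norm Q (fun x => Pi (k n) phi x - phi x) @[n --> \oo] --> (0 : R).
Hypothesis Pi_phis_cvg :
  Num.sqrt n%:R * L2norm Q (fun x => Pi (k n) phis x - phis x) @[n --> \oo] --> (0 : R).
Variable rhohat : nat -> Om -> R.
Hypothesis rhohat_largest : forall n w l,
  largest_gen_eigenvalue (Mhat X m (b (k n)) n w) (Ghat X (b (k n)) n w) l ->
  rhohat n w = l.

Let M := Mop kappa m.
Let M_lin := Mop_linear M_defined.

Definition projection_error n :=
  L2norm Q (fun x => Pi (k n) phi x - phi x) + L2norm Q (fun x => Pi (k n) phis x - phis x).

Lemma projection_error_ge0 n : 0 <= projection_error n.
Proof. by rewrite addr_ge0// L2norm_ge0. Qed.

Lemma sqrt_projection_error_cvg :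
  Num.sqrt n%:R * projection_error n @[n --> \oo] --> (0 : R).
Proof.
rewrite -[X in _ --> X](addr0 0).
under eq_fun do rewrite /projection_error mulrDr.
exact: cvgD.
Qed.

Lemma sqrt_projection_error_small (e : R) : 0 < e -> exists N, forall n, (N <= n)%N ->
  Num.sqrt n%:R * projection_error n <= e.
Proof.
move=> e0; have /cvgrPdist_le/(_ _ e0)[N _ hN] := sqrt_projection_error_cvg.
exists N => n /hN; rewrite /= sub0r normrN; apply: le_trans; exact: ler_norm.
Qed.

Lemma projection_error_small (e : R) : 0 < e -> exists N, forall n, (N <= n)%N ->
  projection_error n <= e.
Proof.
move=> e0; have [N hN] := sqrt_projection_error_small e0.
exists (maxn N 1) => n; rewrite geq_max => /andP[Nn n0].
apply: le_trans (hN n Nn); rewrite ler_peMl ?projection_error_ge0//.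
by rewrite -[X in X <= _]sqrtr1 ler_wsqrtr// ler1n.
Qed.

Lemma projected_M_cvg (e : R) : 0 < e -> exists N, forall n, (N <= n)%N ->
  forall f, L2 Q f -> L2norm Q f <= 1 -> L2norm Q (fun x => Pi (k n) (M f) x - M f x) <= e.
Proof.
move=> e0; have /fine_cvgP[[N1 _ fin] /cvgrPdist_le/(_ _ e0)[N2 _ hN]] := Pi_M_cvg.
exists (maxn N1 N2) => n; rewrite geq_max => /andP[n1 n2] f hf f1.
have hM := op_L2 M_bounded hf.
have PL : L2 Q (Pi (k n) (M f)).
  by have [[c ->] _] := @Pi_proj (k n) _ hM; exact: L2_sum.
rewrite -lee_fin -Lnorm_L2norm; last exact: L2B.
have h := hN n n2; rewrite /= sub0r normrN in h.
apply: (@le_trans _ _ (opnorm Q (fun f x => Pi (k n) (Mop kappa m f) x - Mop kappa m f x))).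
  by apply: ereal_sup_ubound; exists f.
rewrite -(fineK (fin n n1)) lee_fin; apply: le_trans h; exact: ler_norm.
Qed.

Lemma GmatE n : Gmat P X (b n) = \matrix_(i, j) inner Q (b n i) (b n j).
Proof. by apply/matrixP => i j; rewrite !mxE (expectation_marginal X_law 0%N). Qed.

Lemma MmatE n : Mmat P X m (b n) = \matrix_(i, j) inner Q (b n i) (M (b n j)).
Proof.
apply/matrixP => i j; rewrite !mxE.
exact: (expectation_pair X_markov X_law m_meas m_gt0 M_defined M_bounded 0%N).
Qed.

Lemma H_inv_sqrt_inner n :
  is_inv_sqrt (\matrix_(i, j) inner Q (b n i) (b n j)) (H n).
Proof. by rewrite -GmatE. Qed.

Definition sample_moment f g n w : R := n%:R^-1 * \sum_(t < n)
  (f (X t w) * m (X t w, X t.+1 w) * g (X t.+1 w) - rho * f (X t w) * g (X t w)).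

(** The first-order term of the eigenvalue expansion is exactly a sample average, with [phi] and
    [phis] replaced by their projections. *)
Lemma sample_pencil_moment n w (c cs : 'cV[R]_(k n)) :
  dot cs ((H (k n) *m Mhat X m (b (k n)) n w *m H (k n)
           - rho *: (H (k n) *m Ghat X (b (k n)) n w *m H (k n))) *m c) =
  sample_moment (sieve_fun (b (k n)) (H (k n)) cs) (sieve_fun (b (k n)) (H (k n)) c) n w.
Proof.
have [_ HT _ _] := H_inv_sqrt (k n).
set h := H (k n) in HT *; set bb := b (k n).
have sw A : dot cs (h *m A *m h *m c) = dot (h *m cs) (A *m (h *m c)).
  by rewrite dot_mulmxl HT !mulmxA.
rewrite mulmxBl -scalemxAl dotBr dotZr !sw /Mhat /Ghat -!scalemxAl !dotZr !mulmx_suml !dot_sum.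
rewrite mulrCA -mulrBr /sample_moment; congr (_ * _).
rewrite mulr_sumr -sumrB; apply: eq_bigr => t _.
by rewrite -scalemxAl dotZr !dot_outer /sieve_fun; ring.
Qed.

Lemma log_eigenvalue_expansion : exists t D, [/\ 0 < t, 0 <= D & exists N, forall n,
  (N <= n)%N -> forall w delta, 0 <= delta -> delta <= t ->
  mxopnorm (H (k n) *m Ghat X (b (k n)) n w *m H (k n) - 1%:M) <= delta ->
  mxopnorm (H (k n) *m Mhat X m (b (k n)) n w *m H (k n)
            - H (k n) *m Mmat P X m (b (k n)) *m H (k n)) <= delta ->
  `|ln (rhohat n w) - ln rho - rho^-1 * sample_moment (Pi (k n) phis) (Pi (k n) phi) n w| <=
    D * (delta + projection_error n) ^+ 2].
Proof.
have r0 := rho_gt0.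
have [K [K0 [t [D [t0 D0 [N hN]]]]]] := @largest_sample_eigenvalue_expansion R _ S Q b H Pi k
  bL2 H_inv_sqrt_inner Pi_proj M Mstar M_lin M_bounded M_adjoint projected_M_cvg
  phi phis rho phiL2 phisL2 rho_gt0 M_phi Mstar_phis rho_simple rho_largest phi_norm phi_phis
  projection_error_small.
have V0 : 0 < (D + 1) * (4 * (K + 1)) by rewrite !mulr_gt0//; lra.
(* The second bound gives [|l - rho| <= rho / 4], inside the range of [ln_linearization]. *)
pose t1 := Num.min t (rho / ((D + 1) * (4 * (K + 1)))).
have t10 : 0 < t1 by rewrite lt_min t0 divr_gt0.
have [N1 hN1] := projection_error_small t10.
(* The terms [rho^-1 * D] and [2 * (rho^-1 * D) ^+ 2] come from the eigenvalue remainder and from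
   the logarithm; [(1 + K) ^+ 2] replaces [delta + K * p] by [delta + p]. *)
exists t1, ((rho^-1 * D + 2 * (rho^-1 * D) ^+ 2) * (1 + K) ^+ 2); split => //.
  by rewrite mulr_ge0 ?sqr_ge0// addr_ge0 ?mulr_ge0 ?sqr_ge0 ?invr_ge0 ?(ltW r0).
exists (maxn N N1) => n; rewrite geq_max => /andP[nN nN1] w delta d0 dt hG hM.
move: dt; rewrite le_min => /andP[dt dt2].
have hI := H_inv_sqrt_inner (k n).
have [c Pc hc] := projection_coords (@bL2 (k n)) hI (@Pi_proj (k n)) phiL2.
have [cs Pcs hcs] := projection_coords (@bL2 (k n)) hI (@Pi_proj (k n)) phisL2.
set G1 := H (k n) *m Ghat X (b (k n)) n w *m H (k n) in hG.
set M1 := H (k n) *m Mhat X m (b (k n)) n w *m H (k n) in hM.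
have [||l [l1 l2 l3]] := hN n nN M1 G1 c cs delta (conj Pc hc) (conj Pcs hcs) d0 dt.
- move=> v; rewrite -[X in _ - X]mul1mx -mulmxBl; apply: le_trans (vnorm_mulmx_le _ _) _.
  exact: (ler_wpM2r (vnorm_ge0 v) hG).
- move=> v; rewrite -mulmxBl; apply: le_trans (vnorm_mulmx_le _ _) _.
  by rewrite /sieve_op -MmatE; exact: (ler_wpM2r (vnorm_ge0 v) hM).
have uH := inv_sqrt_unit hI; have [_ HT _ _] := hI.
have -> : rhohat n w = l by apply: rhohat_largest; exact: (largest_gen_eigenvalue_conj uH HT l1).
rewrite /M1 /G1 sample_pencil_moment -Pc -Pcs in l3.
set p := projection_error n; set T := sample_moment _ _ n w in l3 *.
have p0 : 0 <= p := projection_error_ge0 n.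
set kap := delta + K * p in l2 l3.
have kap0 : 0 <= kap by rewrite addr_ge0// mulr_ge0// ltW.
have pt : p <= rho / ((D + 1) * (4 * (K + 1))).
  by apply: le_trans (hN1 n nN1) _; rewrite ge_min lexx orbT.
have lr : `|l - rho| <= rho / 2.
  apply: le_trans l2 _.
  have kt : kap <= (1 + K) * (rho / ((D + 1) * (4 * (K + 1)))).
    rewrite mulrDl mul1r lerD// ler_wpM2l// ltW//.
  have : D * kap <= (D + 1) * ((1 + K) * (rho / ((D + 1) * (4 * (K + 1))))).
    by apply: ler_pM => //; rewrite lerDl.
  have -> : (D + 1) * ((1 + K) * (rho / ((D + 1) * (4 * (K + 1))))) = rho / 4.
    by field; rewrite !gt_eqF//; lra.
  lra.
have lnl := ln_linearization r0 lr.
have i0 : 0 < rho^-1 by rewrite invr_gt0.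
have -> : ln l - ln rho - rho^-1 * T =
  (ln l - ln rho - rho^-1 * (l - rho)) + rho^-1 * (l - rho - T) by ring.
apply: le_trans (ler_normD _ _) _.
have q1 : `|rho^-1 * (l - rho - T)| <= rho^-1 * D * kap ^+ 2.
  by rewrite normrM (gtr0_norm i0) -mulrA ler_wpM2l// ltW.
have q2 : 2 * (rho^-1 * (l - rho)) ^+ 2 <= 2 * (rho^-1 * D) ^+ 2 * kap ^+ 2.
  rewrite -mulrA -exprMn ler_wpM2l// -[leLHS]real_normK ?num_real//.
  rewrite ler_pXn2r ?nnegrE ?mulr_ge0 ?(ltW i0)//.
  by rewrite normrM (gtr0_norm i0) -mulrA ler_wpM2l// ltW.
have q3 : kap ^+ 2 <= (1 + K) ^+ 2 * (delta + p) ^+ 2.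
  have Kd0 := mulr_ge0 (ltW K0) d0; have Kp0 := mulr_ge0 (ltW K0) p0.
  by rewrite -exprMn ler_pXn2r ?nnegrE// /kap; lra.
apply: le_trans (lerD (le_trans lnl q2) q1) _.
rewrite addrC -mulrDl -mulrA ler_wpM2l//.
by rewrite addr_ge0 ?mulr_ge0 ?sqr_ge0 ?(ltW i0).
Qed.


Hypothesis rhohat_meas : forall n, measurable_fun setT (rhohat n).
Hypothesis dev_G : small_op P (fun n w =>
  mxopnorm (H (k n) *m Ghat X (b (k n)) n w *m H (k n) - 1%:M))
  (fun n => n%:R `^ (- 4%:R^-1)).
Hypothesis dev_M : small_op P (fun n w =>
  mxopnorm (H (k n) *m Mhat X m (b (k n)) n w *m H (k n)
            - H (k n) *m Mmat P X m (b (k n)) *m H (k n)))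
  (fun n => n%:R `^ (- 4%:R^-1)).

Let mX t : measurable_fun setT (X t).
Proof. exact: measurable_funPT. Qed.

Lemma measurable_sample_term (f g : S -> R) t : measurable_fun setT f ->
  measurable_fun setT g ->
  measurable_fun setT (fun w => f (X t w) * m (X t w, X t.+1 w) * g (X t.+1 w)).
Proof.
move=> mf mg; apply: measurable_funM; first apply: measurable_funM.
- exact: (measurableT_comp mf).
- by apply: (measurableT_comp m_meas); exact: measurable_fun_pair.
- exact: (measurableT_comp mg).
Qed.

Lemma measurable_marginal_term (f g : S -> R) t : measurable_fun setT f ->
  measurable_fun setT g -> measurable_fun setT (fun w => f (X t w) * g (X t w)).
Proof. by move=> mf mg; apply: measurable_funM; exact: measurableT_comp. Qed.

Lemma measurable_sample_moment f g n : measurable_fun setT f -> measurable_fun setT g ->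
  measurable_fun setT (sample_moment f g n).
Proof.
move=> mf mg; apply: measurable_funM => //; apply: measurable_sum => t.
apply: measurable_funB; first exact: measurable_sample_term.
rewrite (_ : (fun w => _) = fun w => rho * (f (X t w) * g (X t w))).
  by apply: measurable_funM => //; exact: measurable_marginal_term.
by apply/funext => w; rewrite mulrA.
Qed.

Lemma projection_L2norm_le f n : L2 Q f ->
  L2 Q (Pi (k n) f) /\ L2norm Q (Pi (k n) f) <= L2norm Q f.
Proof.
move=> hf; have hI := H_inv_sqrt_inner (k n).
have [c -> hc] := projection_coords (@bL2 (k n)) hI (@Pi_proj (k n)) hf.
split; first exact: sieve_fun_L2.
rewrite (L2norm_sieve_fun (@bL2 (k n)) hI).
exact: (vnorm_coords_le (@bL2 (k n)) hI hf hc).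
Qed.

(** The two factors are replaced one at a time, so every term contains one projection error. The L^1
    bounds are the same at all dates and pass to the average whatever the dependence between
    dates. *)
Lemma sample_moment_projection_error : exists2 C, 0 <= C & forall n,
  (\int[P]_w (`|sample_moment (Pi (k n) phis) (Pi (k n) phi) n w
               - sample_moment phis phi n w|)%:E <= (C * projection_error n)%:E)%E.
Proof.
have r0 := rho_gt0.
have [K K0 hK] := bounded_op_ge0 M_bounded.
have hK' f (hf : L2 Q f) := (hK f hf).2.
have B0 := L2norm_ge0 Q phis.
exists ((K + rho) * (1 + L2norm Q phis)) => [|n]; first by rewrite mulr_ge0//; lra.
have [f'L f'B] := projection_L2norm_le n phisL2.
have [g'L g'B] := projection_L2norm_le n phiL2.
rewrite phi_norm in g'B.
set f' := Pi (k n) phis in f'L f'B *; set g' := Pi (k n) phi in g'L g'B *.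
pose df x := f' x - phis x; pose dg x := g' x - phi x.
have dfL : L2 Q df by exact: L2B.
have dgL : L2 Q dg by exact: L2B.
have mdf := L2_measurable dfL; have mdg := L2_measurable dgL.
have mg' := L2_measurable g'L; have mphis := L2_measurable phisL2.
have df_le : L2norm Q df <= projection_error n by rewrite lerDr L2norm_ge0.
have dg_le : L2norm Q dg <= projection_error n by rewrite lerDl L2norm_ge0.
have p0 := projection_error_ge0 n; set p := projection_error n in p0 df_le dg_le *.
pose u1 t w := df (X t w) * m (X t w, X t.+1 w) * g' (X t.+1 w).
pose u2 t w := phis (X t w) * m (X t w, X t.+1 w) * dg (X t.+1 w).
pose u3 t w := df (X t w) * g' (X t w).
pose u4 t w := phis (X t w) * dg (X t w).
have mu1 t : measurable_fun setT (u1 t) by exact: measurable_sample_term.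
have mu2 t : measurable_fun setT (u2 t) by exact: measurable_sample_term.
have mu3 t : measurable_fun setT (u3 t) by exact: measurable_marginal_term.
have mu4 t : measurable_fun setT (u4 t) by exact: measurable_marginal_term.
have iu1 t : (\int[P]_w (`|u1 t w|)%:E <= (K * p)%:E)%E.
  apply: le_trans (integral_pair_abs_le X_markov X_law m_meas m_gt0 M_defined M_bounded t hK' dfL g'L) _.
  rewrite lee_fin ler_wpM2l//; rewrite -[leRHS]mulr1.
  by apply: ler_pM; rewrite ?L2norm_ge0.
have iu2 t : (\int[P]_w (`|u2 t w|)%:E <= (K * (L2norm Q phis * p))%:E)%E.
  apply: le_trans (integral_pair_abs_le X_markov X_law m_meas m_gt0 M_defined M_bounded t hK' phisL2 dgL) _.
  by rewrite lee_fin ler_wpM2l// ler_wpM2l.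
have iu3 t : (\int[P]_w (`|u3 t w|)%:E <= p%:E)%E.
  apply: le_trans (integral_marginal_abs_le X_law t dfL g'L) _.
  by rewrite lee_fin -[leRHS]mulr1; apply: ler_pM; rewrite ?L2norm_ge0.
have iu4 t : (\int[P]_w (`|u4 t w|)%:E <= (L2norm Q phis * p)%:E)%E.
  apply: le_trans (integral_marginal_abs_le X_law t phisL2 dgL) _.
  by rewrite lee_fin ler_wpM2l.
pose u t w := (u1 t w + u2 t w) + (- rho) * (u3 t w + u4 t w).
have m12 t : measurable_fun setT (fun w => u1 t w + u2 t w) by exact: measurable_funD.
have m34 t : measurable_fun setT (fun w => u3 t w + u4 t w) by exact: measurable_funD.
have m34' t : measurable_fun setT (fun w => (- rho) * (u3 t w + u4 t w)).
  exact: measurable_funM.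
have mu t : measurable_fun setT (u t) by exact: measurable_funD.
have iu t : (\int[P]_w (`|u t w|)%:E <= ((K + rho) * (1 + L2norm Q phis) * p)%:E)%E.
  have h12 := integral_abs_add_le (mu1 t) (mu2 t) (iu1 t) (iu2 t).
  have h34 := integral_abs_add_le (mu3 t) (mu4 t) (iu3 t) (iu4 t).
  have h34' := integral_abs_scale_le (- rho) (m34 t) h34.
  apply: le_trans (integral_abs_add_le (m12 t) (m34' t) h12 h34') _.
  by rewrite lee_fin normrN gtr0_norm// le_eqVlt; apply/orP; left; apply/eqP; ring.
have h := integral_abs_average_le n _ mu iu.
apply: le_trans (h _); last by rewrite !mulr_ge0//; lra.
rewrite le_eqVlt; apply/orP; left; apply/eqP; apply: eq_integral => w _.
congr (`| _ |%:E); rewrite /sample_moment -mulrBr -sumrB; congr (_ * _).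
by apply: eq_bigr => t _; rewrite /u /u1 /u2 /u3 /u4 /df /dg; ring.
Qed.

(** [Y] is the statistic of interest, [Z] the vector of the assumed central limit theorem, and [U]
    its linear form with coefficients [hbar rho]. *)
Let Y n w := Num.sqrt n%:R * (Lhat X m rhohat n w - Lpop P X m rho).
Let Z n w : R * R :=
  ((Num.sqrt n%:R)^-1 * \sum_(t < n) psi_rho X m phi phis rho t w,
   (Num.sqrt n%:R)^-1 * \sum_(t < n) psi_lm P X m t w).
Let U n w := rho^-1 * (Z n w).1 + (-1) * (Z n w).2.

(** An exact identity: the averages of log m cancel, so only the expansion of [ln rhohat]
    remains. *)
Lemma estimator_difference n w : (0 < n)%N -> Y n w - U n w =
  Num.sqrt n%:R * (ln (rhohat n w) - ln rho - rho^-1 * sample_moment phis phi n w).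
Proof.
move=> n0; have np : 0 < n%:R :> R by rewrite ltr0n.
have s0 : 0 < Num.sqrt n%:R :> R by rewrite sqrtr_gt0.
have nE : n%:R = Num.sqrt n%:R * Num.sqrt n%:R :> R by rewrite -expr2 sqr_sqrtr// ltW.
rewrite /Y /U /Z /= /Lhat /Lpop /sample_moment.
have -> : \sum_(t < n) psi_lm P X m t w =
    \sum_(t < n) ln (m (X t w, X t.+1 w)) - n%:R * Elogm P X m.
  by rewrite /psi_lm big_split/= sumr_const card_ord mulr_natl mulNrn.
have alg (y n' lr lrho A B EL ri : R) : y != 0 -> n' = y * y ->
    y * ((lr - n'^-1 * A) - (lrho - EL)) - (ri * (y^-1 * B) + (-1) * (y^-1 * (A - n' * EL))) =
    y * (lr - lrho - ri * (n'^-1 * B)).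
  by move=> y0 ->; field; rewrite y0.
by apply: alg => //; rewrite gt_eqF.
Qed.

Lemma measurable_Y n : measurable_fun setT (Y n).
Proof.
rewrite /Y /Lhat; apply: measurable_funM => //; apply: measurable_funB => //.
apply: measurable_funB.
  by apply: measurableT_comp; [exact: measurable_ln|exact: rhohat_meas].
apply: measurable_funM => //; apply: measurable_sum => t.
apply: measurableT_comp; [exact: measurable_ln|apply: (measurableT_comp m_meas)].
exact: measurable_fun_pair.
Qed.

Lemma measurable_U n : measurable_fun setT (U n).
Proof.
have mphi := L2_measurable phiL2; have mphis := L2_measurable phisL2.
apply: measurable_funD; apply: measurable_funM => //; apply: measurable_funM => //;
  apply: measurable_sum => t; apply: measurable_funB => //.
- exact: measurable_sample_term.
- rewrite (_ : (fun w => _) = fun w => rho * (phis (X t w) * phi (X t w))).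
    by apply: measurable_funM => //; exact: measurable_marginal_term.
  by apply/funext => w; rewrite mulrA.
- apply: measurableT_comp; [exact: measurable_ln|apply: (measurableT_comp m_meas)].
  exact: measurable_fun_pair.
Qed.

Lemma estimator_difference_cvg (e : R) : 0 < e ->
  P [set w | e < `|Y n w - U n w|] @[n --> \oo] --> 0%E.
Proof.
move=> e0; have r0 := rho_gt0.
have [t [D [t0 D0 [N hN]]]] := log_eigenvalue_expansion.
have [C C0 hC] := sample_moment_projection_error.
have D8 : 0 < 8 * (D + 1) by lra.
(* [s <= 1] and the last bound give [D * s ^+ 2 <= e / 8], while [s <= t] admits [s * n^(-1/4)] as
   the deviation in [log_eigenvalue_expansion]. *)
pose s := Num.min t (Num.min 1 (e / (8 * (D + 1)))).
have s0 : 0 < s by rewrite !lt_min t0 ltr01 divr_gt0.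
have st : s <= t by rewrite ge_min lexx.
have s1 : s <= 1 by rewrite !ge_min lexx orbT.
have se : s <= e / (8 * (D + 1)) by rewrite !ge_min lexx !orbT.
have e8 : 0 < e / (8 * (D + 1)) by rewrite divr_gt0.
have De8 : D * (e / (8 * (D + 1))) <= e / 8.
  have -> : e / 8 = (D + 1) * (e / (8 * (D + 1))) by field; rewrite gt_eqF//; lra.
  by rewrite ler_wpM2r ?(ltW e8)// lerDl.
have [N1 hN1] := projection_error_small ltr01.
have [N2 hN2] := sqrt_projection_error_small e8.
pose BG n := [set w | s * n%:R `^ (- 4%:R^-1) <
  `|mxopnorm (H (k n) *m Ghat X (b (k n)) n w *m H (k n) - 1%:M)|].
pose BM n := [set w | s * n%:R `^ (- 4%:R^-1) <
  `|mxopnorm (H (k n) *m Mhat X m (b (k n)) n w *m H (k n)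
            - H (k n) *m Mmat P X m (b (k n)) *m H (k n))|].
pose r n w := sample_moment (Pi (k n) phis) (Pi (k n) phi) n w - sample_moment phis phi n w.
(* Below this threshold, replacing the projections by [phi] and [phis] contributes at most [e / 2]
   after scaling by the square root of n and [rho^-1]. *)
pose a n := rho * e / 2 / Num.sqrt n%:R.
pose BR n := [set w | a n < `|r n w|].
have mb l i : measurable_fun setT (b l i) := L2_measurable (@bL2 l i).
have mBG n : measurable (BG n).
  apply: measurable_mxopnorm_gt => i j; apply: measurable_sandwich => i' j'.
  exact: (measurable_Ghat X (mb (k n))).
have mBM n : measurable (BM n).
  apply: measurable_mxopnorm_gt => i j; apply: measurable_sandwich => i' j'.
  exact: (measurable_Mhat X (mb (k n)) m_meas).
have mr n : measurable_fun setT (r n).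
  have [h1 _] := projection_L2norm_le n phisL2; have [h2 _] := projection_L2norm_le n phiL2.
  exact: (measurable_funB (measurable_sample_moment n (L2_measurable h1) (L2_measurable h2))
    (measurable_sample_moment n (L2_measurable phisL2) (L2_measurable phiL2))).
have mgt (f : Om -> R) c : measurable_fun setT f -> measurable [set w | c < `|f w|].
  move=> mf; rewrite -[X in measurable X]setTI.
  have mf' : measurable_fun setT (fun w => `|f w|) by exact: measurableT_comp.
  have := measurable_fun_ltr (measurable_cst c) mf'.
  by move=> /(_ measurableT [set true]); apply.
have mBR n : measurable (BR n) by exact: mgt.
have mE n : measurable [set w | e < `|Y n w - U n w|].
  by apply: mgt; apply: measurable_funB; [exact: measurable_Y|exact: measurable_U].
(* Outside the three exceptional sets the remainder contributes [2 * D * s ^+ 2], the square root of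
   n cancelling the squared n^(-1/4), plus twice [D * (Num.sqrt n%:R * p) * p]; together at most
   [e / 2]. *)
have sub n : (maxn 1 (maxn N (maxn N1 N2)) <= n)%N ->
    [set w | e < `|Y n w - U n w|] `<=` BG n `|` BM n `|` BR n.
  rewrite !geq_max => /and4P[n0 nN nN1 nN2] w /= ew; apply: contrapT.
  move=> /not_orP[/not_orP[/negP nG /negP nM] /negP nR].
  rewrite -leNgt in nG; rewrite -leNgt in nM; rewrite -leNgt in nR.
  have q1 := @powR_quarter_le1 R n n0; have q0 := powR_ge0 (n%:R : R) (- 4%:R^-1).
  have qq := @powR_quarter_sqr R n n0; set q := n%:R `^ _ in q1 q0 qq nG nM.
  have sq0 : 0 <= s * q by rewrite mulr_ge0// ltW.
  have sqt : s * q <= t.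
    by apply: le_trans st; rewrite -[leRHS]mulr1 ler_wpM2l// ltW.
  have := hN n nN w (s * q) sq0 sqt (le_trans (ler_norm _) nG) (le_trans (ler_norm _) nM).
  set p := projection_error n; set T := sample_moment (Pi _ _) _ n w => hln.
  have p0 : 0 <= p := projection_error_ge0 n.
  have p1 : p <= 1 := hN1 n nN1.
  have sp := hN2 n nN2; rewrite -/p in sp.
  have sn0 : 0 < Num.sqrt n%:R :> R by rewrite sqrtr_gt0 ltr0n.
  move: ew; apply/negP; rewrite -leNgt estimator_difference//.
  have -> : ln (rhohat n w) - ln rho - rho^-1 * sample_moment phis phi n w =
     (ln (rhohat n w) - ln rho - rho^-1 * T) + rho^-1 * r n w.
    by rewrite /r -/T; ring.
  rewrite mulrDr; apply: le_trans (ler_normD _ _) _; rewrite [leRHS](splitr e) lerD//.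
    rewrite normrM (gtr0_norm sn0).
    apply: (@le_trans _ _ (Num.sqrt n%:R * (D * (2 * (s * q) ^+ 2 + 2 * p ^+ 2)))).
      rewrite ler_wpM2l ?(ltW sn0)//; apply: le_trans hln _; rewrite ler_wpM2l//.
      by have := sqr_ge0 (s * q - p); lra.
    have -> : Num.sqrt n%:R * (D * (2 * (s * q) ^+ 2 + 2 * p ^+ 2)) =
        2 * (D * (s * s)) * (Num.sqrt n%:R * q ^+ 2) + 2 * (D * ((Num.sqrt n%:R * p) * p)).
      by ring.
    rewrite qq mulr1.
    have h1 : D * (s * s) <= D * (e / (8 * (D + 1))).
      rewrite ler_wpM2l// -[leRHS]mulr1; apply: ler_pM => //; exact: ltW.
    have h2 : D * ((Num.sqrt n%:R * p) * p) <= D * (e / (8 * (D + 1))).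
      rewrite ler_wpM2l// -[leRHS]mulr1; apply: ler_pM => //.
      by rewrite mulr_ge0// ltW.
    lra.
  rewrite !normrM (gtr0_norm sn0) gtr0_norm ?invr_gt0//.
  move: nR; rewrite /a ler_pdivlMr// => nR.
  by rewrite mulrCA ler_pdivrMl// [leLHS]mulrC; lra.
(* The last term is Markov's bound for [BR n]: the L^1 error [C * projection_error n] divided by
   [a n]. *)
pose bound n := (P (BG n) + P (BM n) + (C * 2 / (rho * e) * (Num.sqrt n%:R * projection_error n))%:E)%E.
have bound0 : bound n @[n --> \oo] --> 0%E.
  have -> : 0%E = (0 + 0 + (C * 2 / (rho * e) * 0)%:E)%E :> \bar R by rewrite mulr0 !adde0.
  apply: cvgeD; first by [].
    by apply: cvgeD; [by []|exact: dev_G|exact: dev_M].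
  apply: cvg_EFin; first exact: nearW.
  by apply: cvgMl_tmp; exact: sqrt_projection_error_cvg.
apply: (squeeze_cvge _ (cvg_cst 0%E) bound0); near=> n.
have nbig : (maxn 1 (maxn N (maxn N1 N2)) <= n)%N by near: n; exact: nbhs_infty_ge.
apply/andP; split; first exact: measure_ge0.
apply: le_trans (le_measure P _ _ (sub n nbig)) _; rewrite ?inE//.
  exact: (measurableU _ _ (measurableU _ _ (mBG n) (mBM n)) (mBR n)).
apply: le_trans (measureU2 P (measurableU _ _ (mBG n) (mBM n)) (mBR n)) _.
apply: leeD; first exact: (measureU2 P (mBG n) (mBM n)).
have n0 : (0 < n)%N by move: nbig; rewrite geq_max => /andP[].
have sn0 : 0 < Num.sqrt n%:R :> R by rewrite sqrtr_gt0 ltr0n.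
have a0 : 0 < a n by rewrite !divr_gt0// mulr_gt0.
apply: le_trans (markov_inequality a0 (mr n) (hC n)) _.
rewrite lee_fin le_eqVlt; apply/orP; left; apply/eqP; rewrite /a; field.
by rewrite !gt_eqF.
Unshelve. all: by end_near. Qed.

Variables (W : 'M[R]_2)
  (NW : probability (measurableTypeR R * measurableTypeR R)%type R).
Hypothesis NW_normal : is_normal2 W NW.
Hypothesis Z_cvg : cvg_law2 P Z NW.

(** The easy half of the Cramer-Wold device: a test function composed with the linear form is a test
    function on the plane. [is_normal2] prescribes the law of that form under [NW], including the
    degenerate case of variance 0. *)
Lemma estimator_cvg_law :
  cvg_law P Y (normal_law (((hbar rho)^T *m W *m hbar rho) 0 0)).
Proof.
set v := (_ *m _) 0 0.
apply: (cvg_law_slutsky measurable_Y measurable_U estimator_difference_cvg).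
move=> f cf [C fC].
pose lin (z : R * R) := hbar rho 0 0 * z.1 + hbar rho 1 0 * z.2.
have clin : continuous lin.
  by move=> z; apply: cvgD; apply: cvgM; (try exact: cvg_cst); [exact: cvg_fst|exact: cvg_snd].
have cfl : continuous (f \o lin) by move=> z; apply: continuous_comp; [exact: clin|exact: cf].
have := Z_cvg cfl (ex_intro _ C (fun z => fC (lin z))).
have -> : (fun n => 'E_P[fun w => (f \o lin) (Z n w)]%E) = (fun n => 'E_P[fun w => f (U n w)]%E).
  apply/funext => n; congr ('E_P[_]%E); apply/funext => w.
  by rewrite /lin /U /= !mxE.
rewrite (_ : (\int[NW]_z ((f \o lin) z)%:E)%E =
   (\int[normal_law v]_x (f x)%:E)%E)//.
have [_ _ NWlaw] := NW_normal.
have mf : measurable_fun [set: measurableTypeR R] f by exact: continuous_measurable_fun.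
have mlin : measurable_fun [set: (measurableTypeR R * measurableTypeR R)%type]
    (lin : measurableTypeR R * measurableTypeR R -> measurableTypeR R).
  by apply: measurable_funD; apply: measurable_funM.
rewrite -(@integral_pushforward _ _ _ _ _ _ mlin NW setT (EFin \o f))//; last first.
- exact: (bounded_integrable NW (measurableT_comp mf mlin) (fun z => fC (lin z))).
- exact/measurable_EFinP.
apply: eq_measure_integral => B mB _.
exact: NWlaw.
Qed.

End eigenvalue_estimator.

Theorem propositionB1 (R : realType)
  (* probability space and state space, a subset of R^d *)
  (dO : measure_display) (Om : measurableType dO) (P : probability Om R)
  (d : nat) (XX : set (d.-tuple (measurableTypeR R))) (x0 : XX)
  (* Markov process X, transition kernel kappa, stationary distribution Q *)
  (X : nat -> {RV P >-> borel_subspace x0})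
  (kappa : R.-pker (borel_subspace x0) ~> (borel_subspace x0))
  (Q : probability (borel_subspace x0) R)
  (hMarkov : homogeneous_markov P X kappa)
  (hstat : strictly_stationary P X)
  (hergo : ergodic_process P X)
  (hQ : forall t A, measurable A -> P (X t @^-1` A) = Q A)
  (m : borel_subspace x0 * borel_subspace x0 -> R)
  (hm : measurable_fun setT m)
  (hm_gt0 : forall z, 0 < m z)
  (hlogm : P.-integrable setT (fun w => (ln (m (X 0%N w, X 1%N w)))%:E))
  (* the adjoint of Mop kappa m *)
  (Mstar : (borel_subspace x0 -> R) -> borel_subspace x0 -> R)
  (hMstar : is_adjoint Q (Mop kappa m) Mstar)
  (* sieve *)
  (b : forall k, 'I_k -> borel_subspace x0 -> R)
  (hbL2 : forall k (j : 'I_k), L2 Q (b k j))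
  (hbfree : forall k, lin_indep Q (b k))
  (Pi : nat -> (borel_subspace x0 -> R) -> borel_subspace x0 -> R)
  (hPi : forall k, orth_projection Q (b k) (Pi k))
  (k : nat -> nat)
  (hk : k n @[n --> \oo] --> \oo)
  (* Gih K is the matrix G^{-1/2} at sieve dimension K *)
  (Gih : forall K, 'M[R]_K)
  (hGih : forall K, is_inv_sqrt (Gmat P X (b K)) (Gih K))
  (* (A1), with the normalization of phi and phis *)
  (phi phis : borel_subspace x0 -> R) (rho : R)
  (hMdef : Mop_defined Q kappa m)
  (hMbdd : bounded_op Q (Mop kappa m))
  (hphiL2 : L2 Q phi) (hphisL2 : L2 Q phis)
  (hphi_gt0 : ae_positive Q phi) (hphis_gt0 : ae_positive Q phis)
  (hrho_gt0 : 0 < rho)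
  (hphi : Mop kappa m phi = (fun x => rho * phi x) %[ae Q])
  (hphis : Mstar phis = (fun x => rho * phis x) %[ae Q])
  (hphi_uniq : forall f, L2 Q f -> ae_positive Q f ->
     Mop kappa m f = (fun x => rho * f x) %[ae Q] ->
     exists c : R, f = (fun x => c * phi x) %[ae Q])
  (hphis_uniq : forall f, L2 Q f -> ae_positive Q f ->
     Mstar f = (fun x => rho * f x) %[ae Q] ->
     exists c : R, f = (fun x => c * phis x) %[ae Q])
  (hsimple : simple_eigenvalue Q (Mop kappa m) rho)
  (hisolated : isolated_eigenvalue Q (Mop kappa m) rho)
  (hlargest : largest_eigenvalue Q (Mop kappa m) rho)
  (hphi_norm : L2norm Q phi = 1)
  (hphi_phis : inner Q phi phis = 1)
  (hlim : forall psi, L2 Q psi ->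
     {ae Q, forall x, rho ^- tau * iter tau (Mop kappa m) psi x
                        @[tau --> \oo] --> inner Q psi phis * phi x})
  (* (A2) *)
  (hA2 : opnorm Q (fun f x => Pi (k n) (Mop kappa m f) x - Mop kappa m f x)
           @[n --> \oo] --> (0%E : \bar R))
  (* (A3) *)
  (hA3G : small_op P (fun n w =>
     mxopnorm (Gih (k n) *m Ghat X (b (k n)) n w *m Gih (k n) - 1%:M))
     (fun=> 1))
  (hA3M : small_op P (fun n w =>
     mxopnorm (Gih (k n) *m Mhat X m (b (k n)) n w *m Gih (k n)
               - Gih (k n) *m Mmat P X m (b (k n)) *m Gih (k n)))
     (fun=> 1))
  (* (A4) *)
  (hA4a : Num.sqrt n%:R * L2norm Q (fun x => Pi (k n) phi x - phi x)
            @[n --> \oo] --> (0 : R))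
  (hA4a' : Num.sqrt n%:R * L2norm Q (fun x => Pi (k n) phis x - phis x)
            @[n --> \oo] --> (0 : R))
  (hA4bG : small_op P (fun n w =>
     mxopnorm (Gih (k n) *m Ghat X (b (k n)) n w *m Gih (k n) - 1%:M))
     (fun n => n%:R `^ (- 4%:R^-1)))
  (hA4bM : small_op P (fun n w =>
     mxopnorm (Gih (k n) *m Mhat X m (b (k n)) n w *m Gih (k n)
               - Gih (k n) *m Mmat P X m (b (k n)) *m Gih (k n)))
     (fun n => n%:R `^ (- 4%:R^-1)))
  (hA4c : ('E_P[fun w => ((phis (X 0%N w) * m (X 0%N w, X 1%N w)
                          * phi (X 1%N w)) ^+ 2)%R] < +oo)%E)
  (* (A5) *)
  (W : 'M[R]_2)
  (NW : probability (measurableTypeR R * measurableTypeR R)%type R)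
  (hNW : is_normal2 W NW)
  (hA5 : cvg_law2 P (fun n w =>
     ((Num.sqrt n%:R)^-1 * \sum_(t < n) psi_rho X m phi phis rho t w,
      (Num.sqrt n%:R)^-1 * \sum_(t < n) psi_lm P X m t w)) NW)
  (* rhohat is the largest real generalized eigenvalue when there is one, and
     is arbitrary otherwise *)
  (rhohat : nat -> {RV P >-> measurableTypeR R})
  (hrhohat : forall n w l,
     largest_gen_eigenvalue (Mhat X m (b (k n)) n w) (Ghat X (b (k n)) n w) l ->
     rhohat n w = l) :
  cvg_law P
    (fun n w => Num.sqrt n%:R * (Lhat X m rhohat n w - Lpop P X m rho))
    (normal_law (((hbar rho)^T *m W *m hbar rho) 0 0)).
Proof.
exact: (@estimator_cvg_law R dO Om _ (borel_subspace x0) P X kappa Q m hMarkov hQ hm hm_gt0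
  hMdef hMbdd Mstar hMstar b Gih Pi k hbL2 hGih hPi hA2 phi phis rho hphiL2 hphisL2 hrho_gt0
  hphi hphis hsimple hlargest hphi_norm hphi_phis hA4a hA4a' (fun n => rhohat n) hrhohat
  (fun n => measurable_funPT (rhohat n)) hA4bG hA4bM W NW hNW hA5).
Qed.
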